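(* Fix natural numbers $n$ and $i$. The $\mathcal{RT}^{\mathrm{op}}$-module (over $\mathbb{Z}$) $$(T,v)\mapsto H_i\big(\operatorname{UConf}_n(\operatorname{cone}(T));\mathbb{Z}\big)$$ is $(n+i)$-small. In particular, it is finitely generated.
   Context: A tree is a finite nonempty connected acyclic graph. A contraction $\varphi:T\to T'$ of trees is a map on vertex sets such that adjacent vertices of $T$ are sent to equal or adjacent vertices of $T'$, and the preimage of every vertex of $T'$ is the vertex set of a (nonempty, connected) subtree of $T$. A rooted tree $(T,v)$ is a tree with a chosen vertex (the root); $\mathcal{RT}$ is the category of rooted trees with contractions sending root to root. The vertex set of a rooted tree is partially ordered by: $u\le w$ iff the unique path from $u$ to the root passes through $w$ (so the root is maximal). An $\mathcal{RT}^{\mathrm{op}}$-module over $k=\mathbb{Z}$ is a functor $\mathcal{RT}^{\mathrm{op}}\to\mathbb{Z}$-modules. The principal projective $P_S$ has $P_S(T)$ free on $\operatorname{Hom}_{\mathcal{RT}}(T,S)$. A module is finitely generated if it is a quotient of a finite direct sum of principal projectives; generated in degrees $\le d$ if it is a quotient of a finite direct sum $\bigoplus_j P_{T_j}$ with every rooted tree $T_j$ having at most $d$ edges; $d$-small if it is isomorphic to a subquotient of a module generated in degrees $\le d$. Graphs are finite CW complexes of dimension $\le 1$ (multiple edges allowed). $\operatorname{UConf}_n(G)=\{(x_1,\dots,x_n)\in G^n\mid x_a\ne x_b\text{ for }a\neq b\}/S_n$. The graph $\operatorname{cone}(T)$ is obtained from $T$ by adding one new vertex $p$ and, for each vertex $w$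 of $T$, one edge $e_w$ from $w$ to $p$. Reduced Świątkowski complex. Let $A_G$ be the integral polynomial ring generated by the edges of $G$. A half-edge is a pair $h=(v(h),e(h))$ of a vertex and an edge having that vertex as endpoint. For a vertex $v$ let $S(v)$ be the free $A_G$-module on the symbol $\emptyset$ and all half-edges at $v$, bigraded with edges in degree $(0,1)$, $\emptyset$ in degree $(0,0)$, half-edges in degree $(1,1)$. Let $\widetilde S(v)\subset S(v)$ be the submodule generated by $\emptyset$ and all differences $h-h'$ of half-edges at $v$, with $A_G$-linear differential of degree $(-1,0)$ given by $\partial(h-h')=(e(h)-e(h'))\emptyset$, $\partial\emptyset=0$. Put $\widetilde S(G)=\bigotimes_{v}\widetilde S(v)$ (graded tensor product of complexes over $A_G$, over all vertices $v$). By a theorem of An, Drummond-Cole and Knudsen, $H_i(\operatorname{UConf}_n(G);\mathbb{Z})$ is identified with the degree $(i,n)$ part of the homology of $\widetilde S(G)$. Functoriality for embeddings: an embedding of graphs $\iota:G\to G'$ induces the chain map $\widetilde\iota_*:\widetilde S(G)\to\widetilde S(G')$ sending edges and half-edges to their images, $\emptyset$ to $\emptyset$, and inserting $\emptyset$ at vertices not in the image. Functoriality for contractions: for a contraction $\varphi:G\to G'$ of a single non-loop edge (a simple contraction), identify the contracted edge with $[0,1]$, with endpoints the vertices $0,1$ and half-edges $h_0,h_1$ at $0,1$ respectively, and let $w'$ be the image of this edge. Each edge (half-edge) of $G'$ is the image of a unique edge (half-edge) of $G$; this gives a ring map $A_{G'}\to A_G$ and maps $\widetilde S(v')\to\widetilde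 S(v)$ for $v'\ne w'$. Define $\widetilde S(w')\to\widetilde S(0)\otimes\widetilde S(1)$ as the restriction of the $A_{G'}$-linear rule $\emptyset\mapsto\emptyset\otimes\emptyset$ and, for a half-edge $h'$ at $w'$ with corresponding half-edge $h$ of $G$, $h'\mapsto(h-h_0)\otimes\emptyset$ if $v(h)=0$ and $h'\mapsto\emptyset\otimes(h-h_1)$ if $v(h)=1$. Tensoring these gives a chain map $\widetilde\varphi^*:\widetilde S(G')\to\widetilde S(G)$; for a contraction of several edges (forming a forest) compose the maps for simple contractions (independent of the factorization). Module structure. Let $\varphi:(T,v)\to(T',v')$ be a morphism in $\mathcal{RT}$. Let $G_\varphi$ be the graph with vertices $\operatorname{Vert}(T')\sqcup\{p'\}$ and edges $\operatorname{Edge}(T')\sqcup\{e'_w\mid w\in\operatorname{Vert}(T)\}$, where $e'_w$ joins $\varphi(w)$ to $p'$. There is a contraction $\pi_\varphi:\operatorname{cone}(T)\to G_\varphi$ extending $\varphi$, with $p\mapsto p'$ and $e_w\mapsto e'_w$, and an embedding $\iota^\varphi:\operatorname{cone}(T')\to G_\varphi$ that is the identity on $T'$, sends the cone point to $p'$, and sends $e_{w'}$ to $e'_w$, where $w$ is the unique maximal vertex of $\varphi^{-1}(w')$. The structure map $\varphi^*:H_i(\operatorname{UConf}_n(\operatorname{cone}(T'));\mathbb{Z})\to H_i(\operatorname{UConf}_n(\operatorname{cone}(T));\mathbb{Z})$ is the map on homology induced by $\widetilde\pi_\varphi^*\circ\widetilde\iota^\varphi_*$. *)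

(* Defs.v *)
From HB Require Import structures.
From mathcomp Require Import mpoly.
From mathcomp Require Import all_boot all_order all_algebra boolp.

Set Implicit Arguments.
Unset Strict Implicit.
Unset Printing Implicit Defensive.

Import GRing.Theory.

(** * Rooted trees and contractions *)

Record tree := Tree {
  tvert :> finType;
  adj : rel tvert;
  adj_sym : symmetric adj;
  adj_irr : irreflexive adj;
  tree_connected : forall x y, connect adj x y;
  tree_acyclic : forall c : seq tvert, 2 < size c -> ~~ ucycleb adj c
}.

Record rtree := RTree { rt_tree :> tree; root : rt_tree }.

Definition tedge (T : tree) : Type :=
  {A : {set T} | [exists x, exists y, adj x y && (A == [set x; y])]}.
HB.instance Definition _ (T : tree) := Finite.on (tedge T).

(* [A] is the vertex set of a subtree: nonempty and connected inside [A]. *)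
Definition subtree_set (T : tree) (A : {set T}) : bool :=
  (A != set0) &&
  [forall x in A, forall y in A,
     connect [rel a b | [&& a \in A, b \in A & adj a b]] x y].

Definition contracting (T T' : tree) (f : T -> T') : bool :=
  [forall x, forall y, adj x y ==> (f x == f y) || adj (f x) (f y)] &&
  [forall w, subtree_set [set x | f x == w]].

Definition rhom (S T : rtree) : Type :=
  {f : {ffun S -> T} | contracting f && (f (root S) == root T)}.
HB.instance Definition _ (S T : rtree) := Finite.on (rhom S T).
Definition rfun (S T : rtree) (f : rhom S T) : S -> T := val f.
Coercion rfun : rhom >-> Funclass.

Lemma adj_bridge (T : tree) (x y : T) : adj x y ->
  ~~ connect [rel a b | adj a b && ([set a; b] != [set x; y])] x y.
Proof.
move=> xy; apply/negP=> /connectP[p0 p0P yE]; move: xy; rewrite yE => xy.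
case: (shortenP p0P) xy yE => p pP puniq _ xy yE.
have subP : path (@adj T) x p.
  by apply: sub_path pP => a b /= /andP[].
have szp : 1 < size p.
  case: p {puniq subP} pP xy yE => [|a [|b p]] //=.
    by rewrite adj_irr.
  by rewrite andbT => /andP[_ +] _ ya; rewrite ya eqxx.
have := @tree_acyclic T (x :: p) szp.
by rewrite /ucycleb puniq andbT /= rcons_path subP /= adj_sym xy.
Qed.

Section ContractionFacts.
Variables (T T' : tree) (f : T -> T').
Hypothesis fP : contracting f.

Lemma contracting_adj x y : adj x y -> (f x == f y) || adj (f x) (f y).
Proof. by case/andP: fP => /forallP/(_ x)/forallP/(_ y)/implyP. Qed.

Lemma contracting_fiber x y : f x = f y ->
  connect [rel a b | [&& f a == f x, f b == f x & adj a b]] x y.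
Proof.
move=> fxy; case/andP: fP => _ /forallP/(_ (f x))/andP[_].
move=> /'forall_implyP/(_ x); rewrite inE eqxx => /(_ isT).
move=> /'forall_implyP/(_ y); rewrite inE fxy eqxx => /(_ isT).
by apply: connect_sub => a b /=; rewrite !inE => ?; apply: connect1.
Qed.

Lemma contracting_surj w : exists x, f x = w.
Proof.
case/andP: fP => _ /forallP/(_ w)/andP[/set0Pn[x]].
by rewrite inE => /eqP; exists x.
Qed.

Lemma contracting_lift x' y' : adj x' y' ->
  exists x y, [/\ adj x y, f x = x' & f y = y'].
Proof.
move=> xy'; case: (contracting_surj x') => a fa.
case: (contracting_surj y') => b fb.
have [[x [y xy]]|no] := pselect (exists x y, [/\ adj x y, f x = x' & f y = y']).
  by exists x, y.
have /negP[] := adj_bridge xy'; rewrite -{2}fa -{2}fb.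
have /connectP[p pP ->] := tree_connected a b.
elim: p a {fa} pP => //= c p IH a /andP[ac /IH cp]; apply: connect_trans cp.
case/orP: (contracting_adj ac) => [/eqP->//|fac]; apply: connect1 => /=.
rewrite fac; apply/eqP => E; apply: no.
have: (f a \in [set x'; y']) && (f c \in [set x'; y']).
  by rewrite -E !inE !eqxx orbT.
have fNac : f a != f c by apply: contraTneq fac => ->; rewrite adj_irr.
rewrite !inE => /andP[/orP[/eqP fax|/eqP fay] /orP[/eqP fcx|/eqP fcy]].
- by rewrite fax fcx eqxx in fNac.
- by exists a, c.
- by exists c, a; rewrite adj_sym.
- by rewrite fay fcy eqxx in fNac.
Qed.

Lemma contracting_preim (A : {set T'}) :
  subtree_set A -> subtree_set [set x | f x \in A].
Proof.
case/andP=> /set0Pn[w wA] /'forall_implyP AP; apply/andP; split.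
  have [x fx] := contracting_surj w; apply/set0Pn; exists x.
  by rewrite inE fx.
apply/'forall_implyP=> x; rewrite inE => xA.
apply/'forall_implyP=> y; rewrite inE => yA.
set R := (R in connect R); have fib a b : f a \in A -> f a = f b -> connect R a b.
  move=> aA /contracting_fiber; apply: connect_sub => c d /= /and3P[/eqP fc /eqP fd cd].
  by apply: connect1; rewrite /R /= !inE fc fd aA.
have /'forall_implyP/(_ _ yA)/connectP[p pP yE] := AP _ xA.
elim: p x xA pP yE => [|c p IH] x xA /=; first by move=> _ /esym; apply: fib.
case/andP=> /and3P[_ cA xc] pP yE.
have [u [v [uv fu fv]]] := contracting_lift xc.
apply: (connect_trans (fib x u xA _)) => //.
apply: (@connect_trans _ _ v); first by apply: connect1; rewrite /R /= !inE fu fv xA cA.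
by apply: IH; rewrite ?fv.
Qed.

End ContractionFacts.

Lemma contracting_comp (T T' T'' : tree) (g : T' -> T'') (f : T -> T') :
  contracting g -> contracting f -> contracting (g \o f).
Proof.
move=> gP fP; apply/andP; split.
  apply/forallP=> x; apply/forallP=> y; apply/implyP=> xy /=.
  case/orP: (contracting_adj fP xy) => [/eqP->|fxy]; first by rewrite eqxx.
  exact: contracting_adj.
apply/forallP=> w; case/andP: (gP) => _ /forallP/(_ w) /(contracting_preim fP).
by congr subtree_set; apply/setP=> x; rewrite !inE.
Qed.

Lemma contracting_id (T : tree) : contracting (@id T).
Proof.
apply/andP; split.
  by apply/forallP=> x; apply/forallP=> y; apply/implyP=> ->; rewrite orbT.
apply/forallP=> w; apply/andP; split; first by apply/set0Pn; exists w; rewrite inE.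
apply/'forall_implyP=> x; rewrite inE => /eqP->.
by apply/'forall_implyP=> y; rewrite inE => /eqP->.
Qed.

Lemma contracting_eq (T T' : tree) (f g : T -> T') :
  f =1 g -> contracting f = contracting g.
Proof. by move=> /funext->. Qed.

Fact rid_subproof (T : rtree) :
  let f := [ffun x : T => x] in contracting f && (f (root T) == root T).
Proof.
rewrite /= ffunE eqxx andbT -(contracting_eq (f := id)) ?contracting_id //.
by move=> x; rewrite ffunE.
Qed.
Definition rid (T : rtree) : rhom T T := Sub [ffun x : T => x] (rid_subproof T).

Fact rcomp_subproof (S T U : rtree) (g : rhom T U) (f : rhom S T) :
  let h := [ffun x : S => g (f x)] in contracting h && (h (root S) == root U).
Proof.
case/andP: (valP f) (valP g) => fP /eqP fr /andP[gP /eqP gr].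
rewrite /= ffunE /rfun fr gr eqxx andbT.
rewrite -(contracting_eq (f := rfun g \o rfun f)) ?contracting_comp //.
by move=> x; rewrite ffunE.
Qed.
Definition rcomp (S T U : rtree) (g : rhom T U) (f : rhom S T) : rhom S U :=
  Sub [ffun x : S => g (f x)] (rcomp_subproof g f).

Lemma rhomP (S T : rtree) (f g : rhom S T) : f =1 g -> f = g.
Proof. by move=> fg; apply/val_inj/ffunP. Qed.

Lemma ridE (T : rtree) x : rid T x = x.
Proof. by rewrite /rfun /= ffunE. Qed.

Lemma rcompE (S T U : rtree) (g : rhom T U) (f : rhom S T) x :
  rcomp g f x = g (f x).
Proof. by rewrite /rfun /= ffunE. Qed.

(* The partial order with maximum [root T]: the path from [u] to the root
   passes through [w]. *)
Definition below (T : rtree) (u w : T) : Prop :=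
  exists p : seq T,
    [/\ path (@adj T) u p, uniq (u :: p), last u p = root T & w \in u :: p].

Definition fiber_max (S T : rtree) (f : S -> T) (w : T) (m : S) : Prop :=
  f m = w /\ forall u : S, f u = w -> below m u -> u = m.

(** * Modules over the opposite of the category of rooted trees

   Modules over the integers are [zmodType]s. *)

Local Open Scope ring_scope.

Record module_on (X : rtree -> zmodType) := ModuleOn {
  act : forall S T : rtree, rhom S T -> X T -> X S;
  actD : forall S T (f : rhom S T), {morph act f : x y / x + y};
  act_id : forall T, act (rid T) =1 id;
  act_comp : forall S T U (g : rhom T U) (f : rhom S T),
    act (rcomp g f) =1 act f \o act g
}.

Record rt_module := RTModule {
  obj :> rtree -> zmodType;
  structure :> module_on obj
}.

Record module_hom (M N : rt_module) := ModuleHom {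
  hom_fun :> forall T : rtree, M T -> N T;
  homD : forall T, {morph hom_fun (T := T) : x y / x + y};
  hom_act : forall S T (f : rhom S T) (x : M T),
    hom_fun (act M f x) = act N f (hom_fun x)
}.

Definition mono_hom (M N : rt_module) (h : module_hom M N) : Prop :=
  forall T : rtree, injective (h T).

Definition epi_hom (M N : rt_module) (h : module_hom M N) : Prop :=
  forall (T : rtree) (y : N T), exists x : M T, h T x = y.

Section Principal.
Variable S : rtree.

Definition principal_act (T U : rtree) (f : rhom T U) (c : {ffun rhom U S -> int}) :
    {ffun rhom T S -> int} :=
  [ffun g => \sum_(h : rhom U S | rcomp h f == g) c h].

Fact principal_actD T U (f : rhom T U) : {morph principal_act f : x y / x + y}.
Proof.
move=> x y; apply/ffunP=> g; rewrite !ffunE -big_split.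
by apply: eq_bigr => h _; rewrite ffunE.
Qed.

Fact principal_act_id T : principal_act (rid T) =1 id.
Proof.
move=> c; apply/ffunP=> g; rewrite ffunE (big_pred1 g) // => h /=.
by congr (_ == _); apply: rhomP => x; rewrite rcompE ridE.
Qed.

Fact principal_act_comp T U V (g : rhom U V) (f : rhom T U) :
  principal_act (rcomp g f) =1 principal_act f \o principal_act g.
Proof.
move=> c; apply/ffunP=> h; rewrite !ffunE.
under [RHS]eq_bigr do rewrite ffunE.
rewrite (exchange_big_dep xpredT) //= big_mkcond; apply: eq_bigr => k _.
have -> : rcomp k (rcomp g f) = rcomp (rcomp k g) f.
  by apply: rhomP => x; rewrite !rcompE.
case: ifPn => [/eqP kh|/negP kh].
  rewrite (big_pred1 (rcomp k g)) // => l /=; rewrite [RHS]eq_sym.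
  by apply/andP/idP => [[]//|/eqP <-]; rewrite kh !eqxx.
rewrite big_pred0 // => l; apply/negP=> /andP[/eqP lh /eqP kl].
by apply: kh; rewrite kl lh.
Qed.

Definition principal : rt_module :=
  RTModule (ModuleOn principal_actD principal_act_id principal_act_comp).

End Principal.

Definition zero_obj (T : rtree) : zmodType := {ffun void -> int}.

Definition zero_module : rt_module :=
  RTModule (@ModuleOn zero_obj (fun _ _ _ x => x) (fun _ _ _ _ _ => erefl)
    (fun _ _ => erefl) (fun _ _ _ _ _ _ => erefl)).

Section DirectSum.
Variables M N : rt_module.

Definition dsum_obj (T : rtree) : zmodType := (M T * N T)%type.

Definition dsum_act (S T : rtree) (f : rhom S T) (x : dsum_obj T) : dsum_obj S :=
  (act M f x.1, act N f x.2).

Fact dsum_actD S T (f : rhom S T) : {morph dsum_act f : x y / x + y}.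
Proof. by move=> x y; rewrite /dsum_act !actD. Qed.

Fact dsum_act_id T : dsum_act (rid T) =1 id.
Proof. by case=> x y; rewrite /dsum_act !act_id. Qed.

Fact dsum_act_comp S T U (g : rhom T U) (f : rhom S T) :
  dsum_act (rcomp g f) =1 dsum_act f \o dsum_act g.
Proof. by move=> x; rewrite /dsum_act !act_comp. Qed.

Definition dsum : rt_module :=
  RTModule (ModuleOn dsum_actD dsum_act_id dsum_act_comp).

End DirectSum.

Definition principal_sum (Ts : seq rtree) : rt_module :=
  foldr (fun T M => dsum (principal T) M) zero_module Ts.

Definition fin_gen (M : rt_module) : Prop :=
  exists (Ts : seq rtree) (q : module_hom (principal_sum Ts) M), epi_hom q.

Definition gen_in_degrees (d : nat) (M : rt_module) : Prop :=
  exists (Ts : seq rtree) (q : module_hom (principal_sum Ts) M),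
    all (fun T : rtree => #|{: tedge T}| <= d)%N Ts /\ epi_hom q.

(* [M] is isomorphic to a quotient of a submodule [K] of [N]. *)
Definition subquotient (M N : rt_module) : Prop :=
  exists (K : rt_module) (i : module_hom K N) (q : module_hom K M),
    mono_hom i /\ epi_hom q.

Definition small (d : nat) (M : rt_module) : Prop :=
  exists N : rt_module, gen_in_degrees d N /\ subquotient M N.

(** * Graphs

   Multiple edges are allowed.  Loops are excluded, so that a half-edge is
   the same thing as a pair of an edge and one of its endpoints. *)

Record graph := Graph {
  vert : finType;
  edge : finType;
  ends : edge -> {set vert};
  ends_card : forall e, #|ends e| = 2%N
}.

Definition halfedge (G : graph) : Type := {h : vert G * edge G | h.1 \in ends h.2}.
HB.instance Definition _ (G : graph) := Finite.on (halfedge G).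
Definition hvert (G : graph) (h : halfedge G) : vert G := (val h).1.
Definition hedge (G : graph) (h : halfedge G) : edge G := (val h).2.

(* The graph obtained from [T] by adding a vertex [None] and, for each [w : W],
   an edge [inr w] from [f w] to [None].  For [f : T -> T'] this is the graph
   G_f; for [f = id] it is the cone of [T]. *)
Section ConeAlong.
Variables (T : tree) (W : finType) (f : W -> T).

Definition cone_ends (e : tedge T + W) : {set option T} :=
  match e with
  | inl A => Some @: val A
  | inr w => [set Some (f w); None]
  end.

Fact cone_ends_card e : #|cone_ends e| = 2%N.
Proof.
case: e => [[A /= /existsP[x /existsP[y /andP[xy /eqP->]]]]|w] /=.
  rewrite card_imset ?cards2; last exact: Some_inj.
  by case: eqP xy => // ->; rewrite adj_irr.
by rewrite cards2.
Qed.

Definition cone_along : graph := @Graph (option T) (tedge T + W)%type cone_ends cone_ends_card.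
End ConeAlong.

Definition cone (T : tree) : graph := cone_along (@id T).

Record embedding (G G' : graph) := Embedding {
  emb_v : vert G -> vert G';
  emb_e : edge G -> edge G';
  emb_v_inj : injective emb_v;
  emb_e_inj : injective emb_e;
  emb_ends : forall e, ends (emb_e e) = emb_v @: ends e
}.

Fact emb_half_subproof (G G' : graph) (j : embedding G G') (h : halfedge G) :
  let h' := (emb_v j (hvert h), emb_e j (hedge h)) in h'.1 \in ends h'.2.
Proof. by rewrite /= emb_ends imset_f // (valP h). Qed.
Definition emb_half (G G' : graph) (j : embedding G G') (h : halfedge G) : halfedge G' :=
  Sub (emb_v j (hvert h), emb_e j (hedge h)) (emb_half_subproof j h).

(* A collapsing map G -> G', recorded by its map on vertices and by the map
   sending an edge of G' to the unique edge of G lying over it. *)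
Record collapse (G G' : graph) := Collapse {
  col_v : vert G -> vert G';
  col_e : edge G' -> edge G;
  col_v_surj : forall w, exists v, col_v v = w;
  col_e_inj : injective col_e;
  col_ends : forall e, ends e = col_v @: ends (col_e e)
}.

Fact col_half_subproof (G G' : graph) (p : collapse G G') (h' : halfedge G') :
  exists h : halfedge G, (hedge h == col_e p (hedge h')) && (col_v p (hvert h) == hvert h').
Proof.
have : hvert h' \in ends (hedge h') := valP h'.
rewrite (col_ends p) => /imsetP[v vP hE].
by exists (Sub (v, col_e p (hedge h')) vP); rewrite /hvert /hedge /= eqxx; apply/eqP.
Qed.
(* The unique half-edge of G lying over a half-edge of G'. *)
Definition col_half (G G' : graph) (p : collapse G G') (h' : halfedge G') : halfedge G :=
  xchoose (col_half_subproof p h').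

Definition is_iso (G G' : graph) (p : collapse G G') : Prop :=
  bijective (col_v p) /\ bijective (col_e p).

(* [p] is the contraction of the single edge [e0]. *)
Definition is_simple (G G' : graph) (p : collapse G G') (e0 : edge G) : Prop :=
  (forall e, (e \in codom (col_e p)) = (e != e0)) /\
  (forall x y, (col_v p x == col_v p y) =
     (x == y) || ((x \in ends e0) && (y \in ends e0))).

(** * The reduced Swiatkowski complex

   With A the ring of integral polynomials in the edges, the graded tensor
   product over A of the exterior algebras on the half-edges at v, over all
   vertices v, is the exterior algebra on all half-edges.  The module S(v) sits
   inside the factor of v as its part of exterior degree at most 1, with the
   symbol for the empty state as the unit, and the differential is the
   restriction of the derivation sending a half-edge to its edge.  The reduced
   module at v is a direct summand, so the tensor product of the reduced modules
   is the span of the products of their elements; Koszul signs are those of the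
   exterior algebra. *)

Definition edge_ring (G : graph) : comNzRingType := {mpoly int[#|edge G|]}.

Definition evar (G : graph) (e : edge G) : edge_ring G := 'X_(enum_rank e).

(* The coefficient at [A] is that of the product of the elements of [A] in
   increasing order of [enum_rank]. *)
Definition ext (G : graph) : Type := {ffun {set halfedge G} -> (edge_ring G)^o}.
HB.instance Definition _ (G : graph) := GRing.Lmodule.on (ext G).

Section Exterior.
Variable G : graph.
Implicit Types (x y : ext G) (A B C : {set halfedge G}).

Definition gen (h : halfedge G) : ext G := [ffun A => (A == [set h])%:R].

Definition eone : ext G := [ffun A => (A == set0)%:R].

Definition inversions A B : nat :=
  #|[set p : halfedge G * halfedge G |
      [&& p.1 \in A, p.2 \in B & (enum_rank p.2 < enum_rank p.1)%N]]|.

Definition emul x y : ext G :=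
  [ffun C : {set halfedge G} => \sum_(A : {set halfedge G} | A \subset C)
     (-1) ^+ inversions A (C :\: A) * x A * y (C :\: A)].

Definition differential x : ext G :=
  [ffun A : {set halfedge G} => \sum_(h | h \notin A)
     (-1) ^+ inversions [set h] A * evar (hedge h) * x (h |: A)].

(* The submodule of S(v) generated by the empty symbol and by the differences
   of half-edges at [v]. *)
Definition reduced_at (v : vert G) x : Prop :=
  exists (a : edge_ring G) (b : halfedge G * halfedge G -> edge_ring G),
    x = a *: eone +
        \sum_(p | (hvert p.1 == v) && (hvert p.2 == v)) b p *: (gen p.1 - gen p.2).

Definition reduced x : Prop :=
  exists (J : finType) (a : J -> edge_ring G) (y : J -> vert G -> ext G),
    (forall j v, reduced_at v (y j v)) /\
    x = \sum_j a j *: \big[emul/eone]_(v : vert G) y j v.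

(* Edges have bidegree (0, 1) and half-edges (1, 1). *)
Definition bidegree (i n : nat) x : Prop :=
  forall A (m : 'X_{1..#|edge G|}), (x A : edge_ring G)@_m != 0 ->
    #|A| = i /\ (mdeg m + i)%N = n.

Variables i n : nat.

Definition is_cycle x : Prop := [/\ reduced x, bidegree i n x & differential x = 0].

Definition is_boundary x : Prop :=
  exists y, [/\ reduced y, bidegree i.+1 n y & differential y = x].

Definition cycle_pred : {pred ext G} := [pred x | `[< is_cycle x >]].

Fact diffB : {morph differential : x y / x - y}.
Proof.
move=> x y; apply/ffunP=> A; rewrite !ffunE -sumrB.
by apply: eq_bigr => h _; rewrite !ffunE mulrBr.
Qed.

Fact reduced0 : reduced 0.
Proof.
exists void, (of_void _), (of_void _).
by split=> [[]|]; rewrite big_pred0 // => -[].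
Qed.

Fact reducedB x y : reduced x -> reduced y -> reduced (x - y).
Proof.
case=> J [a [u [uP ->]]] [K [b [w [wP ->]]]].
exists (J + K)%type, (fun s => match s with inl j => a j | inr k => - b k end),
  (fun s => match s with inl j => u j | inr k => w k end).
split=> [[]//|]; rewrite big_sumType /=; congr (_ + _).
by rewrite -sumrN; apply: eq_bigr => k _; rewrite scaleNr.
Qed.

Fact bidegree0 j m : bidegree j m 0.
Proof. by move=> A k; rewrite ffunE mcoeff0 eqxx. Qed.

Fact bidegreeB j m x y : bidegree j m x -> bidegree j m y -> bidegree j m (x - y).
Proof.
move=> xP yP A k; rewrite !ffunE mcoeffB => xyN0.
have [x0|/xP//] := eqVneq ((x A : edge_ring G)@_k) 0; apply: yP.
by apply: contraNneq xyN0 => y0; rewrite x0 y0 subr0.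
Qed.

Fact cycle_zmod_closed : zmod_closed cycle_pred.
Proof.
split=> [|x y /asboolP[rx bx dx] /asboolP[ry by_ dy]]; apply/asboolP; split.
- exact: reduced0.
- exact: bidegree0.
- by have := diffB 0 0; rewrite !subrr.
- exact: reducedB.
- exact: bidegreeB.
- by rewrite diffB dx dy subr0.
Qed.
HB.instance Definition _ := GRing.isZmodClosed.Build (ext G) cycle_pred cycle_zmod_closed.

Record cycle_type := Cycle { cycle_val : ext G; _ : cycle_val \in cycle_pred }.
HB.instance Definition _ := [isSub for cycle_val].
HB.instance Definition _ := [Choice of cycle_type by <:].
HB.instance Definition _ := [SubChoice_isSubZmodule of cycle_type by <:].

Definition boundary_pred : {pred cycle_type} :=
  [pred z | `[< is_boundary (cycle_val z) >]].

Fact boundary_zmod_closed : zmod_closed boundary_pred.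
Proof.
split=> [|x y /asboolP[u [ru bu ux]] /asboolP[w [rw bw wy]]]; apply/asboolP.
  exists 0; split; [exact: reduced0 | exact: bidegree0 |].
  by have := diffB 0 0; rewrite !subrr.
exists (u - w); split; [exact: reducedB | exact: bidegreeB |].
by rewrite diffB ux wy.
Qed.
HB.instance Definition _ :=
  GRing.isZmodClosed.Build cycle_type boundary_pred boundary_zmod_closed.

(* The part of bidegree (i, n) of the homology; it is identified with
   H_i(UConf_n(G)) by a theorem of An, Drummond-Cole and Knudsen. *)
Definition homology : zmodType := Quotient.quot boundary_pred.

Definition hclass (z : cycle_type) : homology := \pi_homology%qT z.

End Exterior.

(* The multiplicative extension of [r] on edges and [F] on half-edges. *)
Definition ext_map (G G' : graph) (r : edge G -> edge G') (F : halfedge G -> ext G')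
    (x : ext G) : ext G' :=
  \sum_(A : {set halfedge G})
    (mmap (intr : int -> edge_ring G') (fun j => evar (r (enum_val j))) (x A)) *:
    \big[@emul G'/@eone G']_(h <- enum A) F h.

Definition emb_push (G G' : graph) (j : embedding G G') : ext G -> ext G' :=
  ext_map (emb_e j) (fun h => gen (emb_half j h)).

Definition iso_pull (G G' : graph) (p : collapse G G') : ext G' -> ext G :=
  ext_map (col_e p) (fun h' => gen (col_half p h')).

(* The sum has one term if v(h) is an endpoint of [e0], namely the half-edge of
   [e0] at v(h), and is empty otherwise. *)
Definition simple_pull (G G' : graph) (p : collapse G G') (e0 : edge G) :
    ext G' -> ext G :=
  ext_map (col_e p) (fun h' => let h := col_half p h' in
    gen h - \sum_(h0 | (hedge h0 == e0) && (hvert h0 == hvert h)) gen h0).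

(* Factorizations of a contraction into simple contractions followed by an
   isomorphism. *)
Inductive factorization : graph -> graph -> Type :=
| FactIso (G G' : graph) (p : collapse G G') of is_iso p : factorization G G'
| FactStep (G G1 G' : graph) (p : collapse G G1) (e0 : edge G) of is_simple p e0 :
    factorization G1 G' -> factorization G G'.

Fixpoint fact_v (G G' : graph) (c : factorization G G') : vert G -> vert G' :=
  match c with
  | FactIso _ _ p _ => col_v p
  | FactStep _ _ _ p _ _ c' => fact_v c' \o col_v p
  end.

Fixpoint fact_e (G G' : graph) (c : factorization G G') : edge G' -> edge G :=
  match c with
  | FactIso _ _ p _ => col_e p
  | FactStep _ _ _ p _ _ c' => col_e p \o fact_e c'
  end.

Fixpoint fact_pull (G G' : graph) (c : factorization G G') : ext G' -> ext G :=
  match c with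
  | FactIso _ _ p _ => iso_pull p
  | FactStep _ _ _ p e0 _ c' => simple_pull p e0 \o fact_pull c'
  end.

(** * The module structure *)

Section StructureMap.
Variables (S T : rtree) (f : rhom S T).

(* [c] factors the contraction cone S -> G_f. *)
Definition factors_pi (c : factorization (cone S) (cone_along f)) : Prop :=
  [/\ fact_v c =1 omap f,
      forall w : S, fact_e c (inr w) = inr w
    & forall A' : tedge T, exists2 A : tedge S,
        fact_e c (inl A') = inl A & f @: val A = val A'].

(* [j] is the embedding cone T -> G_f. *)
Definition is_iota (j : embedding (cone T) (cone_along f)) : Prop :=
  [/\ emb_v j =1 id,
      forall A : tedge T, emb_e j (inl A) = inl A
    & forall w : T, exists2 m : S, emb_e j (inr w) = inr m & fiber_max f w m].

(* [g] is the map induced on homology by [F]. *)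
Definition induced_by (G G' : graph) (i n : nat) (F : ext G -> ext G')
    (g : homology G i n -> homology G' i n) : Prop :=
  forall z : cycle_type G i n, exists2 z' : cycle_type G' i n,
    cycle_val z' = F (cycle_val z) & g (hclass z) = hclass z'.

(* The second conjunct quantifies over all factorizations: the induced map does
   not depend on the one which is used. *)
Definition is_structure_map (i n : nat)
    (g : homology (cone T) i n -> homology (cone S) i n) : Prop :=
  (exists c j, factors_pi c /\ is_iota j) /\
  (forall c j, factors_pi c -> is_iota j ->
     induced_by (fact_pull c \o emb_push j) g).

End StructureMap.

(* Main.v *)
(** A contraction of rooted trees is determined by the map sending a vertex to the
    maximum of its fibre, a root-preserving order embedding of the target into the
    source.  On the half-edges of the cones a contraction acts by an integral matrix
    whose sums over the half-edges at a vertex and over those of an edge are prescribed.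
    These sums determine the image of a difference of two half-edges: the difference of
    two candidates is a balanced flow on a forest, hence zero.  So the reduced chains are
    themselves functorial.

    A product of [n - i] edges and [i] differences of half-edges involves at most [n + i]
    vertices of the tree, so it descends to the quotient whose fibre maxima are these
    vertices and the root, a tree with at most [n + i] edges.  Hence the cycles, and with
    them the homology, are subquotients of a sum of principal projectives of such trees.

    Finite generation follows from noetherianity over the integers.  A map to a fixed tree
    is a forest with finitely many labels, ordered depth first, and such forests are
    well-quasi-ordered by Kruskal's theorem.  Composition with maps compatible with the
    depth-first orders preserves the lexicographic order on maps, so comparing leading
    terms, with Euclidean division of their coefficients, bounds every chain of
    submodules. *)

(* The obstacle is that the image of a single half-edge is not canonical: contracting two adjacent
   edges in the other order changes it. The change depends only on the vertex of the half-edge, so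
   it cancels in differences at a common vertex, and this is why prescribed sums up to a function of
   the vertex suffice and survive composition.

   The constant arises as follows. Each of the [n - i] edges is charged to one vertex that
   determines it. Each of the [i] differences is charged to two, the vertex of its half-edge and the
   one determining its edge; the other half-edge of the difference can be chosen on the edge to the
   cone point, which costs nothing. This makes [(n - i) + 2 i = n + i]. The root adds one vertex,
   and a tree has one edge fewer than vertices. *)
Require Import Defs.
From HB Require Import structures.
From mathcomp Require Import mpoly.
From mathcomp Require Import all_boot all_order all_algebra boolp.
From mathcomp Require Import generic_quotient ring_quotient ring.
From Stdlib Require List.
(* Restores [root], which the polynomial library shadows. *)
Import Defs.

Set Implicit Arguments.
Unset Strict Implicit.
Unset Printing Implicit Defensive.

(** * Rooted trees as ordered sets *)

Section RootedOrder.
Variable T : rtree.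
Implicit Types x y z : T.

Definition avoid (z : T) : rel T := [rel a b | [&& adj a b, a != z & b != z]].

(* [tle] is [below]: every path from [x] to the root meets [y]. *)
Definition tle x y : bool := (x == y) || ~~ connect (avoid y) x (root T).

Lemma avoid_sym z : symmetric (avoid z).
Proof. by move=> a b; rewrite /avoid /= adj_sym; case: (adj b a) => //=; rewrite andbC. Qed.

Lemma connect_avoidC z x y : connect (avoid z) x y = connect (avoid z) y x.
Proof. exact: (sym_connect_sym (@avoid_sym z)). Qed.

Lemma path_avoid z x p : path (@adj T) x p -> z \notin x :: p ->
  connect (avoid z) x (last x p).
Proof.
elim: p x => [|a p IH] x /=; first by rewrite connect0.
case/andP=> xa ap; rewrite !inE !negb_or => /and3P[zx za zp].
apply: connect_trans (IH _ ap _); last by rewrite inE negb_or za.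
by apply: connect1; rewrite /avoid /= xa eq_sym zx eq_sym za.
Qed.

Lemma simple_path x : exists p,
  [/\ path (@adj T) x p, uniq (x :: p) & last x p = root T].
Proof.
have /connectP[p pP rE] := tree_connected x (root T).
by case: (shortenP pP) rE => q qP qu _ ->; exists q.
Qed.

Lemma tle_refl x : tle x x. Proof. by rewrite /tle eqxx. Qed.
Hint Resolve tle_refl : core.

Lemma connect_avoid_neq z x y : connect (avoid z) x y -> x != z -> y != z.
Proof.
case/connectP=> p + ->; elim: p x => [|a p IH] x //= /andP[/and3P[_ _ az] ap] _.
exact: IH.
Qed.

Lemma tle_root x : tle x (root T).
Proof.
rewrite /tle; case: eqP => //= /eqP xr; apply/negP => /connect_avoid_neq /(_ xr).
by rewrite eqxx.
Qed.

(** A walk from [x] to the root avoiding [z] must meet [y], and its tail from [y] on would still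
    avoid [z]. *)
Lemma tle_trans y x z : tle x y -> tle y z -> tle x z.
Proof.
rewrite /tle; case: (eqVneq x y) => [->//|_ /= xy].
case: (eqVneq y z) => [<-|nyz /= yz]; first by rewrite xy orbT.
case: eqP => //= /eqP nxz; apply/negP=> /connectP[p pP rE].
have [yp|yp] := boolP (y \in x :: p); last first.
  case/negP: xy; apply/connectP; exists p => //.
  elim: p x yp {nxz rE} pP => //= a p IH x; rewrite !inE !negb_or => /and3P[yx ya yp].
  case/andP=> /and3P[xa _ _] ap; rewrite IH ?inE ?negb_or ?ya // andbT.
  by rewrite /avoid /= xa eq_sym yx eq_sym ya.
case/negP: yz; apply/connectP.
move: yp; rewrite inE => /orP[/eqP->|/splitPr yp]; first by exists p.
case: {p} yp pP rE => p1 p2; rewrite cat_path /= => /and3P[_ _ pP] rE.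
by exists p2 => //; rewrite rE last_cat.
Qed.

Lemma tle_anti x y : tle x y -> tle y x -> x = y.
Proof.
move=> xy yx; apply/eqP/negPn/negP=> nxy.
have [p [pP pu pr]] := simple_path x.
move: xy yx; rewrite /tle (negPf nxy) eq_sym (negPf nxy) /= => xy /negP[].
have yp : y \in x :: p.
  by apply: contraR xy => yp; rewrite -pr path_avoid.
move: yp; rewrite inE eq_sym (negPf nxy) /= => yp; case/splitPr: yp pP pu pr => p1 p2.
rewrite cat_path last_cat /= mem_cat inE !negb_or => /and3P[_ _ pP] /andP[/and3P[_ _ xp2] _] <-.
by apply: path_avoid => //; rewrite inE negb_or nxy.
Qed.

(** A simple path from [x] to the root meets both vertices. If neither were above the other, each
    would reach the root avoiding the other; following the path to whichever comes first and leaving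
    there, [x] would reach the root avoiding the second. *)
Lemma tle_chain x y z : tle x y -> tle x z -> tle y z || tle z y.
Proof.
case: (eqVneq x y) => [->_ -> //|nxy]; case: (eqVneq x z) => [->->|nxz]; first by rewrite orbT.
rewrite {1 2}/tle (negPf nxy) (negPf nxz) /= => xy xz.
rewrite orbC -implyNb; apply/implyP=> zy.
rewrite /tle; case: eqP => //= /eqP nyz; apply/negP=> cy.
move: zy; rewrite /tle eq_sym (negPf nyz) /= negbK => cz.
have [p [pP pu pr]] := simple_path x.
have yp : y \in x :: p by apply: contraR xy => yp; rewrite -pr path_avoid.
have zp : z \in x :: p by apply: contraR xz => zp; rewrite -pr path_avoid.
move: yp zp; rewrite !inE eq_sym (negPf nxy) eq_sym (negPf nxz) /= => yp.
case/splitPr: yp pP pu {pr} => p1 p2; rewrite cat_path /= => /and3P[pP1 e1 pP2] pu zp.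
have [zp1|zp1] := boolP (z \in p1); last first.
  case/negP: xz; apply: connect_trans cy.
  have -> : y = last x (rcons p1 y) by rewrite last_rcons.
  apply: path_avoid; first by rewrite rcons_path pP1.
  by rewrite inE mem_rcons inE !negb_or eq_sym nxz eq_sym nyz.
case/negP: xy; apply: connect_trans cz.
move: zp1 pP1 pu; case/splitPr=> p3 p4; rewrite cat_path => /= /and3P[pP3 e3 _] pu.
have -> : z = last x (rcons p3 z) by rewrite last_rcons.
apply: path_avoid; first by rewrite rcons_path pP3.
rewrite inE mem_rcons inE !negb_or eq_sym nxy nyz /=.
case/andP: pu => _; rewrite cat_uniq => /and3P[_ + _].
by rewrite /= mem_cat !negb_or => /andP[/andP[]].
Qed.

Definition tlt x y : bool := (x != y) && tle x y.

Lemma tltW x y : tlt x y -> tle x y. Proof. by case/andP. Qed.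

Lemma tltNge x y : tlt x y -> ~~ tle y x.
Proof. by case/andP=> nxy xy; apply: contra nxy => yx; rewrite (tle_anti xy yx). Qed.

(** Otherwise walks from [x] avoiding [y] and from [y] avoiding [x] join at the root and bypass the
    edge between them, which [adj_bridge] excludes. *)
Lemma adj_comparable x y : adj x y -> tle x y || tle y x.
Proof.
move=> xy; apply: contraT; rewrite negb_or /tle !negb_or !negbK => /andP[/andP[_ cx] /andP[_ cy]].
have /negP[] := adj_bridge xy.
apply: (@connect_trans _ _ (root T)); last first.
  rewrite connect_avoidC in cy; apply: connect_sub cy => a b /and3P[ab ax bx].
  apply: connect1; rewrite /= ab; apply: contraTneq (set21 x y) => <-.
  by rewrite !inE negb_or eq_sym ax eq_sym.
apply: connect_sub cx => a b /and3P[ab ay b_y].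
apply: connect1; rewrite /= ab; apply: contraTneq (set22 x y) => <-.
by rewrite !inE negb_or eq_sym ay eq_sym.
Qed.

Lemma adj_upward x y : adj x y -> connect (avoid x) y (root T) -> tle x y.
Proof.
move=> xy cy; case/orP: (adj_comparable xy) => //.
rewrite /tle; case: eqP => [yx|_ /=]; last by rewrite cy.
by rewrite yx adj_irr in xy.
Qed.

Definition tpar_rel x y := [/\ adj x y, tlt x y & forall z, tlt x z -> tle y z].

Lemma tpar_exists x : x != root T -> exists y, tpar_rel x y.
Proof.
move=> xr; have [[|y p] [/= pP pu pr]] := simple_path x; first by rewrite pr eqxx in xr.
case/andP: pP => xy pP; case/andP: pu => xp pu; exists y.
have nxy : x != y by apply: contraTneq xy => ->; rewrite adj_irr.
have lxy : tle x y by apply: adj_upward => //; rewrite -pr; apply: path_avoid.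
split=> // [|z]; first by rewrite /tlt nxy.
case/andP=> nxz; rewrite {1}/tle (negPf nxz) /= => xz.
rewrite /tle; case: eqP => //= /eqP nyz; apply: contra xz => yz; apply: connect_trans yz.
by apply: connect1; rewrite /avoid /= xy nxz nyz.
Qed.

Lemma tlt_avoid x y : tlt x y -> connect (avoid x) y (root T).
Proof. by move/tltNge; rewrite /tle negb_or negbK => /andP[]. Qed.

(** If the least vertex above [x] were another one, a walk could go from [x] to it and then through
    the root to [y] without using the edge from [x] to [y]. *)
Lemma adj_tle_tpar_rel x y : adj x y -> tle x y -> tpar_rel x y.
Proof.
move=> xy lxy; have nxy : x != y by apply: contraTneq xy => ->; rewrite adj_irr.
have xr : x != root T.
  by apply: contraNneq nxy => xr; rewrite (tle_anti lxy) // xr tle_root.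
have [y0 [xy0 ly0 y0P]] := tpar_exists xr.
case: (eqVneq y0 y) => [<-//|ny0]; have /negP[] := adj_bridge xy.
apply: (@connect_trans _ _ y0).
  apply: connect1; rewrite /= xy0; apply: contraNneq ny0 => E.
  have := set22 x y0; rewrite E !inE => /orP[/eqP y0x|//].
  by rewrite y0x adj_irr in xy0.
have: connect (avoid x) y0 y.
  apply: connect_trans (tlt_avoid ly0) _; rewrite connect_avoidC; apply: tlt_avoid.
  by rewrite /tlt nxy.
apply: connect_sub => a b /and3P[ab ax bx]; apply: connect1; rewrite /= ab.
apply: contraTneq (set21 x y) => <-.
by rewrite !inE negb_or eq_sym ax eq_sym.
Qed.

(** The default is reached exactly at the root, which has no upper neighbour. *)
Definition tpar x : T := odflt (root T) [pick y | adj x y && tle x y].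

Lemma tparP x : x != root T -> tpar_rel x (tpar x).
Proof.
case/tpar_exists=> y [xy /tltW lxy _]; rewrite /tpar; case: pickP => [z /andP[]|/(_ y)].
  exact: adj_tle_tpar_rel.
by rewrite xy lxy.
Qed.

Lemma tpar_adj x : x != root T -> adj x (tpar x).
Proof. by case/tparP. Qed.

Lemma tpar_gt x : x != root T -> tlt x (tpar x).
Proof. by case/tparP. Qed.

Lemma tpar_le x z : tlt x z -> tle (tpar x) z.
Proof.
move=> xz; have xr : x != root T.
  apply: contraTneq xz => ->; rewrite /tlt; apply/negP=> /andP[nz].
  by move/(tle_anti (tle_root z))/esym/eqP; rewrite (negPf nz).
by have [_ _] := tparP xr; apply.
Qed.

Lemma tpar_unique x y : adj x y -> tle x y -> (x != root T) /\ y = tpar x.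
Proof.
move=> xy lxy; have [_ lt yP] := adj_tle_tpar_rel xy lxy.
have xr : x != root T.
  by apply: contraTneq lt => ->; apply/negP=> /tltNge; rewrite tle_root.
by split=> //; apply: tle_anti; [apply: yP; apply: tpar_gt | apply: tpar_le].
Qed.

Lemma adjP x y : adj x y ->
  (x != root T /\ y = tpar x) \/ (y != root T /\ x = tpar y).
Proof.
move=> xy; case/orP: (adj_comparable xy) => le; first by left; apply: tpar_unique.
by right; apply: tpar_unique; rewrite // adj_sym.
Qed.

Lemma upward_ind (P : T -> Prop) :
  (forall x, (forall y, tlt x y -> P y) -> P x) -> forall x, P x.
Proof.
move=> IH x; have [n] := ubnP #|[pred y | tle x y]|.
elim: n x => // n IHn x; rewrite ltnS => le; apply: IH => y xy; apply: IHn.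
apply: leq_trans le; apply: proper_card; apply/properP; split.
  by apply/subsetP=> z; rewrite !inE; apply: tle_trans; apply: tltW.
by exists x; rewrite !inE // tltNge.
Qed.

Lemma downward_ind (P : T -> Prop) :
  (forall x, (forall y, tlt y x -> P y) -> P x) -> forall x, P x.
Proof.
move=> IH x; have [n] := ubnP #|[pred y | tle y x]|.
elim: n x => // n IHn x; rewrite ltnS => le; apply: IH => y xy; apply: IHn.
apply: leq_trans le; apply: proper_card; apply/properP; split.
  by apply/subsetP=> z; rewrite !inE => zy; apply: tle_trans zy (tltW xy).
by exists x; rewrite !inE // tltNge.
Qed.

Lemma below_tle x y : below x y -> tle x y.
Proof.
case=> p [pP pu pr yp]; elim: p x pP pu pr yp => [|a p IH] x /=.
  by rewrite inE => _ _ _ /eqP->.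
case/andP=> xa ap /andP[xp pu] pr; rewrite inE => /orP[/eqP->//|yp].
apply: tle_trans (IH _ ap pu pr yp); apply: adj_upward => //.
by rewrite -pr; apply: path_avoid.
Qed.

Lemma tle_below x y : tle x y -> below x y.
Proof.
move=> xy; have [p [pP pu pr]] := simple_path x; exists p; split=> //.
move: xy; rewrite /tle => /orP[/eqP->|]; first exact: mem_head.
by apply: contraR => yp; rewrite -pr path_avoid.
Qed.

End RootedOrder.

#[global] Hint Resolve tle_refl tle_root : core.

(** * Contractions of rooted trees and the tops of their fibres *)

Section Contraction.
Variables (S T : rtree) (f : rhom S T).

Lemma rhom_contracting : contracting f.
Proof. by case/andP: (valP f). Qed.

Lemma rhom_root : f (root S) = root T.
Proof. by case/andP: (valP f) => _ /eqP. Qed.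

(** The image of an upward step cannot go down. Were [f (tpar x)] a child of [f x], the walk from
    [tpar x] to the root avoiding [x] would have to meet the fibre of [f x], and this connected
    fibre would lead back to [x] around the edge to its parent. *)
Lemma rhom_tpar x : x != root S -> f (tpar x) = f x \/ f x != root T /\ f (tpar x) = tpar (f x).
Proof.
move=> xr; have xp := tpar_adj xr.
case/orP: (contracting_adj rhom_contracting xp) => [/eqP->|fxp]; first by left.
case: (adjP fxp) => [[? ->]|[pr fx]]; first by right.
have nfx : f x != f (tpar x) by apply: contraTneq fxp => ->; rewrite adj_irr.
have lt : tlt (f (tpar x)) (f x) by rewrite fx tpar_gt.
have [p pP pE] := connectP (tlt_avoid (tpar_gt xr)).
have [z zp fz] : exists2 z, z \in tpar x :: p & f z = f x.
  have : tle (f (tpar x)) (f x) by apply: tltW.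
  rewrite /tle eq_sym (negPf nfx) /= -rhom_root pE => nc.
  have [/hasP[z zp /eqP fz]|/hasPn no] := boolP (has (fun z => f z == f x) (tpar x :: p)).
    by exists z.
  case/negP: nc; elim: (p) (tpar x) {pE} pP no => [|a q IH] b /=; first by rewrite connect0.
  case/andP=> /and3P[ba _ _] aq no.
  apply: connect_trans (IH a aq _); last by move=> c cq; apply: no; rewrite inE cq orbT.
  case/orP: (contracting_adj rhom_contracting ba) => [/eqP->|fba]; first exact: connect0.
  apply: connect1; rewrite /avoid /= fba no ?mem_head //.
  by apply: no; rewrite !inE eqxx orbT.
have /negP[] := adj_bridge xp; rewrite (@sym_connect_sym _ _ _ x); last first.
  by move=> a b /=; rewrite adj_sym setUC.
apply: (@connect_trans _ _ z).
  have : connect (avoid x) (tpar x) z.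
    case/splitPl: zp pP {pE} => p1 p2 <-; rewrite cat_path => /andP[pP1 _].
    by apply/connectP; exists p1.
  apply: connect_sub => a b /and3P[ab ax bx]; apply: connect1; rewrite /= ab.
  apply: contraTneq (set21 x (tpar x)) => <-.
  by rewrite !inE negb_or eq_sym ax eq_sym.
have := contracting_fiber rhom_contracting fz.
apply: connect_sub => a b /and3P[/eqP fa /eqP fb ab]; apply: connect1; rewrite /= ab.
apply: contraTneq (set22 x (tpar x)) => <-.
rewrite !inE negb_or; apply/andP; split; apply: contraNneq nfx => ->; rewrite ?fa ?fb fz //.
Qed.

Lemma rhom_mono x y : tle x y -> tle (f x) (f y).
Proof.
elim/upward_ind: x => x IH xy; case: (eqVneq x y) => [->//|nxy].
have lxy : tlt x y by rewrite /tlt nxy.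
have xr : x != root S by apply: contraTneq lxy => ->; apply/negP=> /tltNge; rewrite tle_root.
apply: tle_trans (IH _ (tpar_gt xr) (tpar_le lxy)).
case: (rhom_tpar xr) => [->//|[fr ->]]; exact: tltW (tpar_gt fr).
Qed.

Lemma fiber_top_exists w : exists m, (f m == w) && [forall x, (f x == w) ==> tle x m].
Proof.
have [x0 fx0] := contracting_surj rhom_contracting w.
have [m fm mmax] : exists2 m, f m = w & forall y, f y = w -> tle m y -> y = m.
  elim/upward_ind: x0 fx0 => x IH fx.
  have [/existsP[y /andP[fy xy]]|no] := boolP [exists y, (f y == w) && tlt x y].
    exact: IH xy (eqP fy).
  exists x => // y fy xy; apply/eqP; apply: contraNT no => nyx.
  by apply/existsP; exists y; rewrite fy eqxx /tlt eq_sym nyx.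
exists m; rewrite fm eqxx; apply/forallP=> x; apply/implyP=> /eqP fx.
(* Walk inside the connected fibre starting at [m]. A step to a child stays below [m]; a step to a
   parent could leave only from [m] itself, which maximality forbids. *)
have /connectP[p pP xE] := contracting_fiber rhom_contracting (etrans fm (esym fx)).
rewrite {x fx}xE; move: (tle_refl m); set R := (R in path R) in pP.
have: forall c, path R c p -> tle c m -> tle (last c p) m; last by apply.
elim: p {pP} => //= a p IH c /andP[/and3P[/eqP fc /eqP fa ca] ap] cm.
apply: IH ap _; case: (adjP ca) => [[cr aE]|[ar cE]]; last first.
  by apply: tle_trans cm; rewrite cE; apply: tltW (tpar_gt ar).
case: (eqVneq c m) => [cE|ncm]; last by rewrite aE; apply: tpar_le; rewrite /tlt ncm.
have ma : tle m a by rewrite aE cE; apply/tltW/tpar_gt; rewrite -cE.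
by rewrite (mmax a) // fa.
Qed.

Definition top_of (w : T) : S := xchoose (fiber_top_exists w).

Lemma top_ofK w : f (top_of w) = w.
Proof. by case/andP: (xchooseP (fiber_top_exists w)) => /eqP. Qed.

Lemma top_of_max x : tle x (top_of (f x)).
Proof.
by case/andP: (xchooseP (fiber_top_exists (f x))) => _ /forallP/(_ x); rewrite eqxx.
Qed.

Lemma top_of_fiber_max w : fiber_max f w (top_of w).
Proof.
split=> [|u <- /below_tle]; first exact: top_ofK.
by move=> le; apply: tle_anti (top_of_max u) le.
Qed.

Lemma fiber_max_top w m : fiber_max f w m -> m = top_of w.
Proof. by case=> <- mP; rewrite (mP (top_of (f m))) ?top_ofK //; apply/tle_below/top_of_max. Qed.

Lemma top_of_root : top_of (root T) = root S.
Proof.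
by apply: tle_anti => //; rewrite -rhom_root; apply: top_of_max.
Qed.

(** The fibre tops form the right adjoint of [f]. Monotonicity of tops, the recovery of [f] from
    them and their behaviour under composition all follow from this adjunction. *)
Lemma top_of_galois x w : tle (f x) w = tle x (top_of w).
Proof.
apply/idP/idP=> [|/rhom_mono]; last by rewrite top_ofK.
elim/upward_ind: x => x IH fxw; case: (eqVneq (f x) w) => [<-|nfx]; first exact: top_of_max.
have lxw : tlt (f x) w by rewrite /tlt nfx.
have xr : x != root S.
  apply: contraTneq lxw => ->; rewrite rhom_root.
  by apply/negP=> /tltNge; rewrite tle_root.
apply: tle_trans (tltW (tpar_gt xr)) (IH _ (tpar_gt xr) _).
by case: (rhom_tpar xr) => [->//|[fr ->]]; apply: tpar_le.
Qed.

Lemma tle_top w w' : tle (top_of w) (top_of w') = tle w w'.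
Proof. by rewrite -top_of_galois top_ofK. Qed.

Lemma top_of_inj : injective top_of.
Proof. exact: can_inj top_ofK. Qed.

End Contraction.

Lemma rhom_eq_top (S T : rtree) (f g : rhom S T) : top_of f =1 top_of g -> f = g.
Proof.
move=> fg; apply: rhomP => x; apply: tle_anti.
  by rewrite top_of_galois fg -top_of_galois.
by rewrite top_of_galois -fg -top_of_galois.
Qed.

Lemma top_of_comp (S T U : rtree) (g : rhom T U) (f : rhom S T) w :
  top_of (rcomp g f) w = top_of f (top_of g w).
Proof.
apply: tle_anti.
  by rewrite -!top_of_galois -rcompE top_ofK.
by rewrite -top_of_galois rcompE !top_ofK.
Qed.

Lemma top_of_id (T : rtree) w : top_of (rid T) w = w.
Proof. by rewrite -{2}(top_ofK (rid T) w) ridE. Qed.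

(** * Contractions obtained from order embeddings *)

Section OrderEmbedding.
Variables (S T : rtree) (m : T -> S).
Hypothesis m_tle : forall x y, tle (m x) (m y) = tle x y.
Hypothesis m_root : m (root T) = root S.

(** The images [m w] above [x] form a chain containing the root, so one of them is least. This gives
    the left adjoint of [m]. *)
Lemma retract_exists x : exists w, tle x (m w) && [forall w', tle x (m w') ==> tle w w'].
Proof.
have: tle x (m (root T)) by rewrite m_root.
elim/downward_ind: (root T) => w IH xw.
have [/existsP[w' /andP[lt le]]|no] := boolP [exists w', tlt w' w && tle x (m w')].
  exact: IH lt le.
exists w; rewrite xw; apply/forallP=> w'; apply/implyP=> xw'.
have := tle_chain xw xw'; rewrite !m_tle => /orP[//|w'w].
case: (eqVneq w' w) => [->//|ne]; case/existsP: no; exists w'.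
by rewrite /tlt ne w'w.
Qed.

Definition retract x : T := xchoose (retract_exists x).

Lemma retractP x w : tle (retract x) w = tle x (m w).
Proof.
case/andP: (xchooseP (retract_exists x)) => xm /forallP/(_ w)/implyP le.
by apply/idP/idP => // rw; apply: tle_trans xm _; rewrite m_tle.
Qed.

Lemma retractK w : retract (m w) = w.
Proof. by apply: tle_anti; rewrite ?retractP // -m_tle -retractP. Qed.

Lemma retract_mono x y : tle x y -> tle (retract x) (retract y).
Proof. by move=> xy; rewrite retractP; apply: tle_trans xy _; rewrite -retractP. Qed.

(** Parents go to equal vertices or to parents by adjunction. A fibre is connected because each of
    its vertices over [w] climbs parent by parent to [m w] without leaving it. *)
Lemma retract_contracting : contracting retract.
Proof.
have up x : x != root S -> (retract x == retract (tpar x)) || adj (retract x) (retract (tpar x)).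
  move=> xr; have xp := tpar_gt xr; case: eqP => //= /eqP ne.
  have lt : tlt (retract x) (retract (tpar x)) by rewrite /tlt ne retract_mono ?tltW.
  have rr : retract x != root T.
    by apply: contraTneq lt => ->; apply/negP=> /tltNge; rewrite tle_root.
  suff <- : tpar (retract x) = retract (tpar x) by apply: tpar_adj.
  apply: tle_anti; first exact: tpar_le.
  rewrite retractP; apply: tpar_le; rewrite /tlt -retractP tltW ?tpar_gt // andbT.
  apply: contraTneq (tpar_gt rr) => xE; have := retractK (tpar (retract x)).
  by rewrite -xE => <-; rewrite /tlt eqxx.
apply/andP; split.
  apply/forallP=> x; apply/forallP=> y; apply/implyP=> /adjP[[xr ->]|[yr ->]]; first exact: up.
  by rewrite eq_sym adj_sym; apply: up.
apply/forallP=> w; apply/andP; split; first by apply/set0Pn; exists (m w); rewrite inE retractK.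
set R := (R in connect R).
have symR : connect_sym R.
  by apply: sym_connect_sym => a b; rewrite /R /= adj_sym andbCA.
have toM x : retract x = w -> connect R x (m w).
  elim/upward_ind: x => x IH xw; case: (eqVneq x (m w)) => [->|ne]; first by rewrite connect0.
  have lt : tlt x (m w) by rewrite /tlt ne -retractP xw tle_refl.
  have xr : x != root S by apply: contraTneq lt => ->; apply/negP=> /tltNge; rewrite tle_root.
  have pw : retract (tpar x) = w.
    apply: tle_anti; first by rewrite retractP; apply: tpar_le.
    by rewrite -xw; apply: retract_mono; apply/tltW/tpar_gt.
  apply: connect_trans (connect1 _) (IH _ (tpar_gt xr) pw).
  by rewrite /R /= !inE xw pw eqxx tpar_adj.
apply/'forall_implyP=> x; rewrite inE => /eqP xw; apply/'forall_implyP=> y; rewrite inE => /eqP yw.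
by apply: connect_trans (toM x xw) _; rewrite symR toM.
Qed.

Fact rhom_of_subproof :
  let f := [ffun x : S => retract x] in contracting f && (f (root S) == root T).
Proof.
rewrite /= ffunE -m_root retractK eqxx andbT.
rewrite -(contracting_eq (f := retract)) ?retract_contracting //.
by move=> x; rewrite ffunE.
Qed.
Definition rhom_of : rhom S T := Sub [ffun x : S => retract x] rhom_of_subproof.

Lemma rhom_ofP x w : tle (rhom_of x) w = tle x (m w).
Proof. by rewrite /rfun /= ffunE retractP. Qed.

Lemma top_of_rhom_of w : top_of rhom_of w = m w.
Proof.
apply: tle_anti; first by rewrite -rhom_ofP top_ofK.
by rewrite -top_of_galois rhom_ofP.
Qed.

End OrderEmbedding.

(** * Rooted trees from finite orders *)

Definition tree_order (V : finType) (r : V) (le : rel V) : bool :=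
  [&& [forall x, le x x], [forall x, le x r],
      [forall x, forall y, le x y && le y x ==> (x == y)],
      [forall x, forall y, forall z, le x y && le y z ==> le x z]
    & [forall x, forall y, forall z, le x y && le x z ==> le y z || le z y]].

Section OrderTree.
Variables (V : finType) (r : V) (le : rel V).
Hypothesis leP : tree_order r le.

Lemma ord_refl x : le x x.
Proof. by case/and5P: leP => /forallP/(_ x). Qed.

Lemma ord_root x : le x r.
Proof. by case/and5P: leP => _ /forallP/(_ x). Qed.

Lemma ord_anti x y : le x y -> le y x -> x = y.
Proof.
move=> xy yx; case/and5P: leP => _ _ /forallP/(_ x)/forallP/(_ y) + _ _.
by rewrite xy yx => /eqP.
Qed.

Lemma ord_trans y x z : le x y -> le y z -> le x z.
Proof.
move=> xy yz; case/and5P: leP => _ _ _ /forallP/(_ x)/forallP/(_ y)/forallP/(_ z) + _.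
by rewrite xy yz.
Qed.

Lemma ord_chain x y z : le x y -> le x z -> le y z || le z y.
Proof.
move=> xy xz; case/and5P: leP => _ _ _ _ /forallP/(_ x)/forallP/(_ y)/forallP/(_ z).
by rewrite xy xz.
Qed.

Definition covered x y :=
  [&& x != y, le x y & [forall z, (x != z) && le x z ==> le y z]].

Lemma coveredP x y z : covered x y -> x != z -> le x z -> le y z.
Proof. by case/and3P=> _ _ /forallP/(_ z)/implyP H nxz xz; apply: H; rewrite nxz. Qed.

Lemma covered_unique x y z : covered x y -> covered x z -> y = z.
Proof.
move=> xy xz; case/and3P: (xy) => nxy lxy _; case/and3P: (xz) => nxz lxz _.
by apply: ord_anti; [apply: coveredP xy _ _ | apply: coveredP xz _ _].
Qed.

Lemma ord_down_ind (P : V -> Prop) :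
  (forall x, (forall y, y != x -> le y x -> P y) -> P x) -> forall x, P x.
Proof.
move=> IH x; have [n] := ubnP #|[pred y | le y x]|.
elim: n x => // n IHn x; rewrite ltnS => le_n; apply: IH => y nyx yx; apply: IHn.
apply: leq_trans le_n; apply: proper_card; apply/properP; split.
  by apply/subsetP=> z; rewrite !inE => zy; apply: ord_trans zy yx.
exists x; rewrite !inE ?ord_refl //; apply: contra nyx => xy.
by rewrite (ord_anti xy yx).
Qed.

Lemma ord_up_ind (P : V -> Prop) :
  (forall x, (forall y, y != x -> le x y -> P y) -> P x) -> forall x, P x.
Proof.
move=> IH x; have [n] := ubnP #|[pred y | le x y]|.
elim: n x => // n IHn x; rewrite ltnS => le_n; apply: IH => y nyx xy; apply: IHn.
apply: leq_trans le_n; apply: proper_card; apply/properP; split.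
  by apply/subsetP=> z; rewrite !inE => yz; apply: ord_trans xy yz.
exists x; rewrite !inE ?ord_refl //; apply: contra nyx => yx.
by rewrite (ord_anti xy yx).
Qed.

Lemma covered_exists x : x != r -> exists y, covered x y.
Proof.
move=> xr; suff H z : x != z -> le x z -> exists y, covered x y by apply: (H r xr (ord_root x)).
elim/ord_down_ind: z => z IH nxz xz.
have [/existsP[y /and4P[nxy xy nyz yz]]|no] :=
    boolP [exists y, [&& x != y, le x y, y != z & le y z]]; first exact: IH nxy xy.
exists z; rewrite /covered nxz xz; apply/forallP=> y; apply/implyP=> /andP[nxy xy].
have /orP[//|yz] := ord_chain xz xy.
case: (eqVneq y z) => [->|nyz]; first exact: ord_refl.
by case/existsP: no; exists y; rewrite nxy xy nyz.
Qed.

Definition order_adj : rel V := [rel x y | covered x y || covered y x].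

Lemma order_adj_sym : symmetric order_adj.
Proof. by move=> x y; rewrite /order_adj /= orbC. Qed.

Lemma order_adj_irr : irreflexive order_adj.
Proof. by move=> x; rewrite /order_adj /= /covered eqxx. Qed.

Lemma order_adj_connected x y : connect order_adj x y.
Proof.
have toR z : connect order_adj z r.
  elim/ord_up_ind: z => z IH; case: (eqVneq z r) => [->|/covered_exists[z' zy]].
    by rewrite connect0.
  case/and3P: (zy) => nzy lzy _; apply: connect_trans (IH z' _ lzy); last by rewrite eq_sym.
  by apply: connect1; rewrite /order_adj /= zy.
apply: connect_trans (toR x) _.
by rewrite (sym_connect_sym order_adj_sym).
Qed.

(** A minimal vertex of a cycle would be covered by both of its neighbours on it, which are
    distinct; but covers are unique. *)
Lemma order_adj_acyclic (c : seq V) : 2 < size c -> ~~ ucycleb order_adj c.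
Proof.
move=> sz; apply/negP=> /andP[cyc cu].
have [x xc xmin] : exists2 x, x \in c & forall y, y \in c -> le y x -> y = x.
  case: c sz {cyc cu} => // x0 c _; move: (mem_head x0 c); move: (x0 :: c) => s.
  elim/ord_down_ind: x0 => x IH xs.
  have [/hasP[y ys /andP[nyx yx]]|no] := boolP (has (fun y => (y != x) && le y x) s).
    by apply: IH ys.
  exists x => // y ys yx; apply/eqP; apply: contraNT no => nyx.
  by apply/hasP; exists y; rewrite ?nyx.
have [i [|y [|w c']] cE] := rot_to xc; [by move: sz; rewrite -(size_rot i) cE..|].
have: cycle order_adj (rot i c) by rewrite rot_cycle.
have: uniq (rot i c) by rewrite rot_uniq.
rewrite cE [cycle _ _]/= rcons_path => /and3P[xc' yc' _] /and3P[xy _ zx].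
have cov y' : y' \in c -> order_adj x y' -> covered x y'.
  move=> yc /orP[//|/and3P[nyx yx _]]; by rewrite (xmin _ yc yx) eqxx in nyx.
have inC y' : y' \in rot i c -> y' \in c by rewrite mem_rot.
have xyC : covered x y by apply: cov => //; apply: inC; rewrite cE !inE eqxx orbT.
have xzC : covered x (last w c').
  apply: cov; first by apply: inC; rewrite cE 2!inE mem_last !orbT.
  by rewrite order_adj_sym; case/andP: zx.
by case/negP: yc'; rewrite (covered_unique xyC xzC) mem_last.
Qed.

Definition order_tree : tree :=
  Tree order_adj_sym order_adj_irr order_adj_connected order_adj_acyclic.
Definition order_rtree : rtree := @RTree order_tree r.

(** A walk avoiding [y] that starts strictly below [y] stays strictly below it, while from a vertex
    not below [y] the chain of covers reaches the root without meeting [y]. *)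
Lemma order_rtree_tle (x y : V) : tle (T := order_rtree) x y = le x y.
Proof.
apply/idP/idP=> [|xy].
  rewrite /tle; case: eqP => [-> _|_ /=]; first exact: ord_refl.
  apply: contraNT; elim/ord_up_ind: x => x IH nxy.
  case: (eqVneq x r) => [->|/covered_exists[z xz]]; first by rewrite connect0.
  case/and3P: (xz) => nxz lxz _.
  have nzy : ~~ le z y by apply: contra nxy; apply: ord_trans.
  apply: connect_trans (connect1 _) (IH z _ lxz nzy); last by rewrite eq_sym.
  apply/and3P; split; first by apply/orP; left.
    by apply: contraNneq nxy => ->; apply: ord_refl.
  by apply: contraNneq nzy => ->; apply: ord_refl.
rewrite /tle; case: eqP => //= /eqP nxy; apply/negP=> /connectP[p pP rE].
have: le (last x p) y && (last x p != y).
  elim: p x xy nxy pP {rE} => [|a p IH] x xy nxy /=; first by rewrite xy.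
  case/andP=> /and3P[/orP[xa|ax] _ nay]; apply: IH => //; first exact: coveredP xa nxy xy.
  by case/and3P: ax => _ ax _; apply: ord_trans ax xy.
rewrite -rE => /andP[ry /eqP]; apply.
exact: ord_anti (ord_root _).
Qed.

End OrderTree.

Lemma tle_order (T : rtree) : tree_order (root T) (@tle T).
Proof.
apply/and5P; split.
- exact/forallP/tle_refl.
- exact/forallP/tle_root.
- apply/forallP=> x; apply/forallP=> y; apply/implyP=> /andP[xy yx].
  exact/eqP/tle_anti.
- apply/forallP=> x; apply/forallP=> y; apply/forallP=> z; apply/implyP=> /andP[].
  exact: tle_trans.
- apply/forallP=> x; apply/forallP=> y; apply/forallP=> z; apply/implyP=> /andP[].
  exact: tle_chain.
Qed.

(** Sending an edge to its lower endpoint is injective and misses the root. *)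
Lemma card_tedge (T : rtree) : #|{: tedge T}| < #|T|.
Proof.
have child (A : tedge T) : exists x : T, (x != root T) && (val A == [set x; tpar x]).
  case: A => A /= /existsP[x /existsP[y /andP[/adjP[[xr ->]|[yr ->]] /eqP->]]].
    by exists x; rewrite xr eqxx.
  by exists y; rewrite yr setUC eqxx.
pose g A := xchoose (child A).
have gP A : val A = [set g A; tpar (g A)] by case/andP: (xchooseP (child A)) => _ /eqP.
have g_inj : injective g by move=> A B gAB; apply: val_inj; rewrite !gP gAB.
rewrite -(card_codom g_inj); apply: proper_card; apply/properP; split; first exact/subsetP.
exists (root T) => //; apply/negP=> /codomP[A rE].
by case/andP: (xchooseP (child A)); rewrite -/(g A) -rE eqxx.
Qed.

(** * Kruskal's theorem for ordered forests *)

Definition strictly_increasing (p : nat -> nat) := forall i j, i < j -> p i < p j.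

Lemma increasing_step (p : nat -> nat) : (forall i, p i < p i.+1) -> strictly_increasing p.
Proof.
move=> H i j; elim: j => // j IH; rewrite ltnS leq_eqVlt => /orP[/eqP->//|/IH ij].
exact: ltn_trans ij (H j).
Qed.

Definition good (A : Type) (R : A -> A -> Prop) (s : nat -> A) : Prop :=
  exists i j, i < j /\ R (s i) (s j).

Definition ascending (A : Type) (R : A -> A -> Prop) (s : nat -> A) : Prop :=
  exists p, strictly_increasing p /\ forall i j, i < j -> R (s (p i)) (s (p j)).

Definition wqo (A : Type) (R : A -> A -> Prop) := forall s, ascending R s.

(** Call an index terminal when no later term dominates its term. Infinitely many terminal indices
    would give a subsequence that is not good; past the last one, dominating terms can be chosen
    greedily. *)
Lemma good_ascending (A : Type) (R : A -> A -> Prop) (s : nat -> A) :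
  (forall x y z, R x y -> R y z -> R x z) ->
  (forall p, strictly_increasing p -> good R (s \o p)) -> ascending R s.
Proof.
move=> Rt sg; pose terminal i := forall j, i < j -> ~ R (s i) (s j).
have [N NP] : exists N, forall i, N <= i -> ~ terminal i.
  apply: contrapT => /forallNP inf.
  have /choice[q qP] N : exists i, N <= i /\ terminal i.
    have /existsNP[i /not_implyP[Ni /contrapT ti]] := inf N; by exists i.
  pose p := fix p n := if n is m.+1 then q (p m).+1 else q 0.
  have pi : strictly_increasing p by apply: increasing_step => i /=; case: (qP (p i).+1).
  have pt i : terminal (p i) by case: i => [|i] /=; [case: (qP 0) | case: (qP (p i).+1)].
  have [i [j [ij]]] := sg p pi; exact: pt (pi _ _ ij).
have /choice[q qP] i : exists j, N <= i -> i < j /\ R (s i) (s j).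
  have [Ni|] := leqP N i; last by exists 0.
  have /existsNP[j /not_implyP[ij /contrapT Rij]] := NP _ Ni; by exists j.
pose p := fix p n := if n is m.+1 then q (p m) else N.
have pN i : N <= p i.
  elim: i => //= i IH; apply: leq_trans (IH) _; by case: (qP _ IH) => /ltnW.
exists p; split; first by apply: increasing_step => i /=; case: (qP _ (pN i)).
move=> i j; elim: j => // j IH; rewrite ltnS leq_eqVlt => /orP[/eqP->|/IH ij].
  by case: (qP _ (pN j)).
by apply: Rt ij _; case: (qP _ (pN j)).
Qed.

Lemma wqo_leq : wqo (fun m n : nat => m <= n).
Proof.
move=> s; apply: good_ascending => [x y z|p pi]; first exact: leq_trans.
(* Induction on a bound for the first value: if [t 0 <= t 1] fails, the shifted sequence has a
   smaller bound. *)
have H : forall n (t : nat -> nat), t 0 <= n -> good (fun m n => m <= n) t.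
  elim=> [|n IH] t t0; first by exists 0, 1; rewrite (eqP (_ : t 0 == 0)) -?leqn0.
  have [t01|t10] := leqP (t 0) (t 1); first by exists 0, 1.
  have [|i [j [ij tij]]] := IH (fun i => t i.+1); first by rewrite -ltnS (leq_trans t10).
  by exists i.+1, j.+1.
exact: (H _ (s \o p) (leqnn _)).
Qed.

Lemma wqo_eq (L : finType) : wqo (fun x y : L => x = y).
Proof.
move=> s; apply: good_ascending => [x y z -> //|p pi].
have : ~ injective (fun i : 'I_#|L|.+1 => s (p i)).
  move=> inj; have := leq_card _ inj; by rewrite card_ord ltnn.
move=> /existsNP[i /existsNP[j /not_implyP[E ne]]].
case: (ltngtP i j) => [ij|ji|/val_inj//].
  by exists i, j.
by exists j, i.
Qed.

Inductive forest (A : Type) := FNil | FCons of A & forest A & forest A.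
Arguments FNil {A}.

(* [FCons a C F] is the forest whose first tree has root [a] with children [C], followed by [F].
   An embedding keeps roots or moves everything into the children or the remaining trees, as
   for binary trees. *)
Inductive femb (A B : Type) (R : A -> B -> Prop) : forest A -> forest B -> Prop :=
| FEmbNil F' : femb R FNil F'
| FEmbKeep a b C C' F F' : R a b -> femb R C C' -> femb R F F' ->
  femb R (FCons a C F) (FCons b C' F')
| FEmbDown b F C' F' : femb R F C' -> femb R F (FCons b C' F')
| FEmbNext b F C' F' : femb R F F' -> femb R F (FCons b C' F').

Lemma femb_trans (A : Type) (R : A -> A -> Prop) :
  (forall x y z, R x y -> R y z -> R x z) ->
  forall x y z, femb R x y -> femb R y z -> femb R x z.
Proof.
move=> Rt x y z + yz; elim: yz x => {y z} [F' x xF|a b C C' F F' ab _ IHC _ IHF x xy||].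
- by inversion xF; constructor.
- inversion xy; subst; [constructor | constructor | apply: FEmbDown | apply: FEmbNext]; eauto.
- by move=> b F C' F' _ IH x xF; apply/FEmbDown/IH.
- by move=> b F C' F' _ IH x xF; apply/FEmbNext/IH.
Qed.

Fixpoint fsize (A : Type) (F : forest A) : nat :=
  if F is FCons _ C F' then (fsize C + fsize F').+1 else 0.

Section Kruskal.
Variables (A : Type) (R : A -> A -> Prop).
Hypotheses (R_trans : forall x y z, R x y -> R y z -> R x z) (R_wqo : wqo R).

Definition bad_from (l : seq (forest A)) : Prop :=
  exists s, ~ good (femb R) s /\ forall i, i < size l -> s i = nth FNil l i.

(* Nash-Williams: extend a bad prefix by a forest of least size. *)
Lemma minimal_extension (l : seq (forest A)) : exists x, bad_from l ->
  bad_from (rcons l x) /\ forall y, bad_from (rcons l y) -> fsize x <= fsize y.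
Proof.
have [bl|] := pselect (bad_from l); last by exists FNil.
have ex : exists n, `[< exists2 x, fsize x = n & bad_from (rcons l x) >].
  have [s [sb sl]] := bl; exists (fsize (s (size l))); apply/asboolP; exists (s (size l)) => //.
  exists s; split=> // i; rewrite size_rcons ltnS leq_eqVlt nth_rcons => /orP[/eqP->|il].
    by rewrite ltnn eqxx.
  by rewrite il; apply: sl.
case: (ex_minnP ex) => n /asboolP[x xn bx] nmin; exists x => _; split=> // y by_.
by rewrite xn; apply: nmin; apply/asboolP; exists y.
Qed.

(** The successive minimal extensions form a minimal bad sequence [m]. Its children and its
    remainders behave well, so along a common subsequence the labels, the children and the
    remainders all embed, and hence so do the forests, a contradiction. *)
Lemma femb_good (s0 : nat -> forest A) : good (femb R) s0.
Proof.
apply: contrapT => s0bad; have /choice[e eP] := minimal_extension.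
pose l := fix l n := if n is k.+1 then rcons (l k) (e (l k)) else [::].
have size_l n : size (l n) = n by elim: n => //= n IH; rewrite size_rcons IH.
have bl n : bad_from (l n).
  elim: n => [|n IH] /=; first by exists s0.
  by case: (eP _ IH).
pose m n := e (l n).
have nth_l i n : i < n -> nth FNil (l n) i = m i.
  elim: n => // n IH; rewrite ltnS leq_eqVlt /= nth_rcons size_l => /orP[/eqP->|lt].
    by rewrite ltnn eqxx.
  by rewrite lt IH.
have m_bad i j : i < j -> ~ femb R (m i) (m j).
  move=> ij mij; have [s [sb sl]] := bl j.+1; case: sb; exists i, j; split=> //.
  by rewrite !sl ?size_l ?nth_l // ltnW // ltnS.
have m_min n y s : (forall i, i < n -> s i = m i) -> s n = y -> ~ good (femb R) s ->
    fsize (m n) <= fsize y.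
  move=> sm sn sb; have [_] := eP _ (bl n); apply; exists s; split=> // i.
  rewrite size_rcons size_l ltnS leq_eqVlt nth_rcons size_l => /orP[/eqP->|lt].
    by rewrite ltnn eqxx.
  by rewrite lt nth_l // sm.
have /choice[a aP] : forall n, exists a, exists C F, m n = FCons a C F.
  move=> n.
  case E: (m n) => [|a C F]; last by exists a, C, F.
  by case: (@m_bad n n.+1) => //; rewrite E; constructor.
have [C CP] := choice aP; have [F FP] := choice CP.
(* Cut a bad sequence of parts at one taken from the least index [n], and put the first [n] terms of
   [m] in front. The result is bad with a smaller term at [n], against minimality. *)
have sub_good (t : nat -> forest A) (k : nat -> nat) :
    (forall i, t i = C (k i) \/ t i = F (k i)) -> good (femb R) t.
  move=> tk; apply: contrapT => tb.
  have ex : exists n, `[< exists i, k i = n >] by exists (k 0); apply/asboolP; exists 0.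
  case: (ex_minnP ex) => n /asboolP[i0 ki0] nmin.
  have kge i : n <= k i by apply: nmin; apply/asboolP; exists i.
  have t_le i : femb R (t i) (m (k i)) -> True by [].
  have up x i : femb R x (t i) -> femb R x (m (k i)).
    by rewrite FP => xt; case: (tk i) xt => ->; [apply: FEmbDown | apply: FEmbNext].
  pose s i := if i < n then m i else t (i - n + i0).
  have sn : s n = t i0 by rewrite /s ltnn subnn.
  have lt_t : fsize (t i0) < fsize (m n).
    by rewrite -ki0 FP /= ltnS; case: (tk i0) => ->; rewrite ?leq_addr ?leq_addl.
  suff sb : ~ good (femb R) s.
    have sm i : i < n -> s i = m i by move=> lt; rewrite /s lt.
    by have := m_min _ _ _ sm sn sb; rewrite leqNgt lt_t.
  case=> i [j [ij]]; rewrite /s; case: (ltnP i n) => ni; case: (ltnP j n) => nj.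
  - exact: m_bad.
  - by move/up; apply: m_bad; apply: leq_trans (ni) (kge _).
  - by have := leq_ltn_trans ni (ltn_trans ij nj); rewrite ltnn.
  - move=> tij; apply: tb; exists (i - n + i0), (j - n + i0); split=> //.
    by rewrite ltn_add2r ltn_sub2r // (leq_ltn_trans ni).
have [p [pi pR]] := R_wqo a.
have [q [qi qR]] : ascending (femb R) (C \o p).
  apply: good_ascending => [|u ui]; first exact: femb_trans.
  by apply: (sub_good _ (p \o u)) => i; left.
have [r [ri rR]] : ascending (femb R) (F \o p \o q).
  apply: good_ascending => [|u ui]; first exact: femb_trans.
  by apply: (sub_good _ (p \o q \o u)) => i; right.
have i01 := ri 0 1 isT; apply: (m_bad (p (q (r 0))) (p (q (r 1)))).
  exact/pi/qi.
rewrite !FP; apply: FEmbKeep; first exact/pR/qi.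
  exact: qR.
exact: rR.
Qed.

Lemma femb_wqo : wqo (femb R).
Proof.
by move=> s; apply: good_ascending => [|p _]; [apply: femb_trans | apply: femb_good].
Qed.

End Kruskal.

(** * Vertices of forests and the vertex maps underlying embeddings *)

Section Forest.
Variable A : eqType.

Fixpoint fverts (F : forest A) : seq A :=
  if F is FCons a C F' then a :: fverts C ++ fverts F' else [::].

Fixpoint fbelow (F : forest A) (x y : A) : bool :=
  if F is FCons a C F' then
    [|| (y == a) && (x \in a :: fverts C), fbelow C x y | fbelow F' x y]
  else false.

Lemma fbelow_verts F x y : fbelow F x y -> (x \in fverts F) && (y \in fverts F).
Proof.
elim: F => //= a C IHC F IHF; rewrite !inE !mem_cat.
case/or3P=> [/andP[/eqP->]|/IHC/andP[-> ->]|/IHF/andP[-> ->]]; rewrite ?eqxx ?orbT //.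
by rewrite andbT => /orP[->//|->]; rewrite orbT.
Qed.

End Forest.

Fixpoint fmap (A B : Type) (f : A -> B) (F : forest A) : forest B :=
  if F is FCons a C F' then FCons (f a) (fmap f C) (fmap f F') else FNil.

Lemma femb_fmap (A B A' B' : Type) (f : A -> A') (g : B -> B') (R : A' -> B' -> Prop) F F' :
  femb R (fmap f F) (fmap g F') -> femb (fun x y => R (f x) (g y)) F F'.
Proof.
move: {-1}(fmap f F) (erefl (fmap f F)) {-1}(fmap g F') (erefl (fmap g F')) => X XE Y YE XY.
elim: XY F F' XE YE => {X Y} [Y|a b C C' F F' ab _ IHC _ IHF|b X C' Y' _ IH|b X C' Y' _ IH].
- by case=> //= F' _ _; constructor.
- case=> //= a1 C1 F1; case=> //= b1 C1' F1' [aE CE FE] [bE CE' FE'].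
  by apply: FEmbKeep; [rewrite aE bE | apply: IHC | apply: IHF].
- by move=> F1; case=> //= b1 C1' F1' XE [_ CE FE]; apply/FEmbDown/IH.
- by move=> F1; case=> //= b1 C1' F1' XE [_ CE FE]; apply/FEmbNext/IH.
Qed.

Section Extract.
Variables (A B : eqType) (b0 : B).

(** Distinctness of the vertices allows the maps on the children and on the remaining trees to be
    glued. The subsequence condition says that the depth-first order is kept; together with the
    equality of [fbelow] it is what a planar contraction needs. *)
Lemma femb_extract (R : A -> B -> Prop) F F' : femb R F F' ->
  uniq (fverts F) -> uniq (fverts F') -> exists g : A -> B,
  [/\ forall x, x \in fverts F -> R x (g x), subseq (map g (fverts F)) (fverts F')
    & forall x y, x \in fverts F -> y \in fverts F -> fbelow F' (g x) (g y) = fbelow F x y].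
Proof.
elim=> {F F'} [F' _ _|a b C C' F F' ab _ IHC _ IHF|b F C' F' _ IH|b F C' F' _ IH] /=.
- by exists (fun=> b0); split=> //; apply: sub0seq.
- rewrite !mem_cat !negb_or !cat_uniq.
  move=> /and4P[/andP[aC aF] uC CF uF] /and4P[/andP[bC bF] uC' CF' uF'].
  have [gC [gCR gCs gCb]] := IHC uC uC'; have [gF [gFR gFs gFb]] := IHF uF uF'.
  have dCF x : x \in fverts C -> x \in fverts F = false.
    by move=> xC; apply: contraNF CF => xF; apply/hasP; exists x.
  have dCF' x : x \in fverts C' -> x \in fverts F' = false.
    by move=> xC; apply: contraNF CF' => xF; apply/hasP; exists x.
  pose g x := if x == a then b else if x \in fverts C then gC x else gF x.
  have ga : g a = b by rewrite /g eqxx.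
  have gCE x : x \in fverts C -> g x = gC x.
    by move=> xC; rewrite /g xC; case: eqP aC => // <-; rewrite xC.
  have gFE x : x \in fverts F -> g x = gF x.
    move=> xF; rewrite /g; case: eqP aF => [<-|_ _]; first by rewrite xF.
    by case: ifP => // /dCF; rewrite xF.
  have gCm x : x \in fverts C -> gC x \in fverts C'.
    by move=> xC; apply: (mem_subseq gCs); apply: map_f.
  have gFm x : x \in fverts F -> gF x \in fverts F'.
    by move=> xF; apply: (mem_subseq gFs); apply: map_f.
  exists g; split.
  + move=> x; rewrite inE mem_cat => /or3P[/eqP->|xC|xF]; first by rewrite ga.
      by rewrite gCE //; apply: gCR.
    by rewrite gFE //; apply: gFR.
  + rewrite ga eqxx map_cat; apply: cat_subseq.
      by rewrite (eq_in_map _ gC _).1.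
    by rewrite (eq_in_map _ gF _).1.
  have nC' u v : (u \notin fverts C') || (v \notin fverts C') -> fbelow C' u v = false.
    by move=> nn; apply: contraTF nn => /fbelow_verts; rewrite negb_or !negbK.
  have nF' u v : (u \notin fverts F') || (v \notin fverts F') -> fbelow F' u v = false.
    by move=> nn; apply: contraTF nn => /fbelow_verts; rewrite negb_or !negbK.
  have nC u v : (u \notin fverts C) || (v \notin fverts C) -> fbelow C u v = false.
    by move=> nn; apply: contraTF nn => /fbelow_verts; rewrite negb_or !negbK.
  have nF u v : (u \notin fverts F) || (v \notin fverts F) -> fbelow F u v = false.
    by move=> nn; apply: contraTF nn => /fbelow_verts; rewrite negb_or !negbK.
  have neC u : u \in fverts C -> (u == a) = false by move=> uC1; apply: contraNF aC => /eqP<-.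
  have neF u : u \in fverts F -> (u == a) = false by move=> uF1; apply: contraNF aF => /eqP<-.
  have neC' u : u \in fverts C' -> (u == b) = false by move=> uC1; apply: contraNF bC => /eqP<-.
  have neF' u : u \in fverts F' -> (u == b) = false by move=> uF1; apply: contraNF bF => /eqP<-.
  have dFC' u : u \in fverts F' -> u \in fverts C' = false.
    by move=> uF1; apply/negP=> /dCF'; rewrite uF1.
  have dFC u : u \in fverts F -> u \in fverts C = false.
    by move=> uF1; apply/negP=> /dCF; rewrite uF1.
  move=> x y; rewrite !inE !mem_cat => /or3P[/eqP->|xC|xF] /or3P[/eqP->|yC|yF].
  + by rewrite ga !eqxx.
  + rewrite ga (gCE y) // !eqxx (neC' (gC y)) ?gCm // (neC y) //=.
    by rewrite nC' ?bC // nF' ?bF // nC ?aC // nF ?aF.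
  + rewrite ga (gFE y) // !eqxx (neF' (gF y)) ?gFm // (neF y) //=.
    by rewrite nC' ?bC // nF' ?bF // nC ?aC // nF ?aF.
  + by rewrite ga (gCE x) // !eqxx gCm // xC !orbT.
  + rewrite (gCE x) // (gCE y) // (neC' (gC y)) ?gCm // (neC y) //= gCb //; congr (_ || _).
    by rewrite nF' ?dCF' ?gCm // nF ?dCF.
  + rewrite (gCE x) // (gFE y) // (neF' (gF y)) ?gFm // (neF y) //=.
    rewrite nC' ?(dFC' (gF y)) ?gFm ?orbT // nF' ?(dCF' (gC x)) ?gCm //.
    by rewrite nC ?(dFC y) ?orbT // nF ?(dCF x).
  + rewrite ga (gFE x) // !eqxx (neF' (gF x)) ?gFm // (neF x) // (dFC' (gF x)) ?gFm // (dFC x) //=.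
    by rewrite nC' ?bC ?orbT // nF' ?bF ?orbT // nC ?aC ?orbT // nF ?aF ?orbT.
  + rewrite (gCE y) // (gFE x) // (neC' (gC y)) ?gCm // (neC y) //=.
    rewrite nC' ?(dFC' (gF x)) ?gFm // nF' ?(dCF' (gC y)) ?gCm ?orbT //.
    by rewrite nC ?(dFC x) // nF ?(dCF y) ?orbT.
  + rewrite (gFE x) // (gFE y) // (neF' (gF y)) ?gFm // (neF y) //= gFb //.
    by rewrite nC' ?(dFC' (gF x)) ?gFm // nC ?(dFC x).
- rewrite mem_cat negb_or cat_uniq => uF /andP[/andP[bC bF] /and3P[uC' CF' uF']].
  have [g [gR gs gb]] := IH uF uC'; exists g; split=> //.
    exact: (subseq_trans gs (subseq_trans (prefix_subseq _ _) (subseq_cons _ b))).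
  move=> x y xF yF; have gm z : z \in fverts F -> g z \in fverts C'.
    by move=> zF; apply: (mem_subseq gs); apply: map_f.
  rewrite gb //; have -> : (g y == b) = false.
    by apply: contraNF bC => /eqP<-; apply: gm.
  rewrite /=; case nF: (fbelow F' _ _); last by rewrite orbF.
  have /andP[gxF _] := fbelow_verts nF.
  by case/negP: CF'; apply/hasP; exists (g x) => //; apply: gm.
- rewrite mem_cat negb_or cat_uniq => uF /andP[/andP[bC bF] /and3P[uC' CF' uF']].
  have [g [gR gs gb]] := IH uF uF'; exists g; split=> //.
    exact: (subseq_trans gs (subseq_trans (suffix_subseq _ _) (subseq_cons _ b))).
  move=> x y xF yF; have gm z : z \in fverts F -> g z \in fverts F'.
    by move=> zF; apply: (mem_subseq gs); apply: map_f.
  rewrite gb //; have -> : (g y == b) = false.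
    by apply: contraNF bF => /eqP<-; apply: gm.
  rewrite /=; case nC: (fbelow C' _ _) => //.
  have /andP[gxC _] := fbelow_verts nC.
  by case/negP: CF'; apply/hasP; exists (g x) => //; apply: gm.
Qed.

End Extract.

(** The induction runs over subsets [W], since removing a maximal vertex [a] does not leave a tree:
    the vertices below [a] become its children, and those not below it the remaining forest. *)
Lemma forest_of_rtree (T : rtree) : exists F : forest T,
  [/\ uniq (fverts F), forall x, x \in fverts F & forall x y, fbelow F x y = tle x y].
Proof.
suff H (W : {set T}) : exists F : forest T, [/\ uniq (fverts F), fverts F =i W &
    {in W &, forall x y, fbelow F x y = tle x y}].
  have [F [Fu FW Fb]] := H setT; exists F; split=> // [x|x y]; first by rewrite FW inE.
  by apply: Fb; rewrite inE.
have [n] := ubnP #|W|; elim: n W => // n IH W; rewrite ltnS => Wn.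
have [->|[w wW]] := set_0Vmem W.
  by exists FNil; split=> // [x|x y]; rewrite ?inE.
have [a aW amax] : exists2 a, a \in W & forall x, x \in W -> tle a x -> x = a.
  elim/upward_ind: w wW => w IHw wW.
  have [/existsP[y /andP[yW wy]]|no] := boolP [exists y, (y \in W) && tlt w y].
    by apply: IHw yW.
  exists w => // x xW wx; apply/eqP; apply: contraNT no => nxw.
  by apply/existsP; exists x; rewrite xW /tlt eq_sym nxw.
pose WC := [set x in W | tlt x a]; pose WF := [set x in W | ~~ tle x a].
have ltC : #|WC| < n.
  apply: leq_trans Wn; apply: proper_card; apply/properP; split.
    by apply/subsetP=> x; rewrite inE => /andP[].
  by exists a; rewrite // inE aW /tlt eqxx.
have ltF : #|WF| < n.
  apply: leq_trans Wn; apply: proper_card; apply/properP; split.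
    by apply/subsetP=> x; rewrite inE => /andP[].
  by exists a; rewrite // inE aW tle_refl.
have [C [Cu CW Cb]] := IH _ ltC; have [F [Fu FW Fb]] := IH _ ltF.
have WE x : x \in W -> [|| x == a, x \in WC | x \in WF].
  by move=> xW; rewrite !inE xW /tlt; case: (x == a); case: (tle x a).
exists (FCons a C F); split.
- rewrite /= mem_cat !CW !FW !inE /tlt eqxx /= tle_refl andbF /= cat_uniq Cu Fu andbT /=.
  apply/hasPn=> x; rewrite FW CW !inE => /andP[_ xa]; rewrite /tlt; apply/negP=> /and3P[_ _ xa'].
  by rewrite xa' in xa.
- move=> x; rewrite inE mem_cat CW FW; apply/idP/idP; last exact: WE.
  by rewrite !inE => /or3P[/eqP->|/andP[]|/andP[]].
have inCF x : x \in WC -> x \notin WF.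
  by rewrite !inE => /andP[xW /tltW->]; rewrite andbF.
have inFC x : x \in WF -> x \notin WC by move=> xF; apply/negP=> /inCF; rewrite xF.
have belowN (X : forest T) (Y : {set T}) x y : fverts X =i Y -> (x \notin Y) || (y \notin Y) ->
  fbelow X x y = false.
  by move=> XY nn; apply: contraTF nn => /fbelow_verts; rewrite !XY negb_or !negbK.
have aC : a \notin WC by rewrite !inE /tlt eqxx andbF.
have aF : a \notin WF by rewrite !inE tle_refl andbF.
have ne (z : T) (Y : {set T}) : z \in Y -> a \notin Y -> (z == a) = false.
  by move=> zY aY; apply: contraNF aY => /eqP<-.
move=> x y /WE xWE /WE yWE /=; rewrite inE CW.
case/or3P: yWE => [/eqP->|yC|yF].
- rewrite eqxx (belowN C _ _ _ CW) ?aC ?orbT // (belowN F _ _ _ FW) ?aF ?orbT // !orbF.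
  case/or3P: xWE => [/eqP->|xC|xF]; first by rewrite eqxx tle_refl.
    by rewrite xC orbT; move: xC; rewrite inE => /andP[_ /tltW].
  rewrite (ne x WF) //= (negPf (inFC _ xF)).
  by apply/esym/negP; move: xF; rewrite inE => /andP[_ /negP].
- rewrite (ne y WC) //= (belowN F _ _ _ FW) ?(inCF y) ?orbT // orbF.
  case/or3P: xWE => [/eqP->|xC|xF].
  + rewrite (belowN C _ _ _ CW) ?aC //; apply/esym/negP.
    by move: yC; rewrite inE => /andP[_ /tltNge/negP].
  + exact: Cb.
  + rewrite (belowN C _ _ _ CW) ?(inFC x) //; apply/esym/negP=> xy.
    move: xF yC; rewrite !inE => /andP[_ /negP nxa] /andP[_ /tltW ya].
    by apply: nxa; apply: tle_trans xy ya.
- rewrite (ne y WF) //= (belowN C _ _ _ CW) ?(inFC y) ?orbT //=.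
  case/or3P: xWE => [/eqP->|xC|xF].
  + rewrite (belowN F _ _ _ FW) ?aF //; apply/esym/negP=> ay.
    have yW : y \in W by move: yF; rewrite inE => /andP[].
    by move: aF; rewrite -{1}(amax y yW ay) yF.
  + rewrite (belowN F _ _ _ FW) ?(inCF x) //; apply/esym/negP=> xy.
    move: (yF) xC; rewrite !inE => /andP[yW nya] /andP[_ /tltW xa].
    have := tle_chain xy xa; rewrite (negPf nya) /= => ay.
    by rewrite (amax y yW ay) tle_refl in nya.
  + exact: Fb.
Qed.

Import GRing.Theory Order.TTheory Num.Theory.
Local Open Scope ring_scope.

(** * The exterior algebra on the half-edges *)

Section Inversions.
Variable G : graph.
Implicit Types (A B C : {set halfedge G}) (h k : halfedge G).

Lemma inversionsE A B :
  inversions A B = (\sum_(a in A) \sum_(b in B) (enum_rank b < enum_rank a))%N.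
Proof.
rewrite pair_big_dep /= /inversions -sum1_card [RHS]big_mkcond [LHS]big_mkcond /=.
by apply: eq_bigr => -[a b] _; rewrite inE /=; case: (a \in A); case: (b \in B); case: (_ < _)%N.
Qed.

Lemma inversionsUl A B C : [disjoint A & B] ->
  inversions (A :|: B) C = (inversions A C + inversions B C)%N.
Proof.
move=> dAB; rewrite !inversionsE (big_setID A) /= setUK; congr (_ + _)%N.
by rewrite setDUl setDv set0U (setDidPl _) // disjoint_sym.
Qed.

Lemma inversionsUr A B C : [disjoint B & C] ->
  inversions A (B :|: C) = (inversions A B + inversions A C)%N.
Proof.
move=> dBC; rewrite !inversionsE -big_split; apply: eq_bigr => a _ /=.
rewrite (big_setID B) /= setUK; congr (_ + _)%N.
by rewrite setDUl setDv set0U (setDidPl _) // disjoint_sym.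
Qed.

Lemma inversions0l A : inversions set0 A = 0%N.
Proof. by rewrite inversionsE big_set0. Qed.

Lemma inversions0r A : inversions A set0 = 0%N.
Proof. by rewrite inversionsE big1 // => a _; rewrite big_set0. Qed.

Lemma inversions11 h k : inversions [set h] [set k] = (enum_rank k < enum_rank h)%N.
Proof. by rewrite inversionsE !big_set1. Qed.

Lemma inversions_min h A : (forall k, k \in A -> (enum_rank h < enum_rank k)%N) ->
  inversions [set h] A = 0%N.
Proof.
move=> hA; rewrite inversionsE big_set1 big1 // => k /hA.
by rewrite ltnNge; case: ltnP => // /ltnW ->.
Qed.

End Inversions.

Section ExteriorBasis.
Variable G : graph.
Implicit Types (x y z : ext G) (A B C : {set halfedge G}) (h k : halfedge G).
Local Notation R := (edge_ring G).

Definition ebas A : ext G := [ffun B => (B == A)%:R].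

Lemma genE h : gen h = ebas [set h]. Proof. by []. Qed.
Lemma eoneE : eone G = ebas set0. Proof. by []. Qed.

Lemma ext_decomp x : x = \sum_A (x A : R) *: ebas A.
Proof.
apply/ffunP=> B; rewrite sum_ffunE (bigD1 B) //= big1 => [|A nAB].
  by rewrite addr0 !ffunE eqxx [RHS]mulr1.
by rewrite !ffunE eq_sym (negPf nAB) [LHS]mulr0.
Qed.

Lemma emulDl x y z : emul (x + y) z = emul x z + emul y z.
Proof.
apply/ffunP=> C; rewrite !ffunE -big_split; apply: eq_bigr => A _.
by rewrite ffunE mulrDr mulrDl.
Qed.

Lemma emulDr x y z : emul x (y + z) = emul x y + emul x z.
Proof.
apply/ffunP=> C; rewrite !ffunE -big_split; apply: eq_bigr => A _.
by rewrite ffunE mulrDr.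
Qed.

Lemma emulZl (a : R) x y : emul (a *: x) y = a *: emul x y.
Proof.
apply/ffunP=> C; rewrite !ffunE [RHS]mulr_sumr; apply: eq_bigr => A _.
by rewrite ffunE !mulrA; congr (_ * _ * _); rewrite mulrC.
Qed.

Lemma emulZr (a : R) x y : emul x (a *: y) = a *: emul x y.
Proof.
apply/ffunP=> C; rewrite !ffunE [RHS]mulr_sumr; apply: eq_bigr => A _.
by rewrite ffunE [_ * (a *: _)]mulrCA.
Qed.

Lemma emul0l x : emul 0 x = 0.
Proof. by have := emulZl 0 0 x; rewrite !scale0r. Qed.
Lemma emulNl x y : emul (- x) y = - emul x y.
Proof. by have := emulZl (- 1) x y; rewrite !scaleN1r. Qed.
Lemma emulBl x y z : emul (x - y) z = emul x z - emul y z.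
Proof. by rewrite emulDl emulNl. Qed.
Lemma emul_bas A B : emul (ebas A) (ebas B) =
  (if [disjoint A & B] then (-1) ^+ inversions A B else 0 : R) *: ebas (A :|: B).
Proof.
apply/ffunP=> C; rewrite !ffunE; have [->|nC] := eqVneq C (A :|: B); last first.
  rewrite [RHS]mulr0 big1 // => A' sA'; rewrite !ffunE.
  have [A'E|_] := eqVneq A' A; last by rewrite mulr0 mul0r.
  have [C'E|_] := eqVneq (C :\: A') B; last by rewrite mulr0.
  case/eqP: nC; rewrite -C'E -A'E; apply/setP=> k; rewrite !inE.
  by case: (boolP (k \in A')) => // /(subsetP sA').
rewrite (bigD1 A) ?subsetUl //= big1 ?addr0 => [|A' /andP[_ nA]]; last first.
  by rewrite !ffunE (negPf nA) mulr0 mul0r.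
rewrite !ffunE eqxx mulr1 setDUl setDv set0U [RHS]mulr1; case: ifPn => dAB.
  by rewrite (setDidPl _) ?eqxx ?mulr1 // disjoint_sym.
case: eqP => [E|_]; last by rewrite mulr0.
by case/negP: dAB; rewrite disjoint_sym; apply/setDidPl.
Qed.

Lemma ext_bas_ind (P : ext G -> Prop) :
  (forall x y, P x -> P y -> P (x + y)) -> (forall (a : R) x, P x -> P (a *: x)) ->
  (forall A, P (ebas A)) -> forall x, P x.
Proof.
move=> PD PZ Pb x; rewrite (ext_decomp x); elim/big_ind: _ => // [|A _]; last exact: PZ.
by rewrite -(scale0r (ebas set0)); apply: PZ.
Qed.

Lemma emulA x y z : emul x (emul y z) = emul (emul x y) z.
Proof.
elim/ext_bas_ind: x => [x x' IH IH'|a x IH|A]; first by rewrite !emulDl IH IH'.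
  by rewrite !emulZl IH.
elim/ext_bas_ind: y => [y y' IH IH'|a y IH|B]; first by rewrite !(emulDl, emulDr) IH IH'.
  by rewrite !(emulZl, emulZr) IH.
elim/ext_bas_ind: z => [z z' IH IH'|a z IH|C]; first by rewrite !emulDr IH IH'.
  by rewrite !emulZr IH.
rewrite !emul_bas emulZl emulZr !emul_bas !scalerA setUA; congr (_ *: _).
have disjUl (X Y Z : {set halfedge G}) : [disjoint X :|: Y & Z] =
  [disjoint X & Z] && [disjoint Y & Z].
  by rewrite -!setI_eq0 setIUl setU_eq0.
have disjUr (X Y Z : {set halfedge G}) : [disjoint X & Y :|: Z] =
  [disjoint X & Y] && [disjoint X & Z].
  by rewrite -!setI_eq0 setIUr setU_eq0.
rewrite disjUl disjUr.
case dAB: [disjoint A & B]; case dBC: [disjoint B & C]; rewrite ?(mulr0, mul0r) //=; last first.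
  by rewrite andbF mulr0.
case dAC: [disjoint A & C]; rewrite ?(mulr0, mul0r) //=.
by rewrite inversionsUl // inversionsUr // -!exprD; congr (_ ^+ _); rewrite [RHS]addnA addnC.
Qed.

Lemma emul1l x : emul (eone G) x = x.
Proof.
elim/ext_bas_ind: x => [x y IHx IHy|a x IH|A]; first by rewrite emulDr IHx IHy.
  by rewrite emulZr IH.
by rewrite eoneE emul_bas disjoints_subset sub0set inversions0l scale1r set0U.
Qed.

Lemma emul1r x : emul x (eone G) = x.
Proof.
elim/ext_bas_ind: x => [x y IHx IHy|a x IH|A]; first by rewrite emulDl IHx IHy.
  by rewrite emulZl IH.
by rewrite eoneE emul_bas disjoint_sym disjoints_subset sub0set inversions0r scale1r setU0.
Qed.

Lemma gen_anti h k : emul (gen h) (gen k) = - emul (gen k) (gen h).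
Proof.
rewrite !genE !emul_bas [in RHS]setUC [in RHS]disjoint_sym -scaleNr; congr (_ *: _).
case: ifPn => [|_]; last by rewrite oppr0.
rewrite disjoints_subset sub1set !inE => nhk; rewrite !inversions11.
move: nhk; case: (ltngtP (enum_rank k) (enum_rank h)) => [_ _|_ _|/ord_inj/enum_rank_inj->].
- by rewrite expr1 expr0.
- by rewrite expr1 expr0 opprK.
- by rewrite eqxx.
Qed.

Lemma gen_sq h : emul (gen h) (gen h) = 0.
Proof. by rewrite !genE emul_bas disjoints_subset sub1set !inE eqxx scale0r. Qed.

Lemma gen_bas h A : (forall k, k \in A -> (enum_rank h < enum_rank k)%N) ->
  emul (gen h) (ebas A) = ebas (h |: A).
Proof.
move=> hA; rewrite genE emul_bas inversions_min // disjoints_subset sub1set inE.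
by case: ifPn => [_|/negPn/hA]; rewrite ?scale1r // ltnn.
Qed.

(** Each new element precedes the present ones, so by [gen_bas] every step of the induction is a
    product without sign. *)
Lemma minset_ind (P : {set halfedge G} -> Prop) : P set0 ->
  (forall h A, (forall k, k \in A -> (enum_rank h < enum_rank k)%N) -> P A -> P (h |: A)) ->
  forall A, P A.
Proof.
move=> P0 PS A; have [n] := ubnP #|A|; elim: n A => // n IH A; rewrite ltnS => An.
have [->//|[k0 k0A]] := set_0Vmem A.
case: (arg_minnP (fun k => enum_rank k : nat) k0A) => h; rewrite -[_ h]/(h \in A) => hA hmin.
rewrite -(setD1K hA); apply: PS => [k|].
  rewrite !inE => /andP[nkh kA]; rewrite ltn_neqAle hmin // andbT.
  by apply: contra nkh => /eqP/ord_inj/enum_rank_inj->.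
by apply: IH; apply: leq_trans An; rewrite [X in (_ < X)%N](cardsD1 h A) hA.
Qed.

Lemma ext_ind (P : ext G -> Prop) :
  (forall x y, P x -> P y -> P (x + y)) -> (forall (a : R) x, P x -> P (a *: x)) ->
  P (eone G) -> (forall h x, P x -> P (emul (gen h) x)) -> forall x, P x.
Proof.
move=> PD PZ P1 Pg; apply: ext_bas_ind => // A; elim/minset_ind: A => [//|h A hA PA].
by rewrite -gen_bas //; apply: Pg.
Qed.

Lemma genM_coef h x C :
  emul (gen h) x C = if h \in C then (-1) ^+ inversions [set h] (C :\ h) * x (C :\ h) else 0.
Proof.
rewrite ffunE; case: ifPn => hC; last first.
  rewrite big1 // => A AC; rewrite ffunE; case: eqP => [Ah|_]; last by rewrite mulr0 mul0r.
  by move: AC; rewrite Ah sub1set (negPf hC).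
rewrite (bigD1 [set h]) ?sub1set //= ffunE eqxx mulr1 big1 ?addr0 // => A /andP[_ nA].
by rewrite ffunE (negPf nA) mulr0 mul0r.
Qed.

Lemma differentialD x y : differential (x + y) = differential x + differential y.
Proof.
apply/ffunP=> A; rewrite !ffunE -big_split; apply: eq_bigr => h _.
by rewrite ffunE mulrDr.
Qed.

Lemma differentialZ (a : R) x : differential (a *: x) = a *: differential x.
Proof.
apply/ffunP=> A; rewrite !ffunE [RHS]mulr_sumr; apply: eq_bigr => h _.
by rewrite ffunE [LHS]mulrCA.
Qed.

Lemma differential1 : differential (eone G) = 0.
Proof.
apply/ffunP=> A; rewrite !ffunE big1 // => h _; rewrite ffunE.
by case: eqP => [/setP/(_ h)|_]; rewrite ?mulr0 // !inE eqxx.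
Qed.

Lemma extBE x y A : (x - y) A = x A - y A. Proof. by rewrite !ffunE. Qed.
Lemma extDE x y A : (x + y) A = x A + y A. Proof. by rewrite !ffunE. Qed.
Lemma extZE (a : R) x A : (a *: x) A = a * (x A : R). Proof. by rewrite ffunE. Qed.
Lemma differentialE x A : differential x A = \sum_(h | h \notin A)
     (-1) ^+ inversions [set h] A * evar (hedge h) * (x (h |: A) : R).
Proof. by rewrite ffunE. Qed.

(** The graded Leibniz rule. A term removing some [k] other than [h] changes sign because exactly
    one of the pairs [(h, k)] and [(k, h)] is an inversion. *)
Lemma differential_gen h x :
  differential (emul (gen h) x) = evar (hedge h) *: x - emul (gen h) (differential x).
Proof.
have sqr1 n : (-1) ^+ n * (-1) ^+ n = 1 :> R by rewrite -expr2 sqrr_sign.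
apply/ffunP=> A; rewrite extBE extZE genM_coef [LHS]differentialE.
case: ifPn => hA; last first.
  rewrite subr0 (bigD1 h) //= big1 => [|k /andP[kA nkh]]; last first.
    by rewrite genM_coef !inE eq_sym (negPf nkh) (negPf hA) mulr0.
  by rewrite genM_coef setU11 addr0 setU1K // mulrACA sqr1 mul1r.
rewrite differentialE mulr_sumr [in RHS](bigD1 h) ?setD11 //= setD1K //.
rewrite !mulrA sqr1 mul1r opprD addNKr -sumrN.
have nE k : (k \notin A) = (k \notin A :\ h) && (k != h).
  by rewrite !inE; case: (eqVneq k h) => [->|]; rewrite ?hA //= andbT.
apply: eq_big => // k kA; have nkh : k != h by apply: contraNneq kA => ->.
have hkA : (k |: A) :\ h = k |: (A :\ h) by rewrite setDUl; congr (_ :|: _); apply/setDidPl;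
  rewrite disjoints_subset sub1set !inE.
rewrite genM_coef !inE hA orbT hkA.
have -> : inversions [set k] A = (inversions [set k] (A :\ h) + inversions [set k] [set h])%N.
  by rewrite -inversionsUr ?(setUC _ [set h]) ?setD1K // disjoint_sym disjoints_subset sub1set
    !inE eqxx.
have -> : inversions [set h] (k |: A :\ h) =
  (inversions [set h] [set k] + inversions [set h] (A :\ h))%N.
  by rewrite inversionsUr // disjoints_subset sub1set !inE negb_and kA orbT.
have sgn : (-1) ^+ inversions [set k] [set h] * (-1) ^+ inversions [set h] [set k] = -1 :> R.
  rewrite !inversions11; case: (ltngtP (enum_rank k) (enum_rank h)) =>
    [_|_|/ord_inj/enum_rank_inj E].
  - by rewrite expr1 expr0 mul1r.
  - by rewrite expr1 expr0 mulr1.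
  - by rewrite E eqxx in nkh.
have E (K : comNzRingType) (a b c d e u : K) : b * c = -1 ->
    a * b * e * (c * d * u) = - (d * (a * e * u)).
  by move=> bc; rewrite -[RHS]mulN1r -bc; ring.
by rewrite !exprD; apply: E.
Qed.

End ExteriorBasis.

(** * Maps of edge rings and abstract exterior algebras *)

Definition edge_map (G G' : graph) (r : edge G -> edge G') : edge_ring G -> edge_ring G' :=
  mmap (intr : int -> edge_ring G') (fun j => evar (r (enum_val j))).

Section EdgeMap.
Variables (G G' : graph) (r : edge G -> edge G').

HB.instance Definition _ := GRing.RMorphism.copy (edge_map r)
  (mmap (intr : int -> edge_ring G') (fun j => evar (r (enum_val j)))).

Lemma edge_map_evar e : edge_map r (evar e) = evar (r e).
Proof. by rewrite /edge_map /evar mmapX mmap1U enum_rankK. Qed.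

Lemma edge_map1 : edge_map r 1 = 1.
Proof. exact: (rmorph1 (edge_map r)). Qed.
Lemma edge_mapB a b : edge_map r (a - b) = edge_map r a - edge_map r b.
Proof. exact: (rmorphB (edge_map r)). Qed.
Lemma edge_mapM a b : edge_map r (a * b) = edge_map r a * edge_map r b.
Proof. exact: (rmorphM (edge_map r)). Qed.

End EdgeMap.

(** The coefficients are integers, so closure under differences already accounts for all scalars. *)
Lemma edge_ring_ind (G : graph) (P : edge_ring G -> Prop) :
  P 1 -> (forall a b, P a -> P b -> P (a - b)) -> (forall e a, P a -> P (evar e * a)) ->
  forall a, P a.
Proof.
move=> P1 PB Pe.
have P0 : P 0 by rewrite -(subrr 1); apply: PB.
have PN a : P a -> P (- a) by rewrite -sub0r; apply: PB.
have PD a b : P a -> P b -> P (a + b) by move=> Pa Pb; rewrite -[b]opprK; apply: PB => //;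
  apply: PN.
have PX m a : P a -> P ('X_[m] * a).
  rewrite mpolyXE_id; move: a; elim/big_ind: _ => [a|u v IHu IHv a Pa|i _ a Pa].
  - by rewrite mul1r.
  - by rewrite -mulrA; apply/IHu/IHv.
  - elim: (m i) => [|k IH]; first by rewrite expr0 mul1r.
    by rewrite exprS -mulrA -[i]enum_valK; apply: Pe; rewrite enum_valK.
have PMn a n : P a -> P (a *+ n).
  by move=> Pa; elim: n => [|n IH]; rewrite ?mulr0n // mulrS; apply: PD.
move=> a; rewrite [a]mpolyE; elim/big_ind: _ => // m _.
rewrite -[X in X *: _]intz scaler_int -[in X in X *~ _](mulr1 'X_[m]).
case: (a@_m) => n; first exact/PMn/PX.
by rewrite NegzE mulrNz; apply/PN/PMn/PX.
Qed.

(* Working over an abstract exterior algebra keeps conversion from unfolding polynomials. *)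
Record exterior (R : comNzRingType) (H : finType) := Exterior {
  ecar :> lmodType R;
  xmul : ecar -> ecar -> ecar;
  xone : ecar;
  xgen : H -> ecar;
  xmulDl : forall x y z, xmul (x + y) z = xmul x z + xmul y z;
  xmulDr : forall x y z, xmul x (y + z) = xmul x y + xmul x z;
  xmulZl : forall (a : R) x y, xmul (a *: x) y = a *: xmul x y;
  xmulZr : forall (a : R) x y, xmul x (a *: y) = a *: xmul x y;
  xmulA : forall x y z, xmul x (xmul y z) = xmul (xmul x y) z;
  xmul1l : forall x, xmul xone x = x;
  xmul1r : forall x, xmul x xone = x;
  xgen_anti : forall h k, xmul (xgen h) (xgen k) = - xmul (xgen k) (xgen h);
  xgen_sq : forall h, xmul (xgen h) (xgen h) = 0;
  xext_ind : forall P : ecar -> Prop,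
    (forall x y, P x -> P y -> P (x + y)) -> (forall (a : R) x, P x -> P (a *: x)) ->
    P xone -> (forall h x, P x -> P (xmul (xgen h) x)) -> forall x, P x
}.
Arguments xmul {R H e}.
Arguments xone {R H e}.
Arguments xgen {R H e}.

Definition graph_ext (G : graph) : exterior (edge_ring G) (halfedge G) :=
  @Exterior (edge_ring G) (halfedge G) (ext G) (@emul G) (eone G) (@gen G)
    (@emulDl G) (@emulDr G) (@emulZl G) (@emulZr G) (@emulA G) (@emul1l G) (@emul1r G)
    (@gen_anti G) (@gen_sq G) (@ext_ind G).

Section Degree1.
Variables (R : comNzRingType) (H : finType) (E : exterior R H).
Implicit Types (x y u v : E) (h k : H).

Lemma xmul0l x : xmul 0 x = 0.
Proof. by have := xmulZl 0 0 x; rewrite !scale0r. Qed.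
Lemma xmul0r x : xmul x 0 = 0.
Proof. by have := xmulZr 0 x 0; rewrite !scale0r. Qed.
Lemma xmulNl x y : xmul (- x) y = - xmul x y.
Proof. by have := xmulZl (- 1) x y; rewrite !scaleN1r. Qed.
Lemma xmulBl x y z : xmul (x - y) z = xmul x z - xmul y z.
Proof. by rewrite xmulDl xmulNl. Qed.
Lemma xmul_suml (I : Type) (r : seq I) (P : pred I) (F : I -> E) x :
  xmul (\sum_(i <- r | P i) F i) x = \sum_(i <- r | P i) xmul (F i) x.
Proof. by apply: (big_morph (fun y => xmul y x)) => [y z|]; rewrite ?xmulDl ?xmul0l. Qed.
Lemma xmul_sumr (I : Type) (r : seq I) (P : pred I) (F : I -> E) x :
  xmul x (\sum_(i <- r | P i) F i) = \sum_(i <- r | P i) xmul x (F i).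
Proof. by apply: (big_morph (xmul x)) => [y z|]; rewrite ?xmulDr ?xmul0r. Qed.

Definition deg1 u := exists c : H -> R, u = \sum_k c k *: (xgen k : E).

Lemma deg1_anti u v : deg1 u -> deg1 v -> xmul u v = - xmul v u.
Proof.
case=> c -> [d ->]; rewrite xmul_suml xmul_sumr -sumrN; apply: eq_bigr => k _.
rewrite xmul_sumr xmul_suml -sumrN; apply: eq_bigr => l _.
by rewrite !(xmulZl, xmulZr) xgen_anti !scalerN !scalerA mulrC.
Qed.

(** Anticommutation would only show that twice the square vanishes, and 2 may be a zero divisor in
    [R]. Instead the cross terms cancel in pairs and the squares of generators are 0. *)
Lemma deg1_sq u : deg1 u -> xmul u u = 0.
Proof.
case=> c ->; elim: (index_enum _) => [|k s IH]; first by rewrite big_nil xmul0l.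
rewrite big_cons xmulDl !xmulDr IH addr0 !xmulZl !xmulZr xgen_sq !scaler0 add0r.
rewrite -scalerDr xmul_suml xmul_sumr -big_split big1 ?scaler0 // => l _ /=.
by rewrite xmulZl xmulZr xgen_anti scalerN addNr.
Qed.

Lemma deg1D u v : deg1 u -> deg1 v -> deg1 (u + v).
Proof.
case=> c -> [d ->]; exists (fun k => c k + d k); rewrite -big_split.
by apply: eq_bigr => k _; rewrite scalerDl.
Qed.

Lemma deg1Z a u : deg1 u -> deg1 (a *: u).
Proof.
case=> c ->; exists (fun k => a * c k); rewrite scaler_sumr.
by apply: eq_bigr => k _; rewrite scalerA.
Qed.

Lemma deg1N u : deg1 u -> deg1 (- u).
Proof. by rewrite -scaleN1r; apply: deg1Z. Qed.

Lemma deg1_0 : deg1 0.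
Proof. by exists (fun=> 0); rewrite big1 // => k _; rewrite scale0r. Qed.

Lemma deg1_sum (I : Type) (r : seq I) (P : pred I) (F : I -> E) :
  (forall i, P i -> deg1 (F i)) -> deg1 (\sum_(i <- r | P i) F i).
Proof. by move=> F1; elim/big_ind: _ => //; [apply: deg1_0 | apply: deg1D]. Qed.

Lemma deg1_gen h : deg1 (xgen h).
Proof.
exists (fun k => (k == h)%:R); rewrite (bigD1 h) //= eqxx scale1r big1 ?addr0 // => k /negPf->.
by rewrite scale0r.
Qed.

End Degree1.

Section ExtMap.
Variables (G G' : graph) (r : edge G -> edge G') (F : halfedge G -> ext G').
Hypothesis F1 : forall h, deg1 (F h : graph_ext G').
Implicit Types (x y : ext G) (A : {set halfedge G}) (h : halfedge G).
Local Notation phi := (ext_map r F).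
Local Notation R := (edge_ring G).

Lemma ext_mapE x : phi x =
  \sum_A edge_map r (x A) *: \big[@emul G'/@eone G']_(h <- enum A) F h.
Proof. by []. Qed.

Lemma ext_mapD x y : phi (x + y) = phi x + phi y.
Proof.
rewrite /ext_map -big_split; apply: eq_bigr => A _ /=.
by rewrite extDE -/(edge_map r) rmorphD scalerDl.
Qed.

Lemma ext_mapZ (a : R) x : phi (a *: x) = edge_map r a *: phi x.
Proof.
rewrite /ext_map [RHS]scaler_sumr; apply: eq_bigr => A _.
rewrite [RHS]scalerA; congr (_ *: _); rewrite extZE; exact: (rmorphM (edge_map r)).
Qed.

Lemma ext_mapN x : phi (- x) = - phi x.
Proof. by rewrite -scaleN1r ext_mapZ rmorphN1 scaleN1r. Qed.
Lemma ext_map0 : phi 0 = 0.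
Proof. by rewrite -(scale0r (0 : ext G)) ext_mapZ rmorph0 scale0r. Qed.
Lemma ext_map_bas A : phi (ebas A) = \big[@emul G'/@eone G']_(h <- enum A) F h.
Proof.
rewrite ext_mapE (bigD1 A) //= ffunE eqxx rmorph1 scale1r big1 ?addr0 // => B /negPf nBA.
by rewrite ffunE nBA rmorph0 scale0r.
Qed.

Lemma ext_map1 : phi (eone G) = eone G'.
Proof. by rewrite eoneE ext_map_bas enum_set0 big_nil. Qed.

Lemma enum_min h A : (forall k, k \in A -> (enum_rank h < enum_rank k)%N) ->
  enum (h |: A) = h :: enum A.
Proof.
move=> hA; pose lt := [rel a b : halfedge G | (enum_rank a < enum_rank b)%N].
have ltT : transitive lt by move=> b a c; apply: ltn_trans.
have srt (B : {set halfedge G}) : sorted lt (enum B).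
  rewrite /enum_mem -enumT /=; apply: (sorted_filter ltT).
  apply/(sortedP h) => m; rewrite -cardE => ltm /=.
  have nthE l (ltl : (l < #|{: halfedge G}|)%N) :
    enum_rank (nth h (enum {: halfedge G}) l) = l :> nat.
    by rewrite -[l]/(val (Ordinal ltl)) -(enum_val_nth h (Ordinal ltl)) enum_valK.
  by rewrite !nthE // ltnW.
have hnA : h \notin A by apply/negP=> /hA; rewrite ltnn.
apply: (irr_sorted_eq ltT) => [a|//||a]; first exact: ltnn.
  rewrite /= path_min_sorted ?srt //; apply/allP=> k; rewrite mem_enum; exact: hA.
by rewrite !(inE, mem_enum).
Qed.

Lemma ext_map_min h A : (forall k, k \in A -> (enum_rank h < enum_rank k)%N) ->
  phi (ebas (h |: A)) = emul (F h) (phi (ebas A)).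
Proof. by move=> hA; rewrite 2!ext_map_bas enum_min // big_cons. Qed.

(** By definition the map is multiplicative on increasing products only. Reordering produces signs
    and squares, and elements of degree 1 have the same signs and vanishing squares as the
    generators they replace. *)
Lemma ext_map_gen h x : phi (emul (gen h) x) = emul (F h) (phi x).
Proof.
elim/ext_bas_ind: x => [x y IHx IHy|a x IH|A].
- by rewrite emulDr [LHS]ext_mapD [in RHS]ext_mapD [RHS]emulDr IHx IHy.
- by rewrite emulZr [LHS]ext_mapZ [in RHS]ext_mapZ [RHS]emulZr IH.
elim/minset_ind: A h => [|b A bA IH] h.
  by rewrite gen_bas ?ext_map_min // => k; rewrite inE.
case: (ltngtP (enum_rank h) (enum_rank b)) => [hb|bh|/ord_inj/enum_rank_inj ->].
- have hbA k : k \in b |: A -> (enum_rank h < enum_rank k)%N.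
    by rewrite !inE => /orP[/eqP->//|/bA]; apply: ltn_trans.
  by rewrite (gen_bas hbA) (ext_map_min hbA).
(* Here [h] has to pass the least element [b]; anticommutation exchanges them in the source and in
   the target. *)
- have bhA k : k \in h |: A -> (enum_rank b < enum_rank k)%N.
    by rewrite !inE => /orP[/eqP->//|/bA].
  have sE : phi (emul (gen b) (emul (gen h) (ebas A))) = emul (F b) (phi (emul (gen h) (ebas A))).
    have [c ->] : exists c : R, emul (gen h) (ebas A) = c *: ebas (h |: A).
      by rewrite genE emul_bas; eexists.
    have -> : emul (gen b) (c *: ebas (h |: A)) = c *: ebas (b |: (h |: A)).
      by rewrite emulZr gen_bas.
    apply: etrans (ext_mapZ _ _) _; apply: etrans (congr1 _ (ext_map_min bhA)) _.
    apply: esym; apply: etrans (congr1 (emul (F b)) (ext_mapZ _ _)) _; exact: emulZr.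
  have -> : emul (gen h) (ebas (b |: A)) = - emul (gen b) (emul (gen h) (ebas A)).
    by rewrite -(gen_bas bA) emulA gen_anti emulNl emulA.
  apply: etrans (ext_mapN _) _; apply: etrans (congr1 _ sE) _.
  apply: etrans (congr1 (fun u => - emul (F b) u) (IH h)) _.
  apply: etrans (congr1 _ (emulA _ _ _)) _.
  have -> : emul (F b) (F h) = - emul (F h) (F b).
    exact: (@deg1_anti _ _ (graph_ext G') (F b) (F h)).
  rewrite (ext_map_min bA); apply: etrans (congr1 _ (emulNl _ _)) _.
  by apply: etrans (opprK _) _; apply/esym/emulA.
have -> : emul (gen b) (ebas (b |: A)) = 0 by rewrite -(gen_bas bA) emulA gen_sq emul0l.
rewrite (ext_map_min bA) ext_map0; apply/esym; apply: etrans (emulA _ _ _) _.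
have -> : emul (F b) (F b) = 0 by exact: (@deg1_sq _ _ (graph_ext G') (F b)).
by rewrite emul0l.
Qed.

End ExtMap.

(** * Reduced chains and maps of exterior algebras *)

Section Reduced.
Variables (R : comNzRingType) (H : finType) (E : exterior R H) (V : finType) (hv : H -> V).
Implicit Types (x y u : E) (h k : H) (v : V) (s : {set V}).

Definition xred_at v x : Prop :=
  exists (a : R) (b : H * H -> R),
    x = a *: xone +
        \sum_(p | (hv p.1 == v) && (hv p.2 == v)) b p *: (xgen p.1 - xgen p.2 : E).

(** Reducedness with a support. A product of two differences at the same vertex is not reduced in
    general, so a new factor may be multiplied in only at a vertex outside [s]. *)
Definition xred_on s x : Prop :=
  exists (J : finType) (a : J -> R) (y : J -> V -> E),
    [/\ forall j v, xred_at v (y j v), forall j v, v \notin s -> y j v = xone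
      & x = \sum_j a j *: \big[xmul/xone]_v y j v].

Definition xred x : Prop :=
  exists (J : finType) (a : J -> R) (y : J -> V -> E),
    (forall j v, xred_at v (y j v)) /\ x = \sum_j a j *: \big[xmul/xone]_v y j v.

Lemma xred_at1 v : xred_at v xone.
Proof.
exists 1, (fun=> 0); rewrite scale1r big1 ?addr0 // => p _; exact: scale0r.
Qed.

Lemma xred_at_diff h k : hv h = hv k -> xred_at (hv h) (xgen h - xgen k).
Proof.
move=> hk; exists 0, (fun p => (p == (h, k))%:R); rewrite scale0r add0r.
rewrite (bigD1 (h, k)) /= -?hk ?eqxx // scale1r big1 ?addr0 // => p /andP[_ /negPf->].
by rewrite scale0r.
Qed.

(** The induction forgets that the vertices of the factors are distinct. It suits predicates that
    are stable under multiplication by any difference, such as compatibility with a map. *)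
Lemma xred_prod_ind (P : E -> Prop) (y : V -> E) (vs : seq V) :
  (forall x y, P x -> P y -> P (x + y)) -> (forall (a : R) x, P x -> P (a *: x)) ->
  P xone ->
  (forall h k x, hv h = hv k -> P x -> P (xmul (xgen h - xgen k) x)) ->
  (forall v, xred_at v (y v)) -> P (\big[xmul/xone]_(v <- vs) y v).
Proof.
move=> PD PZ P1 Pd yP; elim: vs => [|v vs IH]; first by rewrite big_nil.
rewrite big_cons; have [a [b ->]] := yP v.
rewrite xmulDl xmulZl xmul1l xmul_suml; apply: (PD); first exact: (PZ).
apply: (big_ind P) => [||p /andP[/eqP h1 /eqP h2]]; [|exact: PD|].
  by rewrite -(scale0r xone); apply: (PZ).
by rewrite xmulZl; apply/PZ/Pd => //; rewrite h1.
Qed.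

Lemma xred_ind (P : E -> Prop) :
  (forall x y, P x -> P y -> P (x + y)) -> (forall (a : R) x, P x -> P (a *: x)) ->
  P xone ->
  (forall h k x, hv h = hv k -> P x -> P (xmul (xgen h - xgen k) x)) ->
  forall x, xred x -> P x.
Proof.
move=> PD PZ P1 Pd x [J [a [y [yP ->]]]]; apply: (big_ind P) => [||j _]; [|exact: PD|].
  by rewrite -(scale0r xone); apply: (PZ).
by apply: (PZ); apply: xred_prod_ind.
Qed.

Lemma xred_onW s x : xred_on s x -> xred x.
Proof. by case=> J [a [y [yP _ xE]]]; exists J, a, y. Qed.

Lemma xred_onS s s' x : s \subset s' -> xred_on s x -> xred_on s' x.
Proof.
move=> ss [J [a [y [yP y1 xE]]]]; exists J, a, y; split=> // j v vs.
by apply: y1; apply: contra vs; apply: (subsetP ss).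
Qed.

Lemma xred_on1 s : xred_on s xone.
Proof.
exists 'I_1, (fun=> 1), (fun _ _ => xone); split=> // [_ v|]; first exact: xred_at1.
rewrite big_ord1 scale1r; elim: (index_enum V) => [|v vs IH]; first by rewrite big_nil.
by rewrite big_cons -IH xmul1l.
Qed.

Lemma xred_onD s x y : xred_on s x -> xred_on s y -> xred_on s (x + y).
Proof.
case=> J [a [u [uP u1 ->]]] [K [b [w [wP w1 ->]]]].
exists (J + K)%type, (fun c => match c with inl j => a j | inr k => b k end),
  (fun c => match c with inl j => u j | inr k => w k end).
by split=> [[]|[] ? ?|]; rewrite ?big_sumType //; [apply: u1 | apply: w1].
Qed.

Lemma xred_onZ s (c : R) x : xred_on s x -> xred_on s (c *: x).
Proof.
case=> J [a [u [uP u1 ->]]]; exists J, (fun j => c * a j), u; split=> //.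
by rewrite scaler_sumr; apply: eq_bigr => j _; rewrite scalerA.
Qed.

Lemma xred_on0 s : xred_on s 0.
Proof. by rewrite -(scale0r xone); apply/xred_onZ/xred_on1. Qed.

(* An odd element moves past a reduced factor at the cost of the sign of its odd part. *)
Lemma xred_at_flip v x u : xred_at v x -> deg1 u ->
  exists2 x', xred_at v x' & xmul u x = xmul x' u.
Proof.
case=> a [b ->] u1; set o := \sum_(p | _) _.
have o1 : deg1 o.
  apply: deg1_sum => p _; apply/deg1Z/deg1D; first exact: deg1_gen.
  exact/deg1N/deg1_gen.
exists (a *: xone - o); last first.
  by rewrite xmulDr xmulBl xmulZr xmulZl xmul1l xmul1r (deg1_anti u1 o1).
exists a, (fun p => - b p); congr (_ + _); rewrite -sumrN.
by apply: eq_bigr => p _; rewrite scaleNr.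
Qed.

(** The factor [u] is moved through the product to the place of its own vertex, flipping each factor
    it passes. Factors equal to one stay so, hence the support grows by [v] only. *)
Lemma xred_prod_insert u v (vs : seq V) (y : V -> E) :
  deg1 u -> xred_at v u -> uniq vs -> v \in vs -> y v = xone -> (forall w, xred_at w (y w)) ->
  exists y' : V -> E, [/\ forall w, xred_at w (y' w), forall w, w != v -> y w = xone -> y' w = xone
    & xmul u (\big[xmul/xone]_(w <- vs) y w) = \big[xmul/xone]_(w <- vs) y' w].
Proof.
move=> u1 uv + + yv yP; elim: vs => //= w vs IH /andP[wvs vsu].
rewrite inE; case: (eqVneq v w) wvs => [<-|nvw] wvs /= vvs.
  exists (fun z => if z == v then u else y z); split=> [z|z /negPf->//|].
    by case: eqP => [->|].
  rewrite !big_cons eqxx yv xmul1l; congr (xmul _ _); apply: eq_big_seq => z zvs.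
  by case: (eqVneq z v) => // zv; rewrite -zv zvs in wvs.
have [y' [y'P y'1 y'E]] := IH vsu vvs.
have [x' x'P x'E] := xred_at_flip (yP w) u1.
exists (fun z => if z == w then (if y w == xone then xone else x') else y' z); split.
- move=> z; case: eqP => [->|//]; case: ifP => // _; exact: xred_at1.
- by move=> z nzv yz; case: eqP => [<-|_]; [rewrite yz eqxx | apply: y'1].
rewrite !big_cons eqxx.
have -> : \big[xmul/xone]_(z <- vs) (if z == w then if y w == xone then xone else x' else y' z)
    = \big[xmul/xone]_(z <- vs) y' z.
  apply: eq_big_seq => z zvs.
  by case: (eqVneq z w) => // zw; rewrite -zw zvs in wvs.
rewrite -y'E !xmulA; case: eqP => [->|_]; last by rewrite x'E.
by rewrite xmul1l xmul1r.
Qed.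

Lemma xred_on_diff s h k x : hv h = hv k -> hv h \notin s -> xred_on s x ->
  xred_on (hv h |: s) (xmul (xgen h - xgen k) x).
Proof.
move=> hk hs [J [a [y [yP y1 ->]]]].
have u1 : deg1 (xgen h - xgen k : E) by apply/deg1D/deg1N/deg1_gen/deg1_gen.
have /choice[y' y'P] j : exists y' : V -> E, [/\ forall w, xred_at w (y' w),
    forall w, w \notin hv h |: s -> y' w = xone
    & xmul (xgen h - xgen k) (\big[xmul/xone]_v y j v) = \big[xmul/xone]_v y' v].
  have [|y' [yP' y1' yE']] := xred_prod_insert u1 (xred_at_diff hk) (index_enum_uniq V)
      (mem_index_enum _) _ (yP j).
    exact: y1.
  exists y'; split=> // w; rewrite !inE negb_or => /andP[nw ws].
  by apply: y1' nw _; apply: y1.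
exists J, a, y'; split=> [j v|j v|]; [by case: (y'P j) | by case: (y'P j) => _ + _; apply |].
by rewrite xmul_sumr; apply: eq_bigr => j _; rewrite xmulZr; case: (y'P j) => _ _ ->.
Qed.

End Reduced.

(** * Integral matrices on half-edges and the algebra maps they define *)

Section Balanced.
Variables (R : comNzRingType) (H : finType) (E : exterior R H) (V : finType) (hv : H -> V).

Definition xlin (c : H -> int) : E := \sum_k (c k)%:~R *: xgen k.

Lemma xlin_deg1 c : deg1 (xlin c).
Proof. by exists (fun k => (c k)%:~R). Qed.

Lemma xlinB c d : xlin (fun k => c k - d k) = xlin c - xlin d.
Proof. by rewrite -sumrB; apply: eq_bigr => k _; rewrite rmorphB scalerBl. Qed.

Lemma eq_xlin c d : c =1 d -> xlin c = xlin d.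
Proof. by move=> cd; apply: eq_bigr => k _; rewrite cd. Qed.

Lemma xlin1 h : xlin (fun k => (k == h)%:R) = xgen h.
Proof.
rewrite /xlin (bigD1 h) //= eqxx scale1r big1 ?addr0 // => k /negPf->.
by rewrite scale0r.
Qed.

(** Subtract one fixed half-edge at each vertex: its total coefficient is the sum of [c] over that
    vertex, which is 0. *)
Lemma balancedE (c : H -> int) : (forall v, \sum_(k | hv k == v) c k = 0) ->
  exists b : H -> H, (forall k, hv (b k) = hv k) /\
    xlin c = \sum_k (c k)%:~R *: (xgen k - xgen (b k) : E).
Proof.
move=> c0; pose b k := odflt k [pick m | hv m == hv k].
have bP k : hv (b k) = hv k by rewrite /b; case: pickP => [m /eqP|].
have beq k l : hv k = hv l -> b k = b l.
  rewrite /b => kl; rewrite (eq_pick (Q := fun m => hv m == hv l)); last by move=> m /=; rewrite kl.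
  by case: pickP => // /(_ k); rewrite kl eqxx.
exists b; split=> //; under [RHS]eq_bigr do rewrite scalerBr.
rewrite sumrB [X in _ - X](partition_big hv xpredT) //= [X in _ - X]big1 ?subr0 // => v _.
have [/existsP[k0 /eqP k0v]|no] := boolP [exists k, hv k == v]; last first.
  by rewrite big_pred0 // => k; apply: contraNF no => kv; apply/existsP; exists k.
rewrite (eq_bigr (fun k => (c k)%:~R *: xgen (b k0))); last first.
  by move=> k /eqP kv; rewrite (@beq k k0) // kv k0v.
by rewrite -scaler_suml -rmorph_sum /= c0 rmorph0 scale0r.
Qed.

End Balanced.

Section AlgebraMap.
Variables (R R' : comNzRingType) (H H' : finType) (E : exterior R H) (E' : exterior R' H').

(** An algebra map semilinear over [rm]. Since ring maps fix the integers, integral matrices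
    multiply under composition with no regard to the edge rings. *)
Record algmap (rm : R -> R') (M : H -> H' -> int) (phi : E -> E') : Prop := AlgMap {
  algmapD : forall x y, phi (x + y) = phi x + phi y;
  algmapZ : forall a x, phi (a *: x) = rm a *: phi x;
  algmap1 : phi xone = xone;
  algmap_gen : forall h x, phi (xmul (xgen h) x) = xmul (xlin E' (M h)) (phi x)
}.

Variables (rm : {rmorphism R -> R'}) (M : H -> H' -> int) (phi : E -> E').
Hypothesis phiP : algmap rm M phi.
Implicit Types (x y : E) (h k : H).

Lemma algmapN x : phi (- x) = - phi x.
Proof. by rewrite -scaleN1r (algmapZ phiP) rmorphN1 scaleN1r. Qed.
Lemma algmap0 : phi 0 = 0.
Proof. by rewrite -(scale0r (0 : E)) (algmapZ phiP) rmorph0 scale0r. Qed.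
Lemma algmapB x y : phi (x - y) = phi x - phi y.
Proof. by rewrite (algmapD phiP) algmapN. Qed.
Lemma algmap_sum (I : Type) (r : seq I) (P : pred I) (F : I -> E) :
  phi (\sum_(i <- r | P i) F i) = \sum_(i <- r | P i) phi (F i).
Proof. exact: (big_morph phi (algmapD phiP) algmap0). Qed.

Lemma algmap_gen1 h : phi (xgen h) = xlin E' (M h).
Proof. by rewrite -[xgen h]xmul1r (algmap_gen phiP) (algmap1 phiP) xmul1r. Qed.

Lemma algmapM x y : phi (xmul x y) = xmul (phi x) (phi y).
Proof.
elim/(xext_ind (e := E)): x => [x x' IH IH'|a x IH||h x IH].
- by rewrite xmulDl !(algmapD phiP) IH IH' xmulDl.
- by rewrite xmulZl !(algmapZ phiP) IH xmulZl.
- by rewrite (algmap1 phiP) !xmul1l.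
- by rewrite -xmulA !(algmap_gen phiP) IH xmulA.
Qed.

Lemma algmap_diff h k x :
  phi (xmul (xgen h - xgen k) x) = xmul (xlin E' (fun l => M h l - M k l)) (phi x).
Proof. by rewrite algmapM algmapB !algmap_gen1 xlinB. Qed.

Section ReducedImage.
Variables (V V' : finType) (hv : H -> V) (hv' : H' -> V') (vm : V' -> V).
Hypothesis Mbal : forall h k v', hv h = hv k -> \sum_(l | hv' l == v') (M h l - M k l) = 0.
Hypothesis Mloc : forall h l, M h l != 0 -> vm (hv' l) = hv h.

(** By [Mbal] and [balancedE] a difference at [v] goes to a combination of differences, and by
    [Mloc] these lie at vertices over [v]. Fibres of [vm] over distinct [v] are disjoint, so no
    target vertex receives two factors. *)
Lemma algmap_red x : xred hv x -> xred hv' (phi x).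
Proof.
case=> J [a [y [yP ->]]]; rewrite algmap_sum.
have red0 : xred hv' (0 : E') by apply: xred_onW (xred_on0 E' hv' setT).
have redD (z1 z2 : E') : xred hv' z1 -> xred hv' z2 -> xred hv' (z1 + z2).
  by move=> r1 r2; apply: (@xred_onW _ _ _ _ _ setT); apply: xred_onD;
    [case: r1 | case: r2] => K [b [z [zP ->]]]; exists K, b, z; split=> // ? ?; rewrite inE.
apply: (big_ind (xred hv')) => // j _; rewrite (algmapZ phiP).
(* The image of a partial product is supported over the vertices already treated. *)
suff H0 (vs : seq V) : uniq vs ->
    xred_on hv' [set v' | vm v' \in vs] (phi (\big[xmul/xone]_(v <- vs) y j v)).
  by apply/(xred_onW (s := [set v' | vm v' \in index_enum V]))/xred_onZ/H0/index_enum_uniq.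
elim: vs => [_|v vs IH /= /andP[vvs /IH{}IH]].
  by rewrite big_nil (algmap1 phiP); apply: xred_on1.
rewrite big_cons; set X := \big[xmul/xone]_(w <- vs) _ in IH *.
have sub : [set v' | vm v' \in vs] \subset [set v' | vm v' \in v :: vs].
  by apply/subsetP=> v'; rewrite !inE => ->; rewrite orbT.
have [b [c ->]] := yP j v.
rewrite xmulDl xmulZl xmul1l xmul_suml (algmapD phiP) (algmapZ phiP) algmap_sum.
apply: xred_onD; first exact: xred_onS sub (xred_onZ _ IH).
apply: (big_ind (xred_on hv' _)) => [||p /andP[/eqP h1 /eqP h2]].
- exact: xred_on0.
- exact: xred_onD.
rewrite xmulZl (algmapZ phiP) algmap_diff; apply: xred_onZ.
have [d [dP ->]] := @balancedE R' H' E' V' hv' _ (fun v' => Mbal v' (etrans h1 (esym h2))).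
rewrite xmul_suml; apply: (big_ind (xred_on hv' _)) => [||l _].
- exact: xred_on0.
- exact: xred_onD.
rewrite xmulZl; have [->|ne] := eqVneq (M p.1 l - M p.2 l) 0.
  by rewrite rmorph0 scale0r; apply: xred_on0.
have lv : vm (hv' l) = v.
  have [E1|/Mloc->] := eqVneq (M p.1 l) 0; last exact: h1.
  have [E2|/Mloc->] := eqVneq (M p.2 l) 0; last exact: h2.
  by rewrite E1 E2 subrr eqxx in ne.
apply: xred_onZ; apply: (@xred_onS _ _ _ _ _ (hv' l |: [set v' | vm v' \in vs])).
  by apply/subsetP=> v'; rewrite !inE => /orP[/eqP->|->]; rewrite ?lv ?eqxx ?orbT.
by apply: xred_on_diff; rewrite ?dP // inE lv.
Qed.

End ReducedImage.

Section ChainMap.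
Variables (V : finType) (hv : H -> V) (w : H -> R) (w' : H' -> R') (d : E -> E) (d' : E' -> E').
Hypotheses (dD : forall x y, d (x + y) = d x + d y) (dZ : forall (a : R) x, d (a *: x) = a *: d x).
Hypotheses (d1 : d xone = 0)
  (dg : forall h x, d (xmul (xgen h) x) = w h *: x - xmul (xgen h) (d x)).
Hypotheses (d'D : forall x' y' : E', d' (x' + y') = d' x' + d' y').
Hypotheses (d'Z : forall (a : R') (x' : E'), d' (a *: x') = a *: d' x').
Hypotheses (d'1 : d' xone = 0).
Hypotheses (d'g : forall (h' : H') (x' : E'),
  d' (xmul (xgen h') x') = w' h' *: x' - xmul (xgen h') (d' x')).
Hypothesis Mbd : forall h k, hv h = hv k ->
  \sum_l (M h l - M k l)%:~R * w' l = rm (w h) - rm (w k).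

(** Compatibility holds on reduced elements because [Mbd] controls the differentials of differences,
    not those of single half-edges. *)
Lemma algmap_chain x : xred hv x -> phi (d x) = d' (phi x).
Proof.
move: x; apply: (xred_ind (P := fun x => phi (d x) = d' (phi x))) =>
  [x y IHx IHy|a x IH||h k x hk IH].
- by rewrite dD !(algmapD phiP) IHx IHy d'D.
- by rewrite dZ !(algmapZ phiP) IH d'Z.
- by rewrite d1 algmap0 (algmap1 phiP) d'1.
have d'0 : d' 0 = 0 by have := d'Z 0 0; rewrite !scale0r.
have dN z : d (- z) = - d z by rewrite -scaleN1r dZ scaleN1r.
have d'sum (I : finType) (F : I -> E') : d' (\sum_i F i) = \sum_i d' (F i).
  exact: (big_morph d' d'D d'0).
rewrite algmap_diff xmul_suml d'sum.
under eq_bigr do rewrite xmulZl d'Z d'g scalerBr scalerA.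
rewrite sumrB -scaler_suml (Mbd hk) -IH.
rewrite xmulBl dD dN !dg !(algmapD phiP) !algmapN !(algmapD phiP, algmapZ phiP) !algmapN.
rewrite !(algmap_gen phiP) opprD opprK scalerBl.
have -> : \sum_i (M h i - M k i)%:~R *: xmul (xgen i : E') (phi (d x)) =
    xmul (xlin E' (M h)) (phi (d x)) - xmul (xlin E' (M k)) (phi (d x)).
  by rewrite -xmulBl -xlinB xmul_suml; apply: eq_bigr => l _; rewrite xmulZl.
by rewrite opprB addrACA [X in _ + X]addrC.
Qed.

End ChainMap.
End AlgebraMap.

Lemma algmap_agree (R R' : comNzRingType) (H H' V : finType) (E : exterior R H)
    (E' : exterior R' H') (hv : H -> V) (rm rm' : {rmorphism R -> R'}) (M N : H -> H' -> int)
    (phi psi : E -> E') :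
  algmap rm M phi -> algmap rm' N psi -> rm =1 rm' ->
  (forall h k l, hv h = hv k -> M h l - M k l = N h l - N k l) ->
  forall x, xred hv x -> phi x = psi x.
Proof.
move=> phiP psiP rmE MN; apply: (xred_ind (P := fun x => phi x = psi x)) =>
  [x y IHx IHy|a x IH||h k x hk IH].
- by rewrite (algmapD phiP) (algmapD psiP) IHx IHy.
- by rewrite (algmapZ phiP) (algmapZ psiP) IH rmE.
- by rewrite (algmap1 phiP) (algmap1 psiP).
rewrite (algmap_diff phiP) (algmap_diff psiP) IH; congr (xmul _ _).
by apply: eq_xlin => l; apply: MN.
Qed.

Lemma algmap_comp (R R' R'' : comNzRingType) (H H' H'' : finType) (E : exterior R H)
    (E' : exterior R' H') (E'' : exterior R'' H'') (rm : {rmorphism R -> R'})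
    (rm' : {rmorphism R' -> R''}) (M : H -> H' -> int) (N : H' -> H'' -> int)
    (phi : E -> E') (psi : E' -> E'') :
  algmap rm M phi -> algmap rm' N psi ->
  algmap (rm' \o rm) (fun h k => \sum_l M h l * N l k) (psi \o phi).
Proof.
move=> phiP psiP; split=> [x y|a x||h x] /=.
- by rewrite (algmapD phiP) (algmapD psiP).
- by rewrite (algmapZ phiP) (algmapZ psiP).
- by rewrite (algmap1 phiP) (algmap1 psiP).
rewrite (algmap_gen phiP) (algmapM psiP) (algmap_sum psiP); congr (xmul _ _).
under eq_bigr do rewrite (algmapZ psiP) (algmap_gen1 psiP) rmorph_int /xlin scaler_sumr.
rewrite exchange_big; apply: eq_bigr => k _ /=.
rewrite rmorph_sum scaler_suml; apply: eq_bigr => l _.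
by rewrite scalerA rmorphM.
Qed.

Lemma eq_algmap (R R' : comNzRingType) (H H' : finType) (E : exterior R H) (E' : exterior R' H')
    (rm rm' : R -> R') (M M' : H -> H' -> int) (phi : E -> E') :
  rm =1 rm' -> (forall h k, M h k = M' h k) -> algmap rm M phi -> algmap rm' M' phi.
Proof.
move=> rmE ME [pD pZ p1 pg]; split=> // [a x|h x]; first by rewrite -rmE.
by rewrite pg; congr (xmul _ _); apply: eq_xlin.
Qed.

Lemma algmap_id (R : comNzRingType) (H : finType) (E : exterior R H) :
  algmap id (fun h k => (k == h)%:R) (@id E).
Proof. by split=> // h x; rewrite xlin1. Qed.

(** * Chain maps along contractions *)

Lemma half_eq (G : graph) (h k : halfedge G) : hvert h = hvert k -> hedge h = hedge k -> h = k.
Proof.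
by move=> hv he; apply: val_inj; rewrite [val h]surjective_pairing -/(hvert h) -/(hedge h) hv he
  -surjective_pairing.
Qed.

Lemma half_mem (G : graph) (h : halfedge G) : hvert h \in ends (hedge h).
Proof. exact: (valP h). Qed.

Lemma half_exists (G : graph) x (e : edge G) : x \in ends e ->
  exists h : halfedge G, hvert h = x /\ hedge h = e.
Proof. by move=> xe; exists (Sub (x, e) xe). Qed.

(* [r] lifts edges along the contraction [v : G -> G'] and [M] is the matrix of the pull-back
   on half-edges.  The functions [t] and [s] are arbitrary since only differences of
   half-edges at a common vertex matter. *)
Record transfer (G G' : graph) (r : edge G' -> edge G) (v : vert G -> vert G')
    (M : halfedge G' -> halfedge G -> int) : Prop := Transfer {
  tr_inj : injective r;
  tr_ends : forall e', ends e' = v @: ends (r e');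
  tr_edge : exists t : edge G -> vert G' -> int, forall h e,
    \sum_(k | hedge k == e) M h k = (e == r (hedge h))%:R + t e (hvert h);
  tr_vert : exists s : vert G -> vert G' -> int, forall h x,
    \sum_(k | hvert k == x) M h k = s x (hvert h);
  tr_lift : forall h k, #|v @: ends (hedge k)| = 2%N ->
    M h k = ((hedge k == r (hedge h)) && (v (hvert k) == hvert h))%:R;
  tr_loc : forall h k, M h k != 0 -> v (hvert k) = hvert h
}.

Section Lifts.
Variables (G G' : graph) (r : edge G' -> edge G) (v : vert G -> vert G').
Hypothesis r_ends : forall e', ends e' = v @: ends (r e').

Lemma lift_noncontracted e' : #|v @: ends (r e')| = 2%N.
Proof. by rewrite -r_ends ends_card. Qed.

Lemma lift_inj e' x y : x \in ends (r e') -> y \in ends (r e') -> v x = v y -> x = y.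
Proof.
have /imset_injP inj : #|v @: ends (r e')| == #|ends (r e')|.
  by rewrite lift_noncontracted ends_card.
exact: inj.
Qed.

Lemma lift_uniq (h' : halfedge G') (k l : halfedge G) :
  hedge k = r (hedge h') -> v (hvert k) = hvert h' ->
  hedge l = r (hedge h') -> v (hvert l) = hvert h' -> k = l.
Proof.
move=> ke kv le lv; apply: half_eq; last by rewrite ke le.
by apply: (lift_inj (e' := hedge h')); rewrite ?kv ?lv // -?ke ?half_mem // ke -le half_mem.
Qed.

Lemma lift_down (k : halfedge G) e' : hedge k = r e' ->
  exists h : halfedge G', hvert h = v (hvert k) /\ hedge h = e'.
Proof. by move=> ke; apply: half_exists; rewrite r_ends imset_f // -ke half_mem. Qed.

End Lifts.

Section TransferComp.
Variables (G G1 G' : graph) (r : edge G1 -> edge G) (v : vert G -> vert G1).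
Variables (r' : edge G' -> edge G1) (v' : vert G1 -> vert G').
Variables (M : halfedge G1 -> halfedge G -> int) (M' : halfedge G' -> halfedge G1 -> int).
Hypotheses (tM : transfer r v M) (tM' : transfer r' v' M').

(** The edge correction of [M] depends only on a vertex of [G1], so after composition it is weighted
    by the vertex sums of [M'], which depend only on a vertex of [G']. This is why vertex sums are
    part of the record. *)
Lemma transfer_comp :
  transfer (r \o r') (v' \o v) (fun h k => \sum_l M' h l * M l k).
Proof.
case: (tM) => ri re [t tP] [s sP] ml mloc; case: (tM') => ri' re' [t' tP'] [s' sP'] ml' mloc'.
split.
- exact: inj_comp.
- by move=> e'; rewrite re' re imset_comp.
- exists (fun e w => \sum_e1 (e == r e1)%:R * t' e1 w + \sum_y t e y * s' y w) => h e.
  rewrite exchange_big /=; under eq_bigr do rewrite -mulr_sumr tP mulrDr.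
  rewrite big_split /= addrA; congr (_ + _).
    rewrite (partition_big (@hedge G1) xpredT) //=.
    rewrite (eq_bigr (fun e1 => (e == r e1)%:R * ((e1 == r' (hedge h))%:R + t' e1 (hvert h)))).
      under eq_bigr do rewrite mulrDr.
      rewrite big_split; congr (_ + _); rewrite (bigD1 (r' (hedge h))) //= eqxx mulr1.
      by rewrite big1 ?addr0 // => e1 /negPf->; rewrite mulr0.
    by move=> e1 _; rewrite -tP' mulr_sumr; apply: eq_bigr => k /eqP->; rewrite mulrC.
  rewrite (partition_big (@hvert G1) xpredT) //=; apply: eq_bigr => y _.
  by rewrite -sP' mulr_sumr; apply: eq_bigr => k /eqP->; rewrite mulrC.
- exists (fun x w => \sum_y s x y * s' y w) => h x.
  rewrite exchange_big /=; under eq_bigr do rewrite -mulr_sumr sP.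
  rewrite (partition_big (@hvert G1) xpredT) //=; apply: eq_bigr => y _.
  by rewrite -sP' mulr_sumr; apply: eq_bigr => k /eqP->; rewrite mulrC.
- move=> h k nc; have nc1 : #|v @: ends (hedge k)| = 2%N.
    apply/eqP; rewrite eqn_leq; apply/andP; split.
      by rewrite (leq_trans (leq_imset_card _ _)) ?ends_card.
    by rewrite -nc imset_comp leq_imset_card.
  under eq_bigr do rewrite (ml _ _ nc1).
  (* If the edge of [k] is the lift of some [e1], only the half-edge of [e1] at the image vertex
     contributes to the sum; otherwise both sides vanish. *)
  have [/existsP[e1 /eqP e1E]|no] := boolP [exists e1, hedge k == r e1]; last first.
    have /negPf->/= : hedge k != (r \o r') (hedge h).
      by apply: contra no => /eqP->; apply/existsP; exists (r' (hedge h)).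
    rewrite big1 // => l _; case: eqP => [E|_]; last by rewrite mulr0.
    by case/existsP: no; exists (hedge l); rewrite E.
  have [l [lv le]] := lift_down re e1E.
  rewrite (bigD1 l) //= lv le e1E !eqxx mulr1 big1 ?addr0 => [|l' nl]; last first.
    case: andP => [[/eqP E1 /eqP E2]|_]; last by rewrite mulr0.
    by case/eqP: nl; apply: half_eq; rewrite ?lv ?E2 // le; apply: ri; rewrite -e1E -E1.
  rewrite ml' ?le; last by rewrite re -e1E -imset_comp.
  by rewrite lv (inj_eq ri).
- move=> h k; rewrite /comp => ne.
  have [/existsP[l /andP[n1 n2]]|no] := boolP [exists l, (M' h l != 0) && (M l k != 0)].
    by rewrite (mloc _ _ n2) (mloc' _ _ n1).
  case/eqP: ne; rewrite big1 // => l _; apply/eqP; rewrite mulf_eq0; apply: contraNT no.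
  by rewrite negb_or => nn; apply/existsP; exists l.
Qed.

End TransferComp.

Section Instances.
Variables (G G' : graph).

Lemma sum_delta (I : finType) (P : pred I) (i : I) :
  \sum_(k | P k) (k == i)%:R = (P i)%:R :> int.
Proof.
rewrite big_mkcond /= (bigD1 i) //= eqxx big1 => [|k /negPf->]; last by case: (P k).
by rewrite addr0; case: (P i).
Qed.

Lemma delta_transfer (r : edge G' -> edge G) (v : vert G -> vert G')
    (F : halfedge G' -> halfedge G) :
  injective r -> injective v -> (forall e', ends e' = v @: ends (r e')) ->
  (forall h, hedge (F h) = r (hedge h)) -> (forall h, v (hvert (F h)) = hvert h) ->
  transfer r v (fun h k => (k == F h)%:R).
Proof.
move=> ri vi re Fe Fv; split=> //.
- exists (fun _ _ => 0) => h e; rewrite (sum_delta (fun k => hedge k == e)) Fe addr0.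
  by rewrite eq_sym.
- exists (fun x y => (v x == y)%:R) => h x; rewrite (sum_delta (fun k => hvert k == x)).
  by rewrite -Fv (inj_eq vi) eq_sym.
- move=> h k _; case: eqP => [->|n]; first by rewrite Fe Fv !eqxx.
  case: andP => // -[/eqP ke /eqP kv]; case: n.
  by apply: (lift_uniq re (h' := h)).
- by move=> h k; case: (k =P F h) => [-> _|_]; rewrite ?Fv ?eqxx.
Qed.

Variable p : collapse G G'.

Lemma col_half_edge h : hedge (col_half p h) = col_e p (hedge h).
Proof. by have /andP[/eqP] := xchooseP (col_half_subproof p h). Qed.

Lemma col_half_vert h : col_v p (hvert (col_half p h)) = hvert h.
Proof. by have /andP[_ /eqP] := xchooseP (col_half_subproof p h). Qed.

Definition simple_matrix (e0 : edge G) (h : halfedge G') (k : halfedge G) : int :=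
  (k == col_half p h)%:R - ((hedge k == e0) && (hvert k == hvert (col_half p h)))%:R.

(** Every half-edge at the image of [e0] subtracts exactly one half-edge of [e0], whence the
    correction on edges. It subtracts it at its own vertex, so its sum at each endpoint of [e0] is
    0. *)
Lemma simple_transfer e0 : is_simple p e0 -> transfer (col_e p) (col_v p) (simple_matrix e0).
Proof.
case=> codE vE; have re := @col_ends _ _ p; have ri := @col_e_inj _ _ p.
have e0N e' : e0 != col_e p e'.
  by apply/eqP=> E; have := codE e0; rewrite {1}E codom_f eqxx.
have in_e0 h h' : hvert h = hvert h' ->
    (hvert (col_half p h) \in ends e0) = (hvert (col_half p h') \in ends e0).
  rewrite -[in LHS](col_half_vert h) -(col_half_vert h') => /eqP; rewrite vE.
  by case/orP=> [/eqP->//|/andP[-> ->]].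
have sum0 h : \sum_(k | hedge k == e0) ((hedge k == e0) && (hvert k == hvert (col_half p h)))%:R
    = (hvert (col_half p h) \in ends e0)%:R :> int.
  have [inh|ninh] := boolP (_ \in ends e0); last first.
    rewrite big1 // => k /eqP ke; case: andP => // -[_ /eqP kv].
    by move: ninh; rewrite -kv -ke half_mem.
  have [l [lv le]] := half_exists inh.
  rewrite (eq_bigr (fun k => (k == l)%:R)).
    by rewrite (sum_delta (fun k => hedge k == e0)) le eqxx.
  move=> k /eqP ke; rewrite ke eqxx /=; congr (_%:R).
  by congr nat_of_bool; apply/eqP/eqP => [kv|->//]; apply: half_eq; rewrite ?kv ?lv ?ke ?le.
(* This decides whether [y] is the image of [e0]; at a vertex without half-edges any value will
   do. *)
have choose_half y : exists b : bool, forall h, hvert h = y ->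
  (hvert (col_half p h) \in ends e0) = b.
  have [/existsP[h /eqP hy]|no] := boolP [exists h : halfedge G', hvert h == y].
    by exists (hvert (col_half p h) \in ends e0) => h' h'y; apply: in_e0; rewrite h'y.
  by exists true => h hy; case/existsP: no; exists h; apply/eqP.
have [b bP] := choice choose_half.
split=> //.
- exists (fun e y => - ((e == e0) && b y)%:R) => h e.
  rewrite sumrB (sum_delta (fun k => hedge k == e)) col_half_edge [e == _]eq_sym; congr (_ - _).
  rewrite -(bP _ h erefl); case: eqP => [->|ne]; first exact: sum0.
  by rewrite big1 // => k /eqP->; case: eqP.
- exists (fun x y => ((x \notin ends e0) && (col_v p x == y))%:R) => h x.
  rewrite sumrB (sum_delta (fun k => hvert k == x)) -(col_half_vert h) vE.
  set z := hvert (col_half p h).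
  have [xe0|xe0] := boolP (x \in ends e0); last first.
    rewrite /= orbF big1 ?subr0 => [|k /eqP kv]; first by rewrite eq_sym.
    case: andP => // -[/eqP ke _].
    by move: xe0; rewrite -kv -ke half_mem.
  have [l [lv le]] := half_exists xe0.
  rewrite (bigD1 l) ?lv //= le eqxx big1 ?addr0 ?subrr // => [|k /andP[/eqP kv nkl]].
    by rewrite eq_sym subrr.
  by case: andP => // -[/eqP ke _]; case/eqP: nkl; apply: half_eq; rewrite ?kv ?lv ?ke ?le.
- move=> h k nc; have ne0 : hedge k != e0.
    apply: contraPneq nc => ->; have /eqP/cards2P[x [y [nxy E]]] := ends_card e0.
    rewrite E imsetU1 imset_set1; have /eqP -> : col_v p x == col_v p y.
      by rewrite vE E !inE !eqxx !orbT.
    by rewrite setUid cards1.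
  rewrite /simple_matrix (negPf ne0) subr0.
  case: (k =P _) => [->|n]; first by rewrite col_half_edge col_half_vert !eqxx.
  case: andP => // -[/eqP ke /eqP kv]; case: n.
  by apply: (lift_uniq re (h' := h)); rewrite ?col_half_edge ?col_half_vert.
- move=> h k; rewrite /simple_matrix; case: (k =P _) => [-> _|_]; first exact: col_half_vert.
  case: andP => [[_ /eqP->] _|_]; last by rewrite subrr eqxx.
  exact: col_half_vert.
Qed.

Lemma iso_transfer : is_iso p ->
  transfer (col_e p) (col_v p) (fun h k => (k == col_half p h)%:R).
Proof.
case=> /bij_inj vi _; apply: delta_transfer => //.
- exact: col_e_inj.
- exact: col_ends.
- exact: col_half_edge.
- exact: col_half_vert.
Qed.

End Instances.

(** * The chain maps of cones *)

Definition graph_algmap (G G' : graph) := @algmap (edge_ring G) (edge_ring G')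
  (halfedge G) (halfedge G') (graph_ext G) (graph_ext G').

Lemma eq_graph_algmap (G G' : graph) rm rm' M M' phi :
  rm =1 rm' -> (forall h k, M h k = M' h k) -> @graph_algmap G G' rm M phi ->
    @graph_algmap G G' rm' M' phi.
Proof. exact: eq_algmap. Qed.

Lemma ext_map_algmap (G G' : graph) (r : edge G -> edge G') (F : halfedge G -> ext G')
    (M : halfedge G -> halfedge G' -> int) :
  (forall h, F h = xlin (graph_ext G') (M h)) -> graph_algmap (edge_map r) M (ext_map r F).
Proof.
move=> FM; have F1 h : deg1 (F h : graph_ext G') by rewrite FM; apply: xlin_deg1.
split.
- exact: ext_mapD.
- exact: ext_mapZ.
- exact: ext_map1.
- move=> h x; rewrite -FM; exact: ext_map_gen.
Qed.

Lemma edge_map_comp (G G' G'' : graph) (r : edge G -> edge G') (r' : edge G' -> edge G'') :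
  edge_map r' \o edge_map r =1 edge_map (r' \o r).
Proof.
move=> a /=; elim/edge_ring_ind: a => [|a b IHa IHb|e a IH]; first by rewrite !edge_map1.
  apply: etrans (congr1 (edge_map r') (edge_mapB r a b)) _.
  apply: etrans (edge_mapB r' _ _) _; apply: etrans (esym (edge_mapB (r' \o r) a b)).
  exact: (f_equal2 (fun x y => x - y) IHa IHb).
apply: etrans (congr1 (edge_map r') (edge_mapM r (evar e) a)) _.
apply: etrans (edge_mapM r' _ _) _; apply: etrans (esym (edge_mapM (r' \o r) _ a)).
apply: (f_equal2 (fun x y => x * y)) IH.
apply: etrans (congr1 _ (edge_map_evar r e)) _.
exact: etrans (edge_map_evar r' _) (esym (edge_map_evar (r' \o r) e)).
Qed.

Lemma eq_edge_map (G G' : graph) (r r' : edge G -> edge G') :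
  r =1 r' -> edge_map r =1 edge_map r'.
Proof.
move=> rr' a; elim/edge_ring_ind: a => [|a b IHa IHb|e a IH]; first by rewrite !edge_map1.
  by rewrite (edge_mapB r a b) IHa IHb (edge_mapB r' a b).
by rewrite (edge_mapM r _ a) (edge_mapM r' _ a) IH (edge_map_evar r) (edge_map_evar r') rr'.
Qed.

Lemma edge_map_id (G : graph) : edge_map (@id (edge G)) =1 id.
Proof.
move=> a; elim/edge_ring_ind: a => [|a b IHa IHb|e a IH]; first by rewrite edge_map1.
  by rewrite edge_mapB IHa IHb.
by rewrite edge_mapM edge_map_evar IH.
Qed.

Lemma graph_algmap_comp (G G' G'' : graph) (r : edge G -> edge G')
  (r' : edge G' -> edge G'') M M' phi psi :
  @graph_algmap G G' (edge_map r) M phi -> @graph_algmap G' G'' (edge_map r') M' psi ->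
  graph_algmap (edge_map (r' \o r)) (fun h k => \sum_l M h l * M' l k) (psi \o phi).
Proof.
move=> phiP psiP; have := algmap_comp phiP psiP.
by apply: eq_graph_algmap => // a; apply: edge_map_comp.
Qed.

Lemma xlin_simple_matrix (G G' : graph) (p : collapse G G') (e0 : edge G) h :
  gen (col_half p h) - \sum_(h0 | (hedge h0 == e0) && (hvert h0 == hvert (col_half p h))) gen h0
  = xlin (graph_ext G) (simple_matrix p e0 h).
Proof.
rewrite (xlinB (graph_ext G) (fun k => (k == col_half p h)%:R)
  (fun k => ((hedge k == e0) && (hvert k == hvert (col_half p h)))%:R)).
congr (_ - _); first by rewrite xlin1.
rewrite /xlin [LHS]big_mkcond /=; apply: eq_bigr => k _.
by case: ifP => _; [exact/esym/scale1r | exact/esym/scale0r].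
Qed.

Lemma fact_transfer (G G' : graph) (c : factorization G G') :
  exists M, transfer (fact_e c) (fact_v c) M /\ graph_algmap (edge_map (fact_e c)) M (fact_pull c).
Proof.
elim: c => {G G'} [G G' p p_iso|G G1 G' p e0 p_simple c [M [Mt Ma]]] /=.
  exists (fun h k => (k == col_half p h)%:R); split; first exact: iso_transfer.
  by apply: ext_map_algmap => h; rewrite xlin1.
eexists; split; first exact: transfer_comp (simple_transfer p_simple) Mt.
apply: graph_algmap_comp Ma _; apply: ext_map_algmap => h; exact: xlin_simple_matrix.
Qed.

Section Cones.
Variables (S T : rtree) (f : rhom S T).

Lemma tedgeP (A : tedge S) : exists2 x, x != root S & val A = [set x; tpar x].
Proof.
case: A => A /= /existsP[x /existsP[y /andP[/adjP[[xr ->]|[yr ->]] /eqP->]]].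
  by exists x.
by exists y; rewrite // setUC.
Qed.

Fact parent_edge_subproof (x : S) : x != root S ->
  [exists y, exists z, adj y z && ([set x; tpar x] == [set y; z])].
Proof.
by move=> xr; apply/existsP; exists x; apply/existsP; exists (tpar x); rewrite tpar_adj ?eqxx.
Qed.
Definition parent_edge x (xr : x != root S) : tedge S :=
  Sub [set x; tpar x] (parent_edge_subproof xr).

(* Only the edges of [S] inside a fibre of [f] are contracted. *)
Definition contracted (e : edge (cone S)) := #|omap f @: ends e| != 2%N.

Lemma contractedP (e : edge (cone S)) : contracted e ->
  exists2 x, x != root S & exists A : tedge S,
    [/\ e = inl A, val A = [set x; tpar x] & f x = f (tpar x)].
Proof.
case: e => [A|w]; rewrite /contracted /=.
  have [x xr AE] := tedgeP A; rewrite AE !imsetU1 !imset_set1 cards2 /= => ne.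
  exists x => //; exists A; split=> //; apply/eqP; apply: contraNT ne => ne.
  by rewrite (_ : Some (f x) != Some (f (tpar x))).
by rewrite imsetU1 imset_set1 cards2.
Qed.

(** Work up from the leaves of the forest of contracted edges. At [x] the half-edges on edges to
    children vanish by induction and balance on those edges; balance at [x] then kills the half-edge
    towards the parent, and balance on that edge its other half. *)
Lemma balanced_eq0 (D : halfedge (cone S) -> int) :
  (forall k, ~~ contracted (hedge k) -> D k = 0) ->
  (forall e, \sum_(k | hedge k == e) D k = 0) ->
  (forall x, \sum_(k | hvert k == x) D k = 0) ->
  forall k, D k = 0.
Proof.
move=> Dnc De Dv.
have opp k l : hedge k = hedge l -> k != l -> D k = - D l.
  move=> kl nkl; apply/eqP; rewrite -addr_eq0 -(De (hedge l)) (bigD1 k) ?kl //=.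
  rewrite (bigD1 l) /=; last by rewrite eqxx eq_sym.
  rewrite big1 ?addr0 // => m /andP[/andP[/eqP me nmk] nml].
  have : #|[set hvert k; hvert l; hvert m]| = 3%N.
    have ne a b : hedge a = hedge b -> a != b -> hvert a != hvert b.
      by move=> ab; apply: contra_neq => h; apply: half_eq.
    rewrite -setUA cardsU1 cards2 !inE negb_or !ne ?me // ?kl //.
    - by rewrite eq_sym.
    - by rewrite eq_sym.
  move=> c3; suff : (3 <= 2)%N by [].
  rewrite -c3 -(ends_card (hedge l)); apply: subset_leq_card; apply/subsetP=> x.
  rewrite !inE => /orP[/orP[]|] /eqP->; [rewrite -kl | | rewrite -me]; exact: half_mem.
have low x (xr : x != root S) (k : halfedge (cone S)) : hvert k = Some x ->
  hedge k = inl (parent_edge xr) -> D k = 0.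
  elim/downward_ind: x xr k => x IH xr k kv ke.
  have := Dv (Some x); rewrite (bigD1 k) ?kv //= big1 ?addr0 // => l /andP[/eqP lv nlk].
  have [/contractedP[y yr [A [lE AE fy]]]|/Dnc//] := boolP (contracted (hedge l)).
  have AE' : A = parent_edge yr by apply: val_inj.
  have := half_mem l; rewrite lv lE /= mem_imset; last exact: Some_inj.
  rewrite AE !inE => /orP[/eqP xy|/eqP xy].
    case/eqP: nlk; apply: half_eq; rewrite ?lv ?kv // lE ke AE'; congr inl.
    by apply: val_inj; rewrite /= xy.
  have [m [mv me]] : exists m : halfedge (cone S), hvert m = Some y /\ hedge m = inl A.
    by apply: half_exists; rewrite /= mem_imset ?AE ?set21 //; exact: Some_inj.
  rewrite (opp l m) ?lE ?me //.
    rewrite (IH y _ yr m) ?oppr0 // ?me ?AE' //.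
    by rewrite xy tpar_gt.
  apply: contraTneq (tpar_gt yr) => lm; move: lv; rewrite lm mv => -[yx].
  by rewrite -xy yx /tlt eqxx.
move=> k; have [/contractedP[y yr [A [kE AE fy]]]|/Dnc//] := boolP (contracted (hedge k)).
have AE' : A = parent_edge yr by apply: val_inj.
have [m [mv me]] : exists m : halfedge (cone S), hvert m = Some y /\ hedge m = inl A.
  by apply: half_exists; rewrite /= mem_imset ?AE ?set21 //; exact: Some_inj.
have m0 : D m = 0 by apply: (low y yr) => //; rewrite me AE'.
by case: (eqVneq k m) => [->//|nkm]; rewrite (opp k m) ?kE ?me // m0 oppr0.
Qed.

End Cones.

(** * Lifting edges along a contraction, and the maps on reduced chains *)

Section EdgeLift.
Variables (S T : rtree) (f : rhom S T).

Lemma noncontracted_top x : x != root S -> f x != f (tpar x) -> x = top_of f (f x).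
Proof.
move=> xr ne; apply/eqP; apply: contraNT ne => nx; apply/eqP.
apply: tle_anti; first exact/rhom_mono/tltW/tpar_gt.
rewrite top_of_galois; apply: tpar_le; rewrite /tlt nx; exact: top_of_max.
Qed.

Lemma edge_lift_exists (A' : tedge T) : exists A : tedge S, f @: val A == val A'.
Proof.
have [y yr ->] := tedgeP A'.
have [a [b [ab <- <-]]] := contracting_lift (rhom_contracting f) (tpar_adj yr).
have P : [exists u, exists v, adj u v && ([set a; b] == [set u; v])].
  by apply/existsP; exists a; apply/existsP; exists b; rewrite ab eqxx.
by exists (Sub [set a; b] P); rewrite /= imsetU1 imset_set1.
Qed.

(** The lower endpoint of any lift is the top of the fibre over the lower endpoint of [A'], and a
    tree edge is determined by its lower endpoint. *)
Lemma edge_lift_uniq (A B : tedge S) (A' : tedge T) :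
  f @: val A = val A' -> f @: val B = val A' -> A = B.
Proof.
have [x xr AE] := tedgeP A; have [y yr BE] := tedgeP B; have [z zr ->] := tedgeP A'.
rewrite AE BE !imsetU1 !imset_set1 => fA fB.
have nz : z != tpar z by case/andP: (tpar_gt zr).
have low u : u != root S -> [set f u; f (tpar u)] = [set z; tpar z] -> u = top_of f z.
  move=> ur E; have nu : f u != f (tpar u).
    apply: contraTneq isT => fu; have := cards2 z (tpar z).
    by rewrite nz -E fu setUid cards1.
  rewrite {1}(noncontracted_top ur nu); congr top_of.
  have := set21 (f u) (f (tpar u)); rewrite E !inE => /orP[/eqP//|/eqP fu].
  have := set22 (f u) (f (tpar u)); rewrite E !inE => /orP[/eqP fpu|/eqP fpu]; last first.
    by rewrite fu fpu eqxx in nu.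
  have := rhom_mono f (tltW (tpar_gt ur)); rewrite fu fpu => le.
  by have /tltNge := tpar_gt zr; rewrite le.
by apply: val_inj; rewrite AE BE (low x xr fA) (low y yr fB).
Qed.

Definition edge_lift (A' : tedge T) : tedge S := xchoose (edge_lift_exists A').

Lemma edge_liftE A' : f @: val (edge_lift A') = val A'.
Proof.
exact/eqP/(xchooseP (edge_lift_exists A')).
Qed.

Lemma edge_lift_inj : injective edge_lift.
Proof. by move=> A B AB; apply: val_inj; rewrite -!edge_liftE AB. Qed.

(** These are the properties of the edge map of the embedding of [cone T] followed by lifting to
    [cone S]; [lifts_uniq] shows that they determine it. *)
Definition lifts (r : edge (cone T) -> edge (cone S)) : Prop :=
  (forall w : T, r (inr w) = inr (top_of f w)) /\
  (forall A' : tedge T, exists2 A : tedge S, r (inl A') = inl A & f @: val A = val A').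

Lemma lifts_uniq r r' : lifts r -> lifts r' -> r =1 r'.
Proof.
case=> rr rl [rr' rl'] [A'|w]; last by rewrite rr rr'.
have [A -> AE] := rl A'; have [B -> BE] := rl' A'.
by rewrite (edge_lift_uniq AE BE).
Qed.

(** The properties shared by all composites [fact_pull c \o emb_push j]. They determine such a
    composite on reduced chains and, unlike its construction, are closed under composition of
    contractions. *)
Definition cone_map r M (phi : ext (cone T) -> ext (cone S)) : Prop :=
  [/\ lifts r, @transfer (cone S) (cone T) r (omap f) M & graph_algmap (edge_map r) M phi].

Lemma cone_map_agree r M phi r' M' phi' x :
  cone_map r M phi -> cone_map r' M' phi' -> xred (E := graph_ext (cone T)) (@hvert _) x ->
    phi x = phi' x.
Proof.
case=> rl tM aM [rl' tM' aM']; have rE := lifts_uniq rl rl'.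
move: x; apply: (algmap_agree aM aM' (eq_edge_map rE)) => h k l hk.
apply/eqP; rewrite -subr_eq0; apply/eqP.
(* The rows of [h] and [k] are compared for both matrices. Entries on non-contracted edges agree by
   [tr_lift], and the corrections in the sums cancel because [h] and [k] share a vertex. *)
move: l; apply: (@balanced_eq0 _ _ f).
- move=> l /negPn/eqP nc; rewrite (tr_lift tM) // (tr_lift tM) // (tr_lift tM') // (tr_lift tM') //.
  by rewrite !rE subrr.
- move=> e; rewrite !sumrB; have [t tP] := tr_edge tM; have [t' tP'] := tr_edge tM'.
  have cancel (a b c : int) : (a + c) - (b + c) = a - b by rewrite opprD addrACA subrr addr0.
  by rewrite !tP !tP' hk !rE !cancel subrr.
- move=> y; rewrite !sumrB; have [t tP] := tr_vert tM; have [t' tP'] := tr_vert tM'.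
  by rewrite !tP !tP' hk !subrr.
Qed.

(** When the lifts of two half-edges still share a vertex, their difference satisfies the same
    balance conditions as the image and must equal it. So no contracted edge enters, which is what
    lets terms descend to quotient trees. *)
Lemma cone_map_diff r M phi (h k : halfedge (cone T)) (h' k' : halfedge (cone S)) :
  cone_map r M phi -> hvert h' = hvert k' ->
  hedge h' = r (hedge h) -> omap f (hvert h') = hvert h ->
  hedge k' = r (hedge k) -> omap f (hvert k') = hvert k ->
  xlin (graph_ext (cone S)) (fun l => M h l - M k l) = gen h' - gen k'.
Proof.
case=> rl tM aM hk' he hv ke kv.
have hk : hvert h = hvert k by rewrite -hv hk'.
have -> : gen h' - gen k' = xlin (graph_ext (cone S)) (fun l => (l == h')%:R - (l == k')%:R).
  by rewrite (xlinB _ (fun l => (l == h')%:R) (fun l => (l == k')%:R)) !xlin1.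
apply: eq_xlin => l; apply/eqP; rewrite -subr_eq0; apply/eqP.
have chr g g' : hedge g' = r (hedge g) -> omap f (hvert g') = hvert g -> forall l,
    (hedge l == r (hedge g)) && (omap f (hvert l) == hvert g) = (l == g').
  move=> ge gv {}l; apply/idP/eqP => [/andP[/eqP le /eqP lv]|->]; last by rewrite ge gv !eqxx.
  exact: (@lift_uniq (cone S) (cone T) r (omap f) (tr_ends tM) g).
move: l; apply: (@balanced_eq0 _ _ f).
- move=> l /negPn/eqP nc; rewrite !(tr_lift tM) // (chr _ h') // (chr _ k') //.
  by rewrite subrr.
- move=> e; rewrite !sumrB; have [t tP] := tr_edge tM.
  rewrite !tP hk (sum_delta (fun l => hedge l == e)) (sum_delta (fun l => hedge l == e)) he ke.
  by rewrite opprD addrACA subrr addr0 ![e == _]eq_sym subrr.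
- move=> y; rewrite !sumrB; have [t tP] := tr_vert tM.
  rewrite !tP hk (sum_delta (fun l => hvert l == y)) (sum_delta (fun l => hvert l == y)) hk'.
  by rewrite !subrr.
Qed.

End EdgeLift.

Lemma eq_transfer (G G' : graph) (r : edge G' -> edge G) (v v' : vert G -> vert G') M :
  v =1 v' -> transfer r v M -> transfer r v' M.
Proof. by move=> /funext->. Qed.

Lemma lifts_comp (S T U : rtree) (g : rhom T U) (f : rhom S T) r r' :
  lifts f r -> lifts g r' -> lifts (rcomp g f) (r \o r').
Proof.
case=> rr rl [rr' rl']; split=> [w|A''] /=; first by rewrite rr' rr top_of_comp.
have [A' -> A'E] := rl' A''; have [A -> AE] := rl A'; exists A => //.
by rewrite -A'E -AE -imset_comp; apply: eq_imset => x /=; rewrite rcompE.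
Qed.

Lemma cone_map_comp (S T U : rtree) (g : rhom T U) (f : rhom S T) r M phi r' M' phi' :
  @cone_map S T f r M phi -> @cone_map T U g r' M' phi' ->
  exists r'' M'', cone_map (rcomp g f) r'' M'' (phi \o phi').
Proof.
case=> rl tM aM [rl' tM' aM']; exists (r \o r'), (fun h k => \sum_l M' h l * M l k); split.
- exact: lifts_comp.
- by apply: eq_transfer (transfer_comp tM tM') => -[x|] //=; rewrite rcompE.
- exact: graph_algmap_comp aM' aM.
Qed.

Lemma cone_map_id (T : rtree) : exists r M, @cone_map T T (rid T) r M id.
Proof.
exists id, (fun h k => (k == h)%:R); split.
- split=> [w|A]; first by rewrite top_of_id.
  exists A => //; rewrite -[RHS]imset_id; apply: eq_imset => x; exact: ridE.
- have omapid : omap (rid T) =1 id by case=> [x|] //=; rewrite ridE.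
  apply: (@eq_transfer _ _ _ id) => [x|]; first by rewrite omapid.
  by apply: (@delta_transfer (cone T) (cone T) id id id) => // e; rewrite imset_id.
- by apply: eq_algmap (algmap_id _) => // a; rewrite edge_map_id.
Qed.

(** * Factorizations into simple contractions *)

Section Factorization.
Variables (S T : rtree) (f : rhom S T).

Lemma iota_transfer (j : embedding (cone T) (cone_along f)) : is_iota j ->
  @transfer (cone_along f) (cone T) (emb_e j) (fun x => x) (fun h k => (k == emb_half j h)%:R).
Proof.
case=> jv jA jw; apply: delta_transfer.
- exact: emb_e_inj.
- by move=> x y.
- by move=> e; rewrite emb_ends imset_id (eq_imset (g := id)) ?imset_id.
- by move=> h.
- by move=> h; rewrite /hvert /= jv.
Qed.

Lemma cone_map_fact c j : @factors_pi S T f c -> is_iota j ->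
  exists r M, cone_map f r M (fact_pull c \o emb_push j).
Proof.
case=> cv cw cA jI; have jt := iota_transfer jI; case: jI => jv jA jw.
have [M [Mt Ma]] := fact_transfer c.
have Na : graph_algmap (edge_map (emb_e j)) (fun h k => (k == emb_half j h)%:R) (emb_push j).
  by apply: ext_map_algmap => h; rewrite xlin1.
exists (fact_e c \o emb_e j), (fun h k => \sum_l (l == emb_half j h)%:R * M l k); split.
- split=> [w|A'] /=; last by rewrite jA; apply: cA.
  by have [m -> /fiber_max_top->] := jw w; rewrite cw.
- by apply: eq_transfer (transfer_comp Mt jt) => x /=; rewrite cv.
- exact: graph_algmap_comp Na Ma.
Qed.

Fact iota_ends (e : edge (cone T)) :
  ends ((match e with inl A => inl A | inr w => inr (top_of f w) end) : edge (cone_along f))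
  = (id : vert (cone T) -> vert (cone_along f)) @: ends e.
Proof. by case: e => [A|w]; rewrite imset_id //= top_ofK. Qed.

Lemma iota_exists : exists j, @is_iota S T f j.
Proof.
have inj : injective (fun e : edge (cone T) =>
    (match e with inl A => inl A | inr w => inr (top_of f w) end) : edge (cone_along f)).
  by move=> [A|w] [B|w'] // [] => [->//|/top_of_inj->].
exists (@Embedding (cone T) (cone_along f) id _ (fun x y e => e) inj iota_ends).
by split=> //= w; exists (top_of f w) => //; apply: top_of_fiber_max.
Qed.

End Factorization.

Section LiftCollapse.
Variables (S T : rtree) (f : rhom S T) (W : finType) (g : W -> S) (g' : W -> T).
Hypothesis gg' : g' =1 f \o g.

Definition along_edge (e : edge (cone_along g')) : edge (cone_along g) :=
  match e with inl A => inl (edge_lift f A) | inr w => inr w end.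

Lemma along_surj (w : vert (cone_along g')) : exists v : vert (cone_along g), omap f v = w.
Proof. by case: w => [w|]; [exists (Some (top_of f w)); rewrite /= top_ofK | exists None]. Qed.

Lemma along_edge_inj : injective along_edge.
Proof. by move=> [A|w] [B|w'] // [] => [/edge_lift_inj->|->]. Qed.

Lemma along_ends (e : edge (cone_along g')) :
  ends e = (omap f : vert (cone_along g) -> vert (cone_along g')) @: ends (along_edge e).
Proof.
case: e => [A|w] /=; last by rewrite imsetU1 imset_set1 /= gg'.
by rewrite -(edge_liftE f) -!imset_comp; apply: eq_imset.
Qed.

Definition along_collapse : collapse (cone_along g) (cone_along g') :=
  @Collapse (cone_along g) (cone_along g') (omap f) along_edge along_surj along_edge_inj along_ends.

Lemma edge_lift_hit (A : tedge S) : (forall x y, val A = [set x; y] -> adj x y -> f x != f y) ->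
  exists A', edge_lift f A' = A.
Proof.
case: (A) => B /= BP; case/existsP: (BP) => x /existsP[y /andP[xy /eqP BE]].
move=> /(_ x y BE xy) nf.
case/orP: (contracting_adj (rhom_contracting f) xy) => [/eqP fxy|fxy];
  first by rewrite fxy eqxx in nf.
have P : [exists u, exists v, adj u v && ([set f x; f y] == [set u; v])].
  by apply/existsP; exists (f x); apply/existsP; exists (f y); rewrite fxy eqxx.
exists (Sub [set f x; f y] P); apply: (edge_lift_uniq (edge_liftE _ _)).
by rewrite /= BE imsetU1 imset_set1.
Qed.

End LiftCollapse.

Lemma inj_surj_bij (A B : Type) (h : A -> B) : injective h -> (forall b, exists a, h a = b) ->
  bijective h.
Proof.
move=> hi /choice[k kP]; exists k => // a; exact: hi.
Qed.

Lemma along_iso (S T : rtree) (f : rhom S T) (W : finType) (g : W -> S) (g' : W -> T)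
    (gg' : g' =1 f \o g) : injective f -> is_iso (along_collapse gg').
Proof.
move=> fi; split; apply: inj_surj_bij.
- by move=> [x|] [y|] //= [] /fi->.
- exact: along_surj.
- exact: along_edge_inj.
- move=> [A|w]; last by exists (inr w).
  have [x y _ xy|A' A'E] := @edge_lift_hit _ _ f A; last by exists (inl A'); rewrite /= A'E.
  by rewrite (inj_eq fi); apply: contraTneq xy => ->; rewrite adj_irr.
Qed.

Section RemoveVertex.
Variables (S : rtree) (x : S).
Hypothesis xr : x != root S.

Let V := {y : S | y != x}.
Fact removed_root_subproof : root S != x. Proof. by rewrite eq_sym. Qed.
Let vroot : V := Sub (root S) removed_root_subproof.
Let le : rel V := fun a b => tle (val a) (val b).

Lemma removed_order : tree_order vroot le.
Proof.
case/and5P: (tle_order S) => h1 h2 h3 h4 h5; apply/and5P; split.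
- by apply/forallP=> a; apply: tle_refl.
- by apply/forallP=> a; apply: tle_root.
- apply/forallP=> a; apply/forallP=> b; apply/implyP=> /andP[ab ba].
  exact/eqP/val_inj/tle_anti.
- apply/forallP=> a; apply/forallP=> b; apply/forallP=> c; apply/implyP=> /andP[].
  exact: tle_trans.
- apply/forallP=> a; apply/forallP=> b; apply/forallP=> c; apply/implyP=> /andP[].
  exact: tle_chain.
Qed.

(** Dropping [x] from the order amounts to contracting the edge from [x] to its parent: the children
    of [x] become children of [tpar x]. *)
Definition removed : rtree := order_rtree removed_order.

Lemma removed_tle (a b : removed) : tle (val a : S) (val b) = tle a b.
Proof. by rewrite (order_rtree_tle removed_order). Qed.

Definition remove : rhom S removed := @rhom_of S removed val removed_tle erefl.

Lemma top_of_remove w : top_of remove w = val w.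
Proof. exact: top_of_rhom_of. Qed.

Lemma val_remove y : val (remove y) = if y == x then tpar x else y.
Proof.
have rE (z : S) (zx : z != x) : val (remove z) = z.
  by rewrite -{1}[z]/(val (Sub z zx : V)) -(top_of_remove (Sub z zx)) top_ofK.
case: eqP => [->|/eqP]; last exact: rE.
have px : tpar x != x by case/andP: (tpar_gt xr); rewrite eq_sym.
rewrite -[RHS](rE _ px); suff -> : remove x = remove (tpar x) by [].
apply: tle_anti; first exact/rhom_mono/tltW/tpar_gt.
rewrite (rhom_ofP removed_tle erefl); apply: tpar_le.
rewrite /tlt eq_sym (valP (remove x)) /= -(rhom_ofP removed_tle erefl).
exact: tle_refl.
Qed.

Lemma remove_simple (W : finType) (g : W -> S) (g' : W -> removed) (gg' : g' =1 remove \o g) :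
  is_simple (along_collapse gg') (inl (parent_edge xr)).
Proof.
have px : tpar x != x by case/andP: (tpar_gt xr); rewrite eq_sym.
have val_remove_eq a b : (remove a == remove b) =
    (a == b) || ((a \in [set x; tpar x]) && (b \in [set x; tpar x])).
  rewrite -(inj_eq val_inj) !val_remove !inE.
  case: (eqVneq a x) => [->|nax]; case: (eqVneq b x) => [->|nbx]; rewrite ?eqxx //=.
  - by rewrite (negPf nax) andbT.
  - case: (eqVneq a b) => //= nab; apply/esym/negP=> /andP[/eqP aE /eqP bE].
    by rewrite aE bE eqxx in nab.
split=> [[A|w]|[a|] [b|]] /=.
- have [nA|] := boolP (_ != _).
    have [|A' A'E] := @edge_lift_hit _ _ remove A; last by rewrite -A'E; apply/codomP;
      exists (inl A').
    move=> a b AE ab; rewrite val_remove_eq negb_or; apply/andP; split.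
      by apply: contraTneq ab => ->; rewrite adj_irr.
    apply: contra nA => /andP[ia ib]; apply/eqP; congr inl; apply: val_inj => /=; rewrite AE.
    apply/eqP; rewrite eqEcard cards2 subUset !sub1set ia ib /= cards2.
    have -> : a != b by apply: contraTneq ab => ->; rewrite adj_irr.
    by case: (_ != _).
  rewrite negbK => /eqP[->]; apply/negP=> /codomP[[A'|w] //= [A'E]].
  have := ends_card (inl A' : edge (cone removed)); rewrite /= card_imset; last exact: Some_inj.
  rewrite -(edge_liftE remove) -A'E /= imsetU1 imset_set1.
  have /eqP -> : remove x == remove (tpar x) by rewrite val_remove_eq !inE !eqxx !orbT.
  by rewrite setUid cards1.
- by apply/codomP; exists (inr w).
- rewrite !(mem_imset _ _ (@Some_inj _)); exact: val_remove_eq.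
- by apply/esym/negP=> /andP[_ /imsetP[]].
- by apply/esym/negP=> /andP[/imsetP[]].
- by [].
Qed.

End RemoveVertex.

(** Induction on the size of [S], contracting one edge at a time. The edges to the cone point stay
    indexed by a fixed [W] while the tree shrinks, hence the arbitrary maps [g] and [g']. *)
Lemma factorization_exists (S T : rtree) (f : rhom S T) (W : finType) (g : W -> S) (g' : W -> T) :
  g' =1 f \o g -> exists c : factorization (cone_along g) (cone_along g'),
  [/\ fact_v c =1 omap f, forall w, fact_e c (inr w) = inr w
    & forall A' : tedge T, exists2 A : tedge S, fact_e c (inl A') = inl A & f @: val A = val A'].
Proof.
have [n] := ubnP #|S|; elim: n S f g => // n IH S f g; rewrite ltnS => Sn gg'.
have [fi|nfi] := pselect (injective f).
  exists (FactIso (along_iso gg' fi)); split=> // A'.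
  by exists (edge_lift f A') => //; apply: edge_liftE.
(* If no vertex had the same image as its parent, every vertex would be the top of its fibre and [f]
   would be injective. *)
have [x xr fx] : exists2 x, x != root S & f x = f (tpar x).
  have [/existsP[x /andP[xr /eqP fx]]|no] := boolP [exists x, (x != root S) && (f x == f (tpar x))].
    by exists x.
  case: nfi => a b fab.
  have topE y : y = top_of f (f y).
    case: (eqVneq y (root S)) => [->|yr]; first by rewrite rhom_root top_of_root.
    apply: noncontracted_top => //; apply: contra no => fy.
    by apply/existsP; exists y; rewrite yr.
  by rewrite (topE a) fab -topE.
pose S1 := removed xr; pose rho := remove xr.
(* The parent of [x] lies in the same fibre, so [x] is not a top and all tops survive in [S1]. *)
have top_ne w : top_of f w != x.
  apply: contraTneq (tpar_gt xr) => wx; apply/negP=> /tltNge/negP[].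
  by rewrite -[X in tle _ X]wx -top_of_galois -fx -wx top_ofK.
pose m w : S1 := Sub (top_of f w) (top_ne w).
have m_tle w w' : tle (m w) (m w') = tle w w' by rewrite -removed_tle /= tle_top.
have m_root : m (root T) = root S1 by apply: val_inj; rewrite /= top_of_root.
pose f1 := rhom_of m_tle m_root.
have fE : f = rcomp f1 rho.
  apply: rhom_eq_top => w; rewrite top_of_comp.
  by rewrite (top_of_rhom_of m_tle m_root) top_of_remove.
have S1n : (#|S1| < n)%N.
  apply: leq_trans Sn; rewrite card_sig; apply: proper_card; apply/properP; split.
    exact/subsetP.
  by exists x; rewrite // inE eqxx.
have gE : rho \o g =1 rho \o g by [].
have g1E : g' =1 f1 \o (rho \o g) by move=> w; rewrite gg' /= fE rcompE.
have [c [cv cw cA]] := IH S1 f1 _ S1n g1E.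
exists (FactStep (remove_simple gE) c); split=> [[y|]|w|A'] /=.
- by rewrite cv /= fE rcompE.
- by rewrite cv.
- by rewrite cw.
have [A1 -> A1E] := cA A'; exists (edge_lift rho A1) => //.
rewrite -A1E -(edge_liftE rho) -imset_comp; apply: eq_imset => y /=.
by rewrite fE rcompE.
Qed.

Lemma cone_map_exists (S T : rtree) (f : rhom S T) :
  exists c j, factors_pi (f := f) c /\ is_iota (f := f) j.
Proof.
have [j jP] := iota_exists f.
have [c cP] := @factorization_exists S T f S id f (fun=> erefl).
by exists c, j.
Qed.

(** * Noetherian modules *)

Section Spans.
Variable M : rt_module.

Lemma act0 S T (f : rhom S T) : act M f 0 = 0.
Proof. by apply: (addrI (act M f 0)); rewrite -actD !addr0. Qed.

Lemma actN S T (f : rhom S T) x : act M f (- x) = - act M f x.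
Proof. by apply: (addrI (act M f x)); rewrite -actD !subrr act0. Qed.

Inductive spanned (L : seq {T : rtree & M T}) (T : rtree) : M T -> Prop :=
| Spanned0 : spanned L 0
| SpannedG p (f : rhom T (tag p)) : List.In p L -> spanned L (act M f (tagged p))
| SpannedB x y : spanned L x -> spanned L y -> spanned L (x - y).

Lemma spannedN L T (x : M T) : spanned L x -> spanned L (- x).
Proof. by rewrite -sub0r; apply: SpannedB; apply: Spanned0. Qed.

Lemma spannedD L T (x y : M T) : spanned L x -> spanned L y -> spanned L (x + y).
Proof. by move=> sx /spannedN sy; rewrite -[y]opprK; apply: SpannedB. Qed.

Lemma spannedMz L T (x : M T) n : spanned L x -> spanned L (x *~ n).
Proof.
move=> sx; have sMn k : spanned L (x *+ k).
  by elim: k => [|k IH]; rewrite ?mulr0n ?mulrS; [apply: Spanned0 | apply: spannedD].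
by case: n => n; [exact: sMn | rewrite NegzE mulrNz; apply/spannedN/sMn].
Qed.

Lemma spanned_sub L L' T (x : M T) :
  (forall p, List.In p L -> List.In p L') -> spanned L x -> spanned L' x.
Proof.
move=> LL'; elim=> [|p f pL|y z _ sy _ sz]; first exact: Spanned0.
  exact/SpannedG/LL'.
exact: SpannedB.
Qed.

Fixpoint yoneda (L : seq {T : rtree & M T}) (T : rtree) : principal_sum (map tag L) T -> M T :=
  match L with
  | [::] => fun=> 0
  | p :: L' => fun x => \sum_(f : rhom T (tag p)) act M f (tagged p) *~ (x.1 f) + yoneda x.2
  end.

Lemma yonedaD L T : {morph @yoneda L T : x y / x + y}.
Proof.
elim: L => [|p L IH] x y /=; first by rewrite addr0.
rewrite IH addrACA; congr (_ + _); rewrite -big_split; apply: eq_bigr => f _.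
by rewrite ffunE mulrzDr.
Qed.

Lemma act_sum (I : finType) S T (f : rhom S T) (F : I -> M T) :
  act M f (\sum_i F i) = \sum_i act M f (F i).
Proof. exact: (big_morph _ (actD M f) (act0 f)). Qed.

Lemma actMz S T (f : rhom S T) x n : act M f (x *~ n) = act M f x *~ n.
Proof.
have Mn k : act M f (x *+ k) = act M f x *+ k.
  by elim: k => [|k IH]; rewrite ?mulr0n ?act0 // !mulrS actD IH.
by case: n => n; [exact: Mn | rewrite NegzE !mulrNz actN Mn].
Qed.

Lemma yoneda_act L S T (f : rhom S T) (x : principal_sum (map tag L) T) :
  yoneda (act (principal_sum (map tag L)) f x) = act M f (yoneda x).
Proof.
elim: L x => [|p L IH] x /=; first by rewrite act0.
rewrite actD -IH act_sum; congr (_ + _).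
under eq_bigr => g _ do rewrite ffunE mulrz_sumr big_mkcond.
rewrite exchange_big; apply: eq_bigr => h _ /=; rewrite (bigD1 (rcomp h f)) //= eqxx.
rewrite big1 ?addr0 => [|g]; last by rewrite eq_sym => /negPf->.
by rewrite actMz act_comp.
Qed.

Definition yoneda_hom L : module_hom (principal_sum (map tag L)) M :=
  @ModuleHom (principal_sum (map tag L)) M (@yoneda L) (@yonedaD L)
    (fun S T f x => @yoneda_act L S T f x).

Lemma yoneda0 L T : @yoneda L T 0 = 0.
Proof. by apply: (addrI (@yoneda L T 0)); rewrite -yonedaD !addr0. Qed.

Lemma yonedaB L T (x y : principal_sum (map tag L) T) : yoneda (x - y) = yoneda x - yoneda y.
Proof.
rewrite yonedaD; congr (_ + _); apply: (addrI (yoneda y)).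
by rewrite -yonedaD !subrr yoneda0.
Qed.

Lemma yoneda_spanned L T (x : M T) : spanned L x -> exists y, @yoneda L T y = x.
Proof.
elim=> [|p f pL|y z _ [y' <-] _ [z' <-]]; first by exists 0; apply: yoneda0.
  elim: L pL => //= q L IH [->|/IH[y yE]] /=; last first.
    by exists (0, y); rewrite yE big1 ?add0r // => g _; rewrite ffunE mulr0z.
  exists ([ffun g => (g == f)%:R], 0); rewrite yoneda0 addr0 (bigD1 f) //= ffunE eqxx mulr1z.
  by rewrite big1 ?addr0 // => g /negPf ne; rewrite ffunE ne mulr0z.
by exists (y' - z'); apply: yonedaB.
Qed.

Lemma fin_gen_spanned L : (forall T (x : M T), spanned L x) -> fin_gen M.
Proof.
move=> sp; exists (map tag L), (yoneda_hom L) => T x.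
by have [y yE] := yoneda_spanned (sp T x); exists y.
Qed.

End Spans.

Lemma spanned_hom (M N : rt_module) (h : forall T : rtree, M T -> N T)
    (hB : forall T, {morph h T : x y / x - y})
    (h_act : forall S T (f : rhom S T) x, h S (act M f x) = act N f (h T x)) L T (x : M T) :
  spanned L x -> spanned [seq existT _ (tag p) (h _ (tagged p)) | p <- L] (h T x).
Proof.
elim=> [|p f pL|y z _ sy _ sz].
- by rewrite -(subrr 0) hB subrr; apply: Spanned0.
- rewrite h_act; apply: (@SpannedG N _ T (existT _ (tag p) (h _ (tagged p))) f).
  by apply: (List.in_map (fun p : {T : rtree & M T} => existT _ (tag p) (h _ (tagged p))) _ _ pL).
- by rewrite hB; apply: SpannedB.
Qed.

Definition subfamily (M : rt_module) (K : forall T, M T -> Prop) : Prop :=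
  [/\ forall T, K T 0, forall T x y, K T x -> K T y -> K T (x - y)
    & forall S T (f : rhom S T) x, K T x -> K S (act M f x)].

Definition generated (M : rt_module) (K : forall T, M T -> Prop) L : Prop :=
  (forall p, List.In p L -> K (tag p) (tagged p)) /\ (forall T x, K T x -> spanned L x).

Definition noetherian (M : rt_module) : Prop :=
  forall K : forall T, M T -> Prop, subfamily K -> exists L, generated K L.

Lemma spanned_subfamily (M : rt_module) (K : forall T, M T -> Prop) L T (x : M T) :
  subfamily K -> (forall p, List.In p L -> K (tag p) (tagged p)) -> spanned L x -> K T x.
Proof.
case=> K0 KB Ka LK; elim=> [|p f pL|y z _ Ky _ Kz]; first exact: K0.
  exact/Ka/LK.
exact: KB.
Qed.

Lemma noetherian_zero : noetherian zero_module.
Proof.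
move=> K KP; exists [::]; split=> // T x _.
by have -> : x = 0; [apply/ffunP=> -[] | apply: Spanned0].
Qed.

(** The generators are those of the part of [K] inside [M], together with lifts to [K] of generators
    of its projection to [N]. *)
Lemma noetherian_dsum (M N : rt_module) : noetherian M -> noetherian N -> noetherian (dsum M N).
Proof.
move=> nM nN K [K0 KB Ka].
have in1B T : {morph (fun x : M T => (x, 0) : dsum M N T) : x y / x - y}.
  by move=> x y; congr pair; rewrite subr0.
have in1a S T (f : rhom S T) (x : M T) : (act M f x, 0) = act (dsum M N) f (x, 0).
  by rewrite /= /dsum_act /= act0.
have [|L1 [L1K L1s]] := nM (fun T x => K T (x, 0)).
  split=> [T|T x y Kx Ky|S T f x Kx]; first exact: K0.
    by rewrite in1B; apply: KB.
  by rewrite in1a; apply: Ka.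
have [|L2 [L2K L2s]] := nN (fun T y => exists x, K T (x, y)).
  split=> [T|T y y' [x Kx] [x' Kx']|S T f y [x Kx]]; first by exists 0; apply: K0.
    by exists (x - x'); apply: (KB _ (x, y) (x', y')).
  by exists (act M f x); apply: (Ka _ _ f (x, y)).
have [L2' [L2'K L2'E]] : exists L2' : seq {T & dsum M N T},
    (forall p, List.In p L2' -> K (tag p) (tagged p)) /\
    L2 = [seq existT _ (tag p) (tagged p).2 | p <- L2'].
  elim: L2 L2K {L2s} => [|[U y] L2 IH] L2K; first by exists [::].
  have [|L2' [L2'K ->]] := IH; first by move=> p pL; apply: L2K; right.
  have [x Kx] := L2K _ (or_introl erefl).
  by exists (existT _ U (x, y) :: L2'); split=> // p [<-|/L2'K].
exists ([seq existT _ (tag p) ((tagged p, 0) : dsum M N (tag p)) | p <- L1] ++ L2').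
split=> [p /List.in_app_iff[/List.in_map_iff[q [<- /L1K//]]|/L2'K//]|T [x y] Kxy].
have sy : spanned L2 y by apply: L2s; exists x.
have [x' sxy'] : exists x', spanned L2' ((x', y) : dsum M N T).
  rewrite L2'E in sy; elim: sy => [|p f /List.in_map_iff[q [qE qL]]|y1 y2 _ [x1 s1] _ [x2 s2]].
  - by exists 0; apply: Spanned0.
  - move: f; case: p / qE => f; exists (act M f (tagged q).1);
    apply: (@SpannedG (dsum M N) L2' T q f qL).
  - by exists (x1 - x2); apply: (SpannedB s1 s2).
have Kxy' : K T (x', y) by apply: spanned_subfamily L2'K sxy'.
have sx : spanned L1 (x - x').
  by apply: L1s; have := KB _ _ _ Kxy Kxy'; rewrite /GRing.add /=; congr K; congr pair;
    apply: subrr.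
have -> : (x, y) = ((x - x', 0) : dsum M N T) + (x', y) by congr pair; rewrite ?subrK ?add0r.
apply: spannedD; last by apply: spanned_sub sxy' => p pL; apply/List.in_app_iff; right.
have := @spanned_hom M (dsum M N) (fun T x => (x, 0)) in1B in1a _ _ _ sx.
by apply: spanned_sub => p pL; apply/List.in_app_iff; left.
Qed.

(** * Noetherianity of principal projectives *)

Definition dfs (T : rtree) : seq T := fverts (projT1 (cid (forest_of_rtree T))).
Definition tpos (T : rtree) (x : T) : nat := index x (dfs T).

Lemma dfs_uniq T : uniq (dfs T).
Proof. by rewrite /dfs; case: (cid _) => F [] /=. Qed.

Lemma mem_dfs (T : rtree) (x : T) : x \in dfs T.
Proof. by rewrite /dfs; case: (cid _) => F [] /=. Qed.

Lemma tpos_inj T : injective (@tpos T).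
Proof. by move=> x y; apply: (@index_inj _ x); rewrite ?mem_dfs. Qed.

Definition planar (S T : rtree) (f : rhom S T) : Prop :=
  subseq (map (top_of f) (dfs T)) (dfs S).

Lemma planar_tpos (S T : rtree) (f : rhom S T) x y : planar f ->
  (tpos (top_of f x) < tpos (top_of f y))%N = (tpos x < tpos y)%N.
Proof.
move=> fp; have mono u v : (tpos u < tpos v)%N -> (tpos (top_of f u) < tpos (top_of f v))%N.
  move=> uv; pose r := [rel a b : S | (index a (dfs S) < index b (dfs S))%N].
  have rt : transitive r by move=> b a c; apply: ltn_trans.
  have srt : sorted r (map (top_of f) (dfs T)).
    apply: (subseq_sorted rt fp); apply/(sortedP (root S)) => i ilt /=.
    by rewrite !index_uniq ?dfs_uniq // ltnW.
  have := sorted_ltn_nth rt (root S) srt (tpos u) (tpos v).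
  rewrite !inE size_map !index_mem !mem_dfs => /(_ isT isT uv).
  by rewrite !(nth_map (root T)) ?index_mem ?mem_dfs // !nth_index ?mem_dfs.
case: (ltngtP (tpos x) (tpos y)) => [/mono//|/mono/ltnW|/tpos_inj->]; last by rewrite ltnn.
by rewrite leqNgt => /negPf.
Qed.

Definition key (S T : rtree) (f : rhom T S) : seqlexi nat :=
  [seq tpos (top_of f s) | s <- enum S].

Lemma key_inj (S T : rtree) : injective (@key S T).
Proof.
move=> f g; rewrite /key => /eq_in_map fg; apply: rhom_eq_top => s.
by apply: tpos_inj; apply: fg; rewrite mem_enum.
Qed.

(** A planar [p] preserves and reflects the order of positions, so composing with it changes no
    entrywise comparison and therefore no lexicographic one. *)
Lemma key_lt (S T U : rtree) (f g : rhom T S) (p : rhom U T) : planar p ->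
  (key f < key g)%O -> (key (rcomp f p) < key (rcomp g p))%O.
Proof.
rewrite /key => pp; elim: (enum S) => //= s l IH.
rewrite !ltxi_cons !leEnat !top_of_comp => /andP[le /implyP lt].
have leE x y : (tpos (top_of p x) <= tpos (top_of p y))%N = (tpos x <= tpos y)%N.
  by rewrite leqNgt planar_tpos // -leqNgt.
by rewrite !leE le /=; apply/implyP=> ge; apply/IH/lt.
Qed.

Section PrincipalNoetherian.
Variable S : rtree.
Local Notation P := (principal S).

Definition leading (T : rtree) (x : P T) (f : rhom T S) : Prop :=
  (x : {ffun _ -> int}) f != 0 /\ forall g, (x : {ffun _ -> int}) g != 0 -> (key g <= key f)%O.

Definition coef (T : rtree) (x : P T) (f : rhom T S) : int := (x : {ffun rhom T S -> int}) f.

Lemma leading_exists T (x : P T) : x != 0 -> exists f, leading x f.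
Proof.
move=> x0; have [/existsP[f0 f0x]|no] := boolP [exists f, coef x f != 0]; last first.
  case/eqP: x0; apply/ffunP=> f; rewrite ffunE; apply/eqP; apply: contraNT no => fx.
  by apply/existsP; exists f.
case: (@arg_maxP _ _ _ f0 (fun f => coef x f != 0) (@key S T) f0x) => f fx fmax; by exists f.
Qed.

Lemma rcomp_inj (T U : rtree) (p : rhom U T) : injective (fun f : rhom T S => rcomp f p).
Proof.
move=> f g fg; apply: rhomP => x; rewrite -(top_ofK p x) -!rcompE.
exact: (congr1 (fun h : rhom U S => h (top_of p x)) fg).
Qed.

(** Since [p] is surjective, composing with it is injective, and no two coefficients are merged. *)
Lemma coef_act (T U : rtree) (p : rhom U T) (x : P T) f : coef (act P p x) (rcomp f p) = coef x f.
Proof.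
rewrite /coef ffunE (big_pred1 f) // => g /=; apply/eqP/eqP => [|->//].
exact: rcomp_inj.
Qed.

Lemma coef_act0 (T U : rtree) (p : rhom U T) (x : P T) g : coef (act P p x) g != 0 ->
  exists2 f, coef x f != 0 & g = rcomp f p.
Proof.
rewrite /coef ffunE => ne; have [/existsP[f /andP[/eqP fg fx]]|no] :=
    boolP [exists f, (rcomp f p == g) && (coef x f != 0)]; first by exists f.
case/eqP: ne; rewrite big1 // => f fg; apply/eqP; apply: contraNT no => fx.
by apply/existsP; exists f; rewrite fg.
Qed.

Lemma leading_act (T U : rtree) (p : rhom U T) (x : P T) f : planar p ->
  leading x f -> leading (act P p x) (rcomp f p).
Proof.
move=> pp [fx fmax]; split; first by rewrite [X in X != 0]coef_act.
move=> g /coef_act0[h hx ->]; have := fmax h hx; rewrite le_eqVlt => /orP[/eqP/key_inj->//|].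
by move/(key_lt pp)/ltW.
Qed.

(** The forest of [T] labelled in the finite set [option S] encodes [f], because a contraction is
    determined by its fibre tops. *)
Definition mark (T : rtree) (f : rhom T S) (t : T) : option S :=
  if top_of f (f t) == t then Some (f t) else None.

Lemma mark_top T (f : rhom T S) s : mark f (top_of f s) = Some s.
Proof. by rewrite /mark top_ofK eqxx. Qed.

Lemma mark_some T (f : rhom T S) t s : mark f t = Some s -> t = top_of f s.
Proof. by rewrite /mark; case: eqP => // E [<-]. Qed.

(** Equal marks send tops to tops. This yields the factorization and, the root being the top of its
    own fibre, also the preservation of the root required by [rhom_of]. *)
Lemma marked_embedding (T U : rtree) (f : rhom T S) (f' : rhom U S) :
  femb eq (fmap (mark f) (projT1 (cid (forest_of_rtree T))))
          (fmap (mark f') (projT1 (cid (forest_of_rtree U)))) ->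
  exists2 p : rhom U T, planar p & f' = rcomp f p.
Proof.
move=> /femb_fmap /(femb_extract (root U)) /(_ (dfs_uniq T) (dfs_uniq U))[g [gm gs gb]].
have {}gm x : mark f x = mark f' (g x) by apply: gm; apply: mem_dfs.
have g_tle x y : tle (g x) (g y) = tle x y.
  move: (gb x y (mem_dfs x) (mem_dfs y)).
  by case: (cid (forest_of_rtree T)) (cid (forest_of_rtree U)) => F [_ _ Fb] [F' [_ _ Fb']] /=;
    rewrite Fb Fb'.
have g_top s : g (top_of f s) = top_of f' s.
  by apply: mark_some; rewrite -gm mark_top.
have g_root : g (root T) = root U by rewrite -(top_of_root f) g_top top_of_root.
exists (rhom_of g_tle g_root).
  rewrite /planar; suff -> : map (top_of (rhom_of g_tle g_root)) (dfs T) = map g (dfs T) by [].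
  by apply: eq_map => x; apply: top_of_rhom_of.
by apply: rhom_eq_top => s; rewrite top_of_comp top_of_rhom_of g_top.
Qed.

Variable K : forall T, P T -> Prop.
Hypothesis KP : subfamily K.

Record datum := Datum { dtree : rtree; delt : P dtree; dlead : rhom dtree S }.

(* An element of [K] outside the span of [L] with least leading term and, among those,
   least absolute value of the leading coefficient. *)
Definition minimal_datum (L : seq {T : rtree & P T}) (a : datum) : Prop :=
  [/\ K (delt a) /\ ~ spanned L (delt a), leading (delt a) (dlead a),
      forall y : P (dtree a), K y -> (forall g, coef y g != 0 -> (key g < key (dlead a))%O) ->
        spanned L y
    & forall y : P (dtree a), K y -> leading y (dlead a) ->
       (`|coef y (dlead a)| < `|coef (delt a) (dlead a)|)%N -> spanned L y].

Lemma minimal_datum_exists L : ~ (forall T (x : P T), K x -> spanned L x) ->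
  exists a, minimal_datum L a.
Proof.
move=> /existsNP[T /existsNP[x0 /not_implyP[Kx0 sx0]]].
(* The rank converts the finite order of keys into natural numbers, so that minimization can choose
   first the least leading term and then the least coefficient. *)
pose rk (f : rhom T S) := #|[pred g : rhom T S | (key g < key f)%O]|.
have rk_lt (f g : rhom T S) : (key f < key g)%O -> (rk f < rk g)%N.
  move=> fg; apply: proper_card; apply/properP; split.
    by apply/subsetP=> h; rewrite !inE => hf; apply: lt_trans hf fg.
  by exists f; rewrite !inE ?ltxx.
pose bad (x : P T) f := [/\ K x, ~ spanned L x & leading x f].
have lead_bad x : K x -> ~ spanned L x -> exists f, bad x f.
  move=> Kx sx; have [|f fx] := @leading_exists T x; last by exists f.
  by apply: contra_not_neq sx => ->; apply: Spanned0.
have ex1 : exists n, `[< exists x f, bad x f /\ rk f = n >].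
  have [f fx] := lead_bad _ Kx0 sx0; exists (rk f); apply/asboolP; by exists x0, f.
case: (ex_minnP ex1) => n /asboolP[x1 [f [bx1 rf]]] nmin.
have ex2 : exists m, `[< exists2 x, bad x f & `|coef x f|%N = m >].
  by exists `|coef x1 f|%N; apply/asboolP; exists x1.
case: (ex_minnP ex2) => m /asboolP[x [Kx sx fx] xm] mmin.
exists (Datum x f); split=> //= [y Ky yf|y Ky yf ym].
  apply: contrapT => sy; have [g yg] := lead_bad _ Ky sy.
  have /yf/rk_lt : coef y g != 0 by case: yg => _ _ [].
  by rewrite rf ltnNge nmin //; apply/asboolP; exists y, g.
apply: contrapT => sy; move: ym; rewrite xm ltnNge => /negP[].
by apply: mmin; apply/asboolP; exists y.
Qed.

(** Transported along [p], the earlier element has the leading term of [delt b]. Euclidean division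
    leaves a remainder in [K] with a smaller leading term or a smaller leading coefficient, hence
    spanned by minimality of [b]; then [delt b] would be spanned too. *)
Lemma reduce_datum L (a b : datum) (p : rhom (dtree b) (dtree a)) : minimal_datum L b ->
  List.In (existT _ (dtree a) (delt a)) L -> K (delt a) -> leading (delt a) (dlead a) -> planar p ->
  dlead b = rcomp (dlead a) p ->
  (`|coef (delt a) (dlead a)| <= `|coef (delt b) (dlead b)|)%N -> False.
Proof.
case: KP => K0 KB Ka [[Kb sb] bl b1 b2] aL Ka' al pp be cab.
set y := act P p (delt a); set c := coef (delt a) (dlead a); set d := coef (delt b) (dlead b).
have yl : leading y (dlead b) by rewrite be; apply: leading_act.
have yc : coef y (dlead b) = c by rewrite be coef_act.
have c0 : c != 0 by case: al.
have sy : spanned L y by apply: (@SpannedG P L _ (existT _ (dtree a) (delt a)) p aL).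
have Ky : K y by apply: Ka.
have KMn k : K (y *+ k).
  elim: k => [|k IH]; first exact: K0.
  by rewrite mulrS -[y *+ k]opprK; apply: (KB) => //; rewrite -sub0r; apply: (KB).
pose q := (d %/ c)%Z; pose z := delt b - y *~ q.
have Kz : K z.
  apply: (KB) => //; case: (q) => k; first exact: KMn.
  by rewrite NegzE mulrNz -sub0r; apply: (KB); [exact: (K0) | exact: KMn].
have coefD (u v : P (dtree b)) g : coef (u + v) g = coef u g + coef v g by rewrite /coef ffunE.
have coefN (u : P (dtree b)) g : coef (- u) g = - coef u g by rewrite /coef ffunE.
have coefMz (u : P (dtree b)) k g : coef (u *~ k) g = coef u g * k.
  have Mn m : coef (u *+ m) g = coef u g * m%:Z.
    elim: m => [|m IH]; first by rewrite mulr0n mulr0 /coef ffunE.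
    by rewrite mulrS coefD IH intS mulrDr mulr1.
  case: k => m; first exact: Mn.
  by rewrite NegzE mulrNz coefN mulrN -Mn.
have zE g : coef z g = coef (delt b) g - coef y g * q.
  by rewrite coefD coefN coefMz.
have zlead : coef z (dlead b) = (d %% c)%Z by rewrite zE yc /modz mulrC.
have zmax g : coef z g != 0 -> (key g <= key (dlead b))%O.
  rewrite zE => ne; have [bg|/bl.2//] := eqVneq (coef (delt b) g) 0.
  have [yg|/yl.2//] := eqVneq (coef y g) 0.
  by rewrite bg yg mul0r subrr eqxx in ne.
apply: sb; rewrite -[delt b](subrK (y *~ q)); apply: spannedD; last exact: spannedMz.
have [r0|r0] := eqVneq (d %% c)%Z 0.
  apply: b1 => // g gz; have := zmax g gz; rewrite le_eqVlt => /orP[/eqP/key_inj gE|//].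
  by move: gz; rewrite gE zlead r0 eqxx.
apply: b2 => //; first by split=> //; rewrite [X in X != 0]zlead.
apply: leq_trans cab; rewrite zlead -ltz_nat gez0_abs ?modz_ge0 // abszE.
exact: ltz_mod.
Qed.

(** Otherwise minimal elements outside the span of the earlier ones can be added forever. Two of
    them, an earlier and a later one, have embedded marked forests and leading coefficients of
    nondecreasing absolute value, which [reduce_datum] excludes. *)
Lemma principal_generated : exists L, generated K L.
Proof.
apply: contrapT => /forallNP noL.
pose ok (L : seq {T : rtree & P T}) := forall p, List.In p L -> K (tagged p).
have step (L : {L | ok L}) : exists a, minimal_datum (sval L) a.
  by apply: minimal_datum_exists => sp; apply: (noL (sval L)); split=> //; exact: (svalP L).
have [pick pickP] := choice step.
have ext_ok (L : {L | ok L}) : ok (existT _ (dtree (pick L)) (delt (pick L)) :: sval L).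
  by move=> p [<-|/(svalP L)//]; case: (pickP L) => -[].
pose Ls := fix Ls n : {L | ok L} := if n is m.+1 then exist _ _ (ext_ok (Ls m))
  else exist ok [::] (fun p (h : List.In p [::]) => match h with end).
pose a n := pick (Ls n).
have aP n : minimal_datum (sval (Ls n)) (a n) by apply: pickP.
have aL i j : (i < j)%N -> List.In (existT _ (dtree (a i)) (delt (a i))) (sval (Ls j)).
  elim: j => // j IH; rewrite ltnS leq_eqVlt => /orP[/eqP->|/IH ij]; first by left.
  by right.
have eq_trans' (x y z : option S) : x = y -> y = z -> x = z by move=> ->.
have [p [pi pE]] := femb_wqo eq_trans' (@wqo_eq _)
  (fun n => fmap (mark (dlead (a n))) (projT1 (cid (forest_of_rtree (dtree (a n)))))).
have [q [qi qE]] := wqo_leq (fun n => `|coef (delt (a (p n))) (dlead (a (p n)))|%N).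
have q01 := qi 0%N 1%N isT.
have [g gp gE] := marked_embedding (pE _ _ q01).
have [[Ka _] al _ _] := aP (p (q 0%N)).
exact: (reduce_datum (aP (p (q 1%N))) (aL _ _ (pi _ _ q01)) Ka al gp gE (qE 0%N 1%N isT)).
Qed.

End PrincipalNoetherian.

Lemma noetherian_principal S : noetherian (principal S).
Proof. by move=> K KP; apply: principal_generated. Qed.

Lemma noetherian_principal_sum Ts : noetherian (principal_sum Ts).
Proof.
elim: Ts => [|T Ts IH] /=; first exact: noetherian_zero.
exact: (@noetherian_dsum (principal T) (principal_sum Ts) (@noetherian_principal T) IH).
Qed.

(** * The module structure on homology *)

Section Homology.
Variables (G : graph) (i n : nat).
Implicit Types z : cycle_type G i n.

Lemma hclass_eq z z' : is_boundary i n (cycle_val (z - z')) -> hclass z = hclass z'.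
Proof. by move=> zz'; apply/eqmodP/asboolP. Qed.

Lemma hclass_boundary z z' : hclass z = hclass z' -> is_boundary i n (cycle_val (z - z')).
Proof. by move=> /eqmodP/asboolP. Qed.

Lemma hclassD z z' : hclass (z + z') = hclass z + hclass z'.
Proof. exact: Quotient.pi_add. Qed.

Lemma hclassB z z' : hclass (z - z') = hclass z - hclass z'.
Proof. by rewrite -[hclass (z - z')](addrK (hclass z')) -hclassD subrK. Qed.

Lemma hclass_surj (x : homology G i n) : exists z, hclass z = x.
Proof. by exists (repr x); apply: reprK. Qed.

Lemma cycle_valB z z' : cycle_val (z - z') = cycle_val z - cycle_val z'.
Proof. by []. Qed.

Lemma cycle_valD z z' : cycle_val (z + z') = cycle_val z + cycle_val z'.
Proof. by []. Qed.

Lemma cycle_of (x : ext G) : is_cycle i n x -> exists z, cycle_val z = x.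
Proof.
move=> xc; have xP : x \in cycle_pred i n by apply/asboolP.
by exists (Cycle xP).
Qed.

Lemma cycleP z : is_cycle i n (cycle_val z).
Proof. by case: z => x /= /asboolP. Qed.

End Homology.

Section Bidegree.
Variable G : graph.
Implicit Types (x y : ext G) (p : edge_ring G) (A : {set halfedge G}).

Lemma bidegreeD i n x y : bidegree i n x -> bidegree i n y -> bidegree i n (x + y).
Proof.
move=> bx by_; rewrite -[y]opprK; apply: bidegreeB => //.
rewrite -sub0r; apply: bidegreeB => //; exact: bidegree0.
Qed.

Lemma bidegree_sum i n (I : Type) (r : seq I) (P : pred I) (F : I -> ext G) :
  (forall j, P j -> bidegree i n (F j)) -> bidegree i n (\sum_(j <- r | P j) F j).
Proof.
by move=> FP; elim/big_ind: _ => //; [apply: bidegree0 | move=> x y; apply: bidegreeD].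
Qed.

Lemma bidegree_scale i n d p x : (p : {mpoly int[#|edge G|]}) \is d.-homog ->
  bidegree i n x -> bidegree i (d + n) (p *: x).
Proof.
move=> /dhomogP pd xP A m; rewrite extZE -mcoeff_msupp =>
  /msuppM_le/allpairsP[[m1 m2] /= [m1p m2x ->]].
rewrite mcoeff_msupp in m2x; have [-> <-] := xP _ _ m2x.
by rewrite mdegD addnA; have := pd _ m1p; rewrite /= => ->.
Qed.

Lemma bidegree_gen i n h x : bidegree i n x -> bidegree i.+1 n.+1 (emul (gen h) x).
Proof.
move=> xP A m; rewrite genM_coef; case: ifP => [hA|_]; last by rewrite mcoeff0 eqxx.
have [e ->] : exists e : int, (-1) ^+ inversions [set h] (A :\ h) = e%:MP :> edge_ring G.
  by exists ((-1) ^+ inversions [set h] (A :\ h)); rewrite rmorphXn rmorphN1.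
rewrite mcoeffCM => ne; have ne' : (x (A :\ h) : edge_ring G)@_m != 0.
  by apply: contraNneq ne => ->; rewrite mulr0.
by have [Ai mn] := xP _ _ ne'; rewrite (cardsD1 h) hA Ai addnS mn.
Qed.

Lemma bidegree1 : bidegree 0 0 (eone G).
Proof.
move=> A m; rewrite ffunE; case: (A =P set0) => [->|_]; last by rewrite mcoeff0 eqxx.
rewrite mcoeff1; case: (m =P 0%MM) => [->|_]; last by rewrite eqxx.
by rewrite cards0 mdeg0.
Qed.

Lemma int_homog (c : int) : (c%:~R : {mpoly int[#|edge G|]}) \is 0%N.-homog.
Proof. exact/rpredMz/dhomog1. Qed.

Lemma evar_homog (e : edge G) : (evar e : {mpoly int[#|edge G|]}) \is 1%N.-homog.
Proof. by rewrite dhomogX /= mdeg1. Qed.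

End Bidegree.

Lemma edge_map_homog (G G' : graph) (r : edge G -> edge G') (p : edge_ring G) d :
  (p : {mpoly int[#|edge G|]}) \is d.-homog ->
  (edge_map r p : {mpoly int[#|edge G'|]}) \is d.-homog.
Proof.
move=> /dhomogP pd; rewrite /edge_map /mmap big_seq.
apply: (big_ind (fun q : {mpoly int[#|edge G'|]} => q \is d.-homog)).
- exact: dhomog0.
- by move=> x y; apply: dhomogD.
move=> m mp; rewrite -(pd m mp) /= -[mdeg m]add0n; apply: dhomogM; first exact: int_homog.
rewrite mdegE; apply: (big_ind2 (fun (q : {mpoly int[#|edge G'|]}) e => q \is e.-homog)).
- exact: dhomog1.
- by move=> x e y e'; apply: dhomogM.
by move=> l _; rewrite -[X in X.-homog]mul1n; apply/dhomogMn/evar_homog.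
Qed.

(** The matrix entries are integers, of polynomial degree 0, and each generator goes to a
    combination of generators. *)
Lemma graph_algmap_bidegree (G G' : graph) (r : edge G -> edge G') M phi i n x :
  @graph_algmap G G' (edge_map r) M phi -> bidegree i n x -> bidegree i n (phi x).
Proof.
move=> aM xP; have -> : phi x = \sum_A edge_map r (x A) *: phi (ebas A).
  rewrite {1}(ext_decomp x); apply: etrans (algmap_sum aM _ _ _) _; apply: eq_bigr => A _.
  exact: (algmapZ aM).
have bas (A : {set halfedge G}) : bidegree #|A| #|A| (phi (ebas A)).
  elim/minset_ind: A => [|h A hA IH].
    by rewrite cards0; have := algmap1 aM => /= ->; apply: bidegree1.
  have -> : phi (ebas (h |: A)) = \sum_k (M h k)%:~R *: emul (gen k) (phi (ebas A)).
    rewrite -(gen_bas hA); apply: etrans (algmap_gen aM _ _) _.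
    apply: etrans (xmul_suml _ _ _ _) _; apply: eq_bigr => k _; exact: (xmulZl (e := graph_ext G')).
  have -> : #|h |: A| = #|A|.+1.
    by rewrite cardsU1; case: (boolP (h \in A)) => // /hA; rewrite ltnn.
  apply: bidegree_sum => k _; rewrite -[X in bidegree _ X]add0n.
  apply: bidegree_scale; [exact: int_homog | exact: bidegree_gen].
apply: bidegree_sum => A _.
have [->|xA] := eqVneq (x A) 0; first by rewrite rmorph0 scale0r; apply: bidegree0.
have : exists m, m \in msupp (x A : {mpoly int[#|edge G|]}).
  case E: (msupp (x A : {mpoly int[#|edge G|]})) => [|m s]; last by exists m; rewrite mem_head.
  by move/eqP: E; rewrite msupp_eq0 (negPf xA).
case=> m; rewrite mcoeff_msupp => /(xP A)[Ai mn].
have -> : n = (mdeg m + #|A|)%N by rewrite Ai.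
rewrite -{1}Ai; apply: bidegree_scale; last exact: bas.
apply: edge_map_homog; apply/dhomogP => m'; rewrite mcoeff_msupp => /(xP A)[_ mn'].
by apply: (@addIn i); rewrite /= mn mn'.
Qed.

Lemma reduced_xred (G : graph) (x : ext G) :
  reduced x <-> xred (E := graph_ext G) (@hvert G) x.
Proof. by []. Qed.

Section ConeMap.
Variables (S T : rtree) (f : rhom S T) (r : edge (cone T) -> edge (cone S)).
Variables (M : halfedge (cone T) -> halfedge (cone S) -> int) (phi : ext (cone T) -> ext (cone S)).
Hypothesis phiP : cone_map f r M phi.
Variables (i n : nat).

Lemma cone_map_reduced x : reduced x -> reduced (phi x).
Proof.
case: phiP => _ tM aM xr; apply/reduced_xred.
apply: (algmap_red aM (vm := omap f)) xr => [h k y hk|h l]; last exact: (tr_loc tM).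
by rewrite sumrB; have [s sP] := tr_vert tM; rewrite !sP hk subrr.
Qed.

Lemma cone_map_chain x : reduced x -> phi (differential x) = differential (phi x).
Proof.
case: phiP => _ tM aM; apply: (algmap_chain aM (w := fun h => evar (hedge h))
  (w' := fun h => evar (hedge h))).
- exact: differentialD.
- exact: differentialZ.
- exact: differential1.
- exact: differential_gen.
- exact: differentialD.
- exact: differentialZ.
- exact: differential1.
- exact: differential_gen.
(* Group the half-edges by their edge: the sums over an edge are prescribed up to a correction, and
   the corrections of [h] and [k] coincide as these share a vertex. *)
move=> h k hk; rewrite (partition_big (@hedge (cone S)) xpredT) //=.
have [t tP] := tr_edge tM.
have E e : \sum_(l | hedge l == e) (M h l - M k l)%:~R * evar (hedge l) =
    ((e == r (hedge h))%:R - (e == r (hedge k))%:R) * evar e :> edge_ring (cone S).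
  rewrite (eq_bigr (fun l => (M h l - M k l)%:~R * evar e)); last by move=> l /eqP->.
  rewrite -mulr_suml -rmorph_sum sumrB !tP hk /= opprD addrACA subrr addr0 rmorphB.
  by rewrite !rmorph_nat.
under eq_bigr do rewrite E mulrBl.
rewrite sumrB !edge_map_evar; congr (_ - _).
  rewrite (bigD1 (r (hedge h))) //= eqxx mul1r big1 ?addr0 // => e /negPf->; exact: mul0r.
rewrite (bigD1 (r (hedge k))) //= eqxx mul1r big1 ?addr0 // => e /negPf->; exact: mul0r.
Qed.

Lemma cone_map_cycle x : is_cycle i n x -> is_cycle i n (phi x).
Proof.
case=> xr xb xd; split; first exact: cone_map_reduced.
  by case: phiP => _ _ aM; apply: graph_algmap_bidegree aM xb.
rewrite -cone_map_chain // xd; case: phiP => _ _ aM; exact: (algmap0 aM).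
Qed.

Lemma cone_map_boundary x : is_boundary i n x -> is_boundary i n (phi x).
Proof.
case=> y [yr yb yx]; exists (phi y); split; first exact: cone_map_reduced.
  by case: phiP => _ _ aM; apply: graph_algmap_bidegree aM yb.
by rewrite -cone_map_chain // yx.
Qed.

End ConeMap.

Section ChainMaps.

Lemma chain_map_exists (S T : rtree) (f : rhom S T) :
  exists phi : ext (cone T) -> ext (cone S), exists c j,
    [/\ factors_pi (f := f) c, is_iota (f := f) j & phi = fact_pull c \o emb_push j].
Proof.
have [c [j [cP jP]]] := cone_map_exists f.
by exists (fact_pull c \o emb_push j), c, j.
Qed.

(** One factorization and one embedding are chosen; by [chain_map_fact] the choice is invisible on
    reduced chains. *)
Definition chain_map (S T : rtree) (f : rhom S T) : ext (cone T) -> ext (cone S) :=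
  projT1 (cid (chain_map_exists f)).

Lemma chain_mapP (S T : rtree) (f : rhom S T) : exists r M, cone_map f r M (chain_map f).
Proof.
rewrite /chain_map; case: (cid _) => phi /= [c [j [cP jP ->]]].
exact: cone_map_fact.
Qed.

Lemma chain_map_fact (S T : rtree) (f : rhom S T) c j x :
  factors_pi (f := f) c -> is_iota (f := f) j -> reduced x ->
  fact_pull c (emb_push j x) = chain_map f x.
Proof.
move=> cP jP xr; have [r [M p1]] := cone_map_fact cP jP; have [r' [M' p2]] := chain_mapP f.
exact: (cone_map_agree p1 p2 xr).
Qed.

Lemma chain_map_id T x : reduced x -> chain_map (rid T) x = x.
Proof.
move=> xr; have [r [M p1]] := cone_map_id T; have [r' [M' p2]] := chain_mapP (rid T).
exact: (cone_map_agree p2 p1 xr).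
Qed.

Lemma chain_map_comp (S T U : rtree) (g : rhom T U) (f : rhom S T) x : reduced x ->
  chain_map (rcomp g f) x = chain_map f (chain_map g x).
Proof.
move=> xr; have [r [M p1]] := chain_mapP f; have [r' [M' p2]] := chain_mapP g.
have [r'' [M'' p3]] := cone_map_comp p1 p2; have [r3 [M3 p4]] := chain_mapP (rcomp g f).
exact: (cone_map_agree p4 p3 xr).
Qed.

Lemma chain_mapB (S T : rtree) (f : rhom S T) : {morph chain_map f : x y / x - y}.
Proof. by have [r [M [_ _ aM]]] := chain_mapP f; apply: (algmapB aM). Qed.

Lemma chain_mapD (S T : rtree) (f : rhom S T) : {morph chain_map f : x y / x + y}.
Proof. by have [r [M [_ _ aM]]] := chain_mapP f; apply: (algmapD aM). Qed.

Lemma chain_map_reduced (S T : rtree) (f : rhom S T) x : reduced x -> reduced (chain_map f x).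
Proof. by have [r [M p]] := chain_mapP f; apply: (cone_map_reduced p). Qed.

End ChainMaps.

Section HomologyModule.
Variables n i : nat.
Local Notation H T := (homology (cone T) i n).

Lemma chain_map_cycle (S T : rtree) (f : rhom S T) (z : cycle_type (cone T) i n) :
  exists z' : cycle_type (cone S) i n, cycle_val z' = chain_map f (cycle_val z).
Proof.
have [r [M p]] := chain_mapP f; exact: (cycle_of (cone_map_cycle p (cycleP z))).
Qed.

Definition cycle_map (S T : rtree) (f : rhom S T) z : cycle_type (cone S) i n :=
  projT1 (cid (chain_map_cycle f z)).

Lemma cycle_mapE (S T : rtree) (f : rhom S T) z :
  cycle_val (cycle_map f z) = chain_map f (cycle_val z).
Proof. by rewrite /cycle_map; case: (cid _). Qed.

Definition hact (S T : rtree) (f : rhom S T) (x : H T) : H S :=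
  hclass (cycle_map f (projT1 (cid (hclass_surj x)))).

(** Two representatives of a class differ by a boundary, and the chain map sends boundaries to
    boundaries. *)
Lemma hact_class (S T : rtree) (f : rhom S T) (z : cycle_type (cone T) i n) z' :
  cycle_val z' = chain_map f (cycle_val z) -> hact f (hclass z) = hclass z'.
Proof.
move=> zz'; rewrite /hact; case: (cid _) => w /= wz; apply: hclass_eq.
rewrite cycle_valB cycle_mapE zz' -chain_mapB.
have [r [M p]] := chain_mapP f; apply: (cone_map_boundary p).
by rewrite -cycle_valB; apply: hclass_boundary.
Qed.

Lemma hactD (S T : rtree) (f : rhom S T) : {morph hact f : x y / x + y}.
Proof.
move=> x y; have [z <-] := hclass_surj x; have [w <-] := hclass_surj y.
rewrite -hclassD (hact_class (cycle_mapE f z)) (hact_class (cycle_mapE f w)) -hclassD.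
by apply: hact_class; rewrite !cycle_valD !cycle_mapE chain_mapD.
Qed.

Lemma cycle_reduced (G : graph) (z : cycle_type G i n) : reduced (cycle_val z).
Proof. by case: (cycleP z). Qed.

Lemma hact_id T : hact (rid T) =1 id.
Proof.
move=> x; have [z <-] := hclass_surj x.
by apply: hact_class; rewrite chain_map_id //; apply: cycle_reduced.
Qed.

Lemma hact_comp (S T U : rtree) (g : rhom T U) (f : rhom S T) :
  hact (rcomp g f) =1 hact f \o hact g.
Proof.
move=> x /=; have [z <-] := hclass_surj x.
rewrite (hact_class (cycle_mapE g z)) (hact_class (cycle_mapE f _)); apply: hact_class.
by rewrite !cycle_mapE chain_map_comp //; apply: cycle_reduced.
Qed.

Definition homology_module : module_on (fun T : rtree => H T) :=
  @ModuleOn (fun T : rtree => H T) hact hactD hact_id hact_comp.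

Lemma homology_structure_map (S T : rtree) (f : rhom S T) :
  is_structure_map f (act homology_module f).
Proof.
split; first exact: cone_map_exists.
move=> c j cP jP z; exists (cycle_map f z); last exact: hact_class (cycle_mapE f z).
by rewrite cycle_mapE /= chain_map_fact //; apply: cycle_reduced.
Qed.

End HomologyModule.

(** * The module of reduced chains and submodules cut out by predicates *)

Section ReducedChains.
Variable G : graph.

Definition reduced_pred : {pred ext G} := [pred x | `[< reduced x >]].

Fact reduced_zmod_closed : zmod_closed reduced_pred.
Proof.
split=> [|x y /asboolP rx /asboolP ry]; apply/asboolP; first exact: reduced0.
exact: reducedB.
Qed.
HB.instance Definition _ := GRing.isZmodClosed.Build (ext G) reduced_pred reduced_zmod_closed.

Record reduced_type := Reduced { reduced_val : ext G; _ : reduced_val \in reduced_pred }.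
HB.instance Definition _ := [isSub for reduced_val].
HB.instance Definition _ := [Choice of reduced_type by <:].
HB.instance Definition _ := [SubChoice_isSubZmodule of reduced_type by <:].

Lemma reduced_valP (x : reduced_type) : reduced (reduced_val x).
Proof. by case: x => y /= /asboolP. Qed.

Lemma reduced_valB (x y : reduced_type) : reduced_val (x - y) = reduced_val x - reduced_val y.
Proof. by []. Qed.

Lemma reduced_valD (x y : reduced_type) : reduced_val (x + y) = reduced_val x + reduced_val y.
Proof. by []. Qed.

Lemma reduced_val_inj : injective reduced_val.
Proof. exact: val_inj. Qed.

End ReducedChains.

Fact chain_act_subproof (S T : rtree) (f : rhom S T) (x : reduced_type (cone T)) :
  chain_map f (reduced_val x) \in @reduced_pred (cone S).
Proof. by apply/asboolP/chain_map_reduced/reduced_valP. Qed.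

Definition chain_act (S T : rtree) (f : rhom S T) (x : reduced_type (cone T)) :
  reduced_type (cone S) := Reduced (chain_act_subproof f x).

Fact chain_actD S T (f : rhom S T) : {morph chain_act f : x y / x + y}.
Proof. by move=> x y; apply: reduced_val_inj; rewrite /= chain_mapD. Qed.

Fact chain_act_id T : chain_act (rid T) =1 id.
Proof. by move=> x; apply: reduced_val_inj; rewrite /= chain_map_id //; apply: reduced_valP. Qed.

Fact chain_act_comp S T U (g : rhom T U) (f : rhom S T) :
  chain_act (rcomp g f) =1 chain_act f \o chain_act g.
Proof. by move=> x; apply: reduced_val_inj; rewrite /= chain_map_comp //; apply: reduced_valP. Qed.

(** All bidegrees are kept together; a bidegree is imposed only on the elements to be generated. *)
Definition chains : rt_module := RTModule
  (@ModuleOn (fun T : rtree => reduced_type (cone T)) chain_act chain_actD chain_act_id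
    chain_act_comp).

Section Submodule.
Variables (M : rt_module) (K : forall T, M T -> Prop).
Hypothesis KP : subfamily K.

Definition sub_pred (T : rtree) : {pred M T} := [pred x | `[< K x >]].

Fact sub_zmod_closed T : zmod_closed (@sub_pred T).
Proof.
case: KP => K0 KB _; split=> [|x y /asboolP Kx /asboolP Ky]; apply/asboolP; first exact: (K0).
exact: (KB).
Qed.
HB.instance Definition _ T :=
  GRing.isZmodClosed.Build (M T) (@sub_pred T) (@sub_zmod_closed T).

Record sub_type (T : rtree) := SubElt { sub_val : M T; _ : sub_val \in @sub_pred T }.
HB.instance Definition _ T := [isSub for @sub_val T].
HB.instance Definition _ T := [Choice of sub_type T by <:].
HB.instance Definition _ T := [SubChoice_isSubZmodule of sub_type T by <:].

Definition sub_obj (T : rtree) : zmodType := sub_type T.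

Lemma sub_valP T (x : sub_obj T) : K (sub_val x).
Proof. by case: x => y /= /asboolP. Qed.

Fact sub_act_subproof (S T : rtree) (f : rhom S T) (x : sub_obj T) :
  act M f (sub_val x) \in @sub_pred S.
Proof. by case: KP => _ _ Ka; apply/asboolP/Ka/sub_valP. Qed.

Definition sub_act (S T : rtree) (f : rhom S T) (x : sub_obj T) : sub_obj S :=
  SubElt (sub_act_subproof f x).

Fact sub_actD S T (f : rhom S T) : {morph sub_act f : x y / x + y}.
Proof. by move=> x y; apply: val_inj; rewrite /= actD. Qed.

Fact sub_act_id T : sub_act (rid T) =1 id.
Proof. by move=> x; apply: val_inj; rewrite /= act_id. Qed.

Fact sub_act_comp S T U (g : rhom T U) (f : rhom S T) :
  sub_act (rcomp g f) =1 sub_act f \o sub_act g.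
Proof. by move=> x; apply: val_inj; rewrite /= act_comp. Qed.

Definition submodule : rt_module := RTModule (ModuleOn sub_actD sub_act_id sub_act_comp).

Fact sub_elt_subproof T (x : M T) : K x -> x \in @sub_pred T.
Proof. by move=> Kx; apply/asboolP. Qed.
Definition sub_elt T (x : M T) (Kx : K x) : submodule T := SubElt (sub_elt_subproof Kx).

Lemma sub_val_inj T : injective (@sub_val T).
Proof. exact: val_inj. Qed.

Lemma sub_valB T (x y : submodule T) : sub_val (x - y) = sub_val x - sub_val y.
Proof. by []. Qed.

Lemma sub_valD T (x y : submodule T) : sub_val (x + y) = sub_val x + sub_val y.
Proof. by []. Qed.

Definition sub_inclusion : module_hom submodule M :=
  @ModuleHom submodule M (fun T x => sub_val x) sub_valD (fun S T f x => erefl).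

Lemma submodule_spanned L : generated K L ->
  exists L', forall T (x : submodule T), spanned L' x.
Proof.
case=> LK Ls; have [L' LE] : exists L' : seq {T & submodule T},
    L = [seq existT _ (tag p) (sub_val (tagged p)) | p <- L'].
  elim: L LK {Ls} => [|[U m] L IH] LK; first by exists [::].
  have [|L' ->] := IH; first by move=> p pL; apply: LK; right.
  exists (existT _ U (sub_elt (LK _ (or_introl erefl))) :: L').
  by [].
exists L' => T x; have [y xy sy] : exists2 y : submodule T, sub_val y = sub_val x & spanned L' y.
  have := Ls T _ (sub_valP x); rewrite LE.
  elim=> [|p f /List.in_map_iff[q [qE qL]]|y1 y2 _ [z1 <- s1] _ [z2 <- s2]].
  - by exists 0 => //; apply: Spanned0.
  - move: f; case: p / qE => f; exists (act submodule f (tagged q)) => //.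
    exact: SpannedG.
  - by exists (z1 - z2) => //; apply: SpannedB.
by rewrite -(sub_val_inj xy).
Qed.

End Submodule.

(** * Generation of the reduced chains in bounded degree *)

Section Terms.
Variables (R : comNzRingType) (H : finType) (E : exterior R H) (V : finType) (hv : H -> V).
Variable b : V -> H.
Hypothesis hvb : forall v, hv (b v) = v.

Definition xterm (hs : seq H) : E :=
  foldr (fun h x => xmul (xgen h - xgen (b (hv h))) x) xone hs.

Lemma xterm_reduced c hs : uniq (map hv hs) -> xred hv (c *: xterm hs).
Proof.
move=> hsu; suff : xred_on hv [set v | v \in map hv hs] (xterm hs).
  by move/(xred_onZ c); apply: xred_onW.
elim: hs hsu => [_|h hs IH /= /andP[hhs hsu]]; first exact: xred_on1.
have -> : [set v | v \in hv h :: map hv hs] = hv h |: [set v | v \in map hv hs].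
  by apply/setP=> v; rewrite !inE.
by apply: xred_on_diff; rewrite ?hvb ?inE //; apply: IH.
Qed.

(** Any difference at [v] is the difference of two differences with the base half-edge [b v], so
    products of the latter span. *)
Lemma xred_xterm_ind (P : E -> Prop) :
  (forall x y, P x -> P y -> P (x + y)) -> (forall (a : R) x, P x -> P (a *: x)) ->
  (forall hs, uniq (map hv hs) -> P (xterm hs)) -> forall x, xred hv x -> P x.
Proof.
move=> PD PZ Pt x [J [a [y [yP ->]]]]; apply: (big_ind P) => [||j _]; [|exact: PD|].
  by rewrite -(scale0r (xterm [::])); apply: (PZ); apply: (Pt).
apply: (PZ).
(* The predicate varies in the induction, so that left multiplication by the factors already split
   off can be absorbed into it. *)
suff Q (vs : seq V) (Q : E -> Prop) : uniq vs ->
    (forall x y, Q x -> Q y -> Q (x + y)) -> (forall (a : R) x, Q x -> Q (a *: x)) ->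
    (forall hs, uniq (map hv hs) -> {subset map hv hs <= vs} -> Q (xterm hs)) ->
    Q (\big[xmul/xone]_(v <- vs) y j v).
  by apply: Q => // [|hs hsu _]; [apply: index_enum_uniq | apply: (Pt)].
elim: vs Q => [|v vs IH] Q /=; first by move=> _ _ _ Qt; rewrite big_nil; apply: (Qt [::]).
move=> /andP[vvs vsu] QD QZ Qt; rewrite big_cons; have [c [d yE]] := yP j v.
pose Q' z := Q (xmul (y j v) z); rewrite -[Q _]/(Q' _); apply: IH => // [z w|e z|hs hsu hvs].
- by rewrite /Q' xmulDr; apply: QD.
- by rewrite /Q' xmulZr; apply: QZ.
have sub : {subset map hv hs <= v :: vs} by move=> w /hvs; rewrite inE orbC => ->.
have Q0 : Q 0 by rewrite -(scale0r (xterm hs)); apply: (QZ); apply: (Qt).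
rewrite /Q' yE xmulDl xmulZl xmul1l; apply: (QD); first by apply: (QZ); apply: (Qt).
rewrite xmul_suml; apply: (big_ind Q) => [||p /andP[/eqP h1 /eqP h2]]; [done | exact: QD |].
rewrite xmulZl; apply: (QZ).
have -> : xgen p.1 - xgen p.2 = (xgen p.1 - xgen (b v)) - (xgen p.2 - xgen (b v)) :> E.
  by rewrite opprB addrA subrK.
have Qd h : hv h = v -> Q (xmul (xgen h - xgen (b v)) (xterm hs)).
  move=> hE; have := Qt (h :: hs); rewrite /= hE; apply.
    by rewrite hsu andbT; apply: contra vvs => /hvs.
  by move=> w; rewrite !inE => /orP[->//|/hvs->]; rewrite orbT.
rewrite xmulBl; apply: (QD); first exact: (Qd).
by rewrite -scaleN1r; apply: (QZ); apply: Qd.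
Qed.

End Terms.

Section Projection.
Variables (G : graph) (i n : nat).

(** The projection to bidegree [(i, n)]. The guard makes it zero for [n < i], where the subtraction
    [n - i] is truncated. *)
Definition bipart (x : ext G) : ext G :=
  [ffun A : {set halfedge G} => if (#|A| == i) && (i <= n)%N
             then pihomog mdeg (n - i) (x A : {mpoly int[#|edge G|]}) : edge_ring G else 0].

Lemma bipartD : {morph bipart : x y / x + y}.
Proof.
move=> x y; apply/ffunP=> A; rewrite !ffunE; case: ifP => _; last by rewrite addr0.
exact: pihomogD.
Qed.

Lemma bipartB : {morph bipart : x y / x - y}.
Proof.
move=> x y; apply/ffunP=> A; rewrite !ffunE; case: ifP => _; last by rewrite subr0.
exact: pihomogB.
Qed.

Lemma bipart_id x : bidegree i n x -> bipart x = x.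
Proof.
move=> xP; apply/ffunP=> A; rewrite ffunE.
have [->|xA] := eqVneq (x A) 0; first by rewrite pihomog0; case: ifP.
have [m mP] : exists m, m \in msupp (x A : {mpoly int[#|edge G|]}).
  case E: (msupp (x A : {mpoly int[#|edge G|]})) => [|m s]; last by exists m; rewrite mem_head.
  by move/eqP: E; rewrite msupp_eq0 (negPf xA).
rewrite mcoeff_msupp in mP; have [Ai mn] := xP A m mP.
rewrite Ai eqxx -mn leq_addl /= addnK; apply: pihomog_dE; apply/dhomogP => m'.
rewrite mcoeff_msupp => /(xP A)[_ mn'] /=.
by apply: (@addIn i); rewrite mn mn'.
Qed.

Lemma bipart0 x j m : bidegree j m x -> (j, m) != (i, n) -> bipart x = 0.
Proof.
move=> xP ne; apply/ffunP=> A; rewrite !ffunE; case: ifP => // /andP[/eqP Ai le].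
apply/mpolyP=> k; rewrite mcoeff0; apply/eqP; rewrite -[_ == _]negbK; apply/negP=> kP.
have kd : mdeg k = (n - i)%N.
  have /dhomogP := @pihomogP _ _ mdeg (n - i) (x A : {mpoly int[#|edge G|]}).
  by apply; rewrite mcoeff_msupp.
have xk : (x A : {mpoly int[#|edge G|]})@_k != 0.
  apply: contraNneq kP => xk; rewrite pihomogE; apply/eqP.
  rewrite raddf_sum /= big1 // => m' _; rewrite mcoeffZ mcoeffX.
  by case: eqP => [->|]; rewrite ?xk ?mul0r ?mulr0.
have [Aj km] := xP _ _ xk; case/eqP: ne; congr pair; first by rewrite -Aj.
by rewrite -km kd -Aj Ai subnK.
Qed.

End Projection.

Section ConeTerms.
Variable T : rtree.

Fact base_half_subproof (v : vert (cone T)) :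
  v \in ends (inr (odflt (root T) v) : edge (cone T)).
Proof. by case: v => [x|]; rewrite !inE ?eqxx. Qed.

(* At the cone point [None] the choice of the edge to the root is arbitrary. *)
Definition base_half (v : vert (cone T)) : halfedge (cone T) :=
  Sub (v, inr (odflt (root T) v)) (base_half_subproof v).

Lemma hvert_base v : hvert (base_half v) = v. Proof. by []. Qed.
Lemma hedge_base v : hedge (base_half v) = inr (odflt (root T) v). Proof. by []. Qed.

(** The base half-edge at a tree vertex lies on the edge to the cone point, so it descends to a
    quotient tree as soon as its vertex does; at the cone point it descends because the root always
    does. Hence it adds no vertex to the count. *)
Definition cterm (hs : seq (halfedge (cone T))) : ext (cone T) :=
  xterm (graph_ext (cone T)) (@hvert _) base_half hs.

Definition term (es : seq (edge (cone T))) hs : ext (cone T) :=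
  (\prod_(e <- es) evar e) *: cterm hs.

Lemma term_reduced es hs : uniq (map (@hvert _) hs) -> reduced (term es hs).
Proof.
exact: (@xterm_reduced _ _ (graph_ext (cone T)) _ _ _ hvert_base).
Qed.

Lemma cterm_bidegree hs : bidegree (size hs) (size hs) (cterm hs).
Proof.
elim: hs => [|h hs IH]; first exact: bidegree1.
rewrite /cterm /= emulBl; apply: bidegreeB; exact: bidegree_gen.
Qed.

Lemma term_bidegree es hs : bidegree (size hs) (size es + size hs) (term es hs).
Proof.
apply: bidegree_scale; last exact: cterm_bidegree.
elim: es => [|e es IH]; first by rewrite big_nil; apply: dhomog1.
by rewrite big_cons; apply: (dhomogM (d := 1)) => //; apply: evar_homog.
Qed.

Lemma reduced_term_ind (i n : nat) (P : ext (cone T) -> Prop) :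
  P 0 -> (forall x y, P x -> P y -> P (x - y)) ->
  (forall es hs, uniq (map (@hvert _) hs) -> (size es + size hs)%N = n -> size hs = i ->
     P (term es hs)) ->
  forall x, reduced x -> bidegree i n x -> P x.
Proof.
move=> P0 PB Pt x xr xb; rewrite -(bipart_id xb) -[x]scale1r.
have PD y z : P y -> P z -> P (y + z).
  by move=> Py Pz; rewrite -[z]opprK; apply: (PB) => //; rewrite -sub0r; apply: (PB).
(* The coefficient is quantified inside [Q]: multiplication by polynomials changes the bidegree, and
   [P] is only assumed closed under differences. *)
pose Q (y : graph_ext (cone T)) := forall a : edge_ring (cone T), P (bipart i n (a *: y)).
suff : Q x by apply.
apply: (@xred_xterm_ind _ _ (graph_ext (cone T)) _ (@hvert _) base_half Q) xr =>
  [y z Qy Qz a|c y Qy a|hs hsu].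
- by rewrite scalerDr bipartD; apply: PD.
- by rewrite scalerA.
have Qes es : P (bipart i n (term es hs)).
  have [[hi en]|ne] := pselect (size hs = i /\ (size es + size hs)%N = n).
    rewrite bipart_id; first exact: Pt.
    by rewrite -hi -en hi -hi; apply: term_bidegree.
  rewrite (bipart0 (@term_bidegree es hs)) //; apply/eqP=> -[E1 E2]; exact: ne.
suff Qa (a : edge_ring (cone T)) : forall es,
  P (bipart i n ((a * \prod_(e <- es) evar e) *: cterm hs)).
  by move=> a; have := Qa a [::]; rewrite big_nil mulr1.
elim/edge_ring_ind: a => [|a c IHa IHc|e a IH] es; first by rewrite mul1r; apply: Qes.
  rewrite mulrBl (_ : (_ - _) *: _ = (a * \prod_(e <- es) evar e) *: cterm hs -
    (c * \prod_(e <- es) evar e) *: cterm hs); last exact: scalerBl.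
  by rewrite bipartB; apply: (PB).
by have := IH (e :: es); rewrite big_cons mulrCA mulrA.
Qed.

End ConeTerms.

(** * Descent of terms to quotient trees *)

Section Descent.
Variables (S T : rtree) (f : rhom S T).

(* [x] determines the edge [e]: it is the lower endpoint of an edge of the tree, or the
   endpoint of an edge to the cone point. *)
Definition owner (U : rtree) (e : edge (cone U)) (x : U) : Prop :=
  match e with
  | inl A => x != root U /\ val A = [set x; tpar x]
  | inr w => w = x
  end.

Lemma owner_exists (U : rtree) (e : edge (cone U)) : exists x, owner e x.
Proof.
case: e => [A|w]; last by exists w.
by have [x xr AE] := tedgeP A; exists x.
Qed.

(** When the lower endpoint [x] of a tree edge is a fibre top, its parent lies in another fibre, so
    the edge is not contracted and [rhom_tpar] identifies its image. *)
Lemma edge_descends r e x w : lifts f r -> owner e x -> x = top_of f w -> exists e', r e' = e.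
Proof.
case=> rr rl; case: e => [A|y] /=; last by move=> -> ->; exists (inr w); rewrite rr.
case=> xr AE xw; have wr : w != root T.
  by apply: contraNneq xr => wr; rewrite xw wr top_of_root.
exists (inl (parent_edge wr)); have [B -> BE] := rl (parent_edge wr).
congr inl; apply: (edge_lift_uniq BE); rewrite -[val A]/(sval A) AE imsetU1 imset_set1 /=.
have fx : f x = w by rewrite xw top_ofK.
have [E|[_ ->]] := rhom_tpar f xr; last by rewrite fx.
have /tltNge/negP[] := tpar_gt xr.
by rewrite [X in tle _ X]xw -top_of_galois E fx.
Qed.

Definition covers_half (h : halfedge (cone S)) : Prop :=
  (exists2 x, owner (hedge h) x & exists w, x = top_of f w) /\
  (forall x, hvert h = Some x -> exists w, x = top_of f w).

(** Edges and half-edges are lowered one by one, and [cone_map_diff] recovers each difference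
    exactly. The tree vertices involved are tops, on which [f] is injective, so the vertices of the
    half-edges stay distinct. *)
Lemma term_descends es hs :
  (forall e, e \in es -> exists2 x, owner e x & exists w, x = top_of f w) ->
  (forall h, h \in hs -> covers_half h) -> uniq (map (@hvert _) hs) ->
  exists es' hs', [/\ size es' = size es, size hs' = size hs, uniq (map (@hvert _) hs')
    & chain_map f (@term T es' hs') = @term S es hs].
Proof.
have [r [M phiP]] := chain_mapP f; case: (phiP) => rl tM aM => esP hsP hsu.
have [es' [es's es'E]] : exists es', size es' = size es /\ map r es' = es.
  elim: es esP => [|e es IH] esP; first by exists [::].
  have [|es' [es's es'E]] := IH; first by move=> e' e'P; apply: esP; rewrite inE e'P orbT.
  have [x ex [w xw]] := esP e (mem_head _ _).
  have [e' e'E] := edge_descends rl ex xw.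
  by exists (e' :: es'); rewrite /= es's es'E e'E.
suff [hs' [hs's hs'v hs'E]] : exists hs' : seq (halfedge (cone T)), [/\ size hs' = size hs,
    map (@hvert (cone T)) hs' = map (omap f) (map (@hvert (cone S)) hs) &
      chain_map f (cterm hs') = cterm hs].
  exists es', hs'; split=> //.
    rewrite hs'v map_inj_in_uniq // => u v /mapP[h hh ->] /mapP[k kk ->] {hs'v hs'E hs's}.
    have [_ hv] := hsP h hh; have [_ kv] := hsP k kk.
    case Eh: (hvert h) hv => [x|]; case Ek: (hvert k) kv => [y|] //= kv hv [].
    have [w ->] := hv _ erefl; have [w' ->] := kv _ erefl.
    by rewrite !top_ofK => ->.
  apply: etrans (algmapZ aM _ _) _; rewrite hs'E /term -es'E; congr (_ *: _).
  elim: (es') => [|e es1 IH]; first by rewrite !big_nil; apply: edge_map1.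
  rewrite map_cons !big_cons; apply: etrans (edge_mapM _ _ _) _.
  by rewrite IH edge_map_evar.
elim: hs hsP {hsu} => [|h hs IH] hsP; first by exists [::]; split=> //; apply: (algmap1 aM).
have [|hs' [hs's hs'v hs'E]] := IH; first by move=> k kP; apply: hsP; rewrite inE kP orbT.
have [[x hx [w xw]] hv] := hsP h (mem_head _ _).
have [e' eE] := edge_descends rl hx xw.
have [h' [h'v h'e]] := lift_down (tr_ends tM) (esym eE).
exists (h' :: hs'); split; [by rewrite /= hs's | by rewrite /= hs'v h'v |].
apply: etrans (algmap_diff aM h' (base_half (hvert h')) _) _.
rewrite -/(cterm hs') -/(chain_map f) hs'E.
rewrite (cone_map_diff (h' := h) (k' := base_half (hvert h)) phiP) //.
- by rewrite h'e eE.
(* The base half-edge is a lift too: either its vertex is a top, or it is the cone point, and then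
   the root is a top. *)
- rewrite !hedge_base h'v /=; case: rl => rr _; rewrite rr.
  case E: (hvert h) => [y|] /=; last by rewrite top_of_root.
  by have [w' ->] := hv _ E; rewrite top_ofK.
Qed.

End Descent.

Lemma mem_In (A : eqType) (x : A) s : x \in s <-> List.In x s.
Proof.
elim: s => //= y s IH; rewrite inE; split=> [/orP[/eqP->|/IH]|[->|/IH->]].
- by left.
- by right.
- by rewrite eqxx.
- by rewrite orbT.
Qed.

(** * Trees of bounded size *)

Section SmallTrees.
Variable k : nat.
Local Notation code := ('I_k * {ffun 'I_k * 'I_k -> bool})%type.

(** Coding by a root and a relation on ['I_k] makes the trees with [k] vertices a finite list,
    complete up to isomorphism. *)
Definition code_tree (p : code) : seq rtree :=
  match pselect (tree_order p.1 (fun x y => p.2 (x, y))) with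
  | left leP => [:: order_rtree leP]
  | right _ => [::]
  end.

Definition trees_of_size : seq rtree := List.flat_map code_tree (enum {: code}).

Lemma trees_of_size_card T : List.In T trees_of_size -> #|T| = k.
Proof.
case/List.in_flat_map=> p [_]; rewrite /code_tree; case: pselect => //= leP [<-|//].
by rewrite card_ord.
Qed.

Lemma trees_of_size_exists (r : 'I_k) (le : rel 'I_k) : tree_order r le ->
  exists (T : rtree) (v : 'I_k -> T), [/\ List.In T trees_of_size, bijective v,
    v r = root T & forall x y, tle (v x) (v y) = le x y].
Proof.
move=> leP; pose p : code := (r, [ffun q => le q.1 q.2]).
have leE : (fun x y => p.2 (x, y)) = le by apply/funext=> x; apply/funext=> y; rewrite ffunE.
have leP' : tree_order p.1 (fun x y => p.2 (x, y)) by rewrite leE.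
have [leP'' pE] : exists leP'',
  code_tree p = [:: order_rtree (leP'' : tree_order p.1 (fun x y => p.2 (x, y)))].
  by rewrite /code_tree; case: pselect => [q|//]; exists q.
exists (order_rtree leP''), id; split=> //.
- apply/List.in_flat_map; exists p; split; last by rewrite pE; left.
  by apply/mem_In; rewrite mem_enum.
- by exists id.
- by move=> x y; rewrite (order_rtree_tle leP'') ffunE.
Qed.

End SmallTrees.

(** The order induced on [W] is again that of a rooted tree, and its inclusion is an order embedding
    preserving the root, hence the map of fibre tops of a contraction. *)
Lemma small_quotient (T : rtree) (W : {set T}) : root T \in W ->
  exists (S : rtree) (f : rhom T S), List.In S (trees_of_size #|W|) /\
    forall x, x \in W -> exists w, x = top_of f w.
Proof.
move=> rW; pose ev : 'I_#|W| -> T := fun j => enum_val j.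
pose le : rel 'I_#|W| := fun a c => tle (ev a) (ev c).
have ev_r : ev (enum_rank_in rW (root T)) = root T by rewrite /ev enum_rankK_in.
have ev_inj : injective ev by apply: enum_val_inj.
have leP : tree_order (enum_rank_in rW (root T)) le.
  apply/and5P; split.
  - by apply/forallP=> a; apply: tle_refl.
  - by apply/forallP=> a; rewrite /le ev_r; apply: tle_root.
  - apply/forallP=> a; apply/forallP=> c; apply/implyP=> /andP[ac ca].
    exact/eqP/ev_inj/tle_anti.
  - apply/forallP=> a; apply/forallP=> c; apply/forallP=> d; apply/implyP=> /andP[].
    exact: tle_trans.
  - apply/forallP=> a; apply/forallP=> c; apply/forallP=> d; apply/implyP=> /andP[].
    exact: tle_chain.
have [S [v [SL [u vu uv] vr v_le]]] := trees_of_size_exists leP.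
pose m w := ev (u w).
have m_le x y : tle (m x) (m y) = tle x y by rewrite -[LHS]/(le (u x) (u y)) -v_le !uv.
have m_r : m (root S) = root T by rewrite /m -vr vu ev_r.
exists S, (rhom_of m_le m_r); split=> // x xW; exists (v (enum_rank_in rW x)).
by rewrite top_of_rhom_of /m vu /ev enum_rankK_in.
Qed.

(** * Generators, smallness and finite generation of the homology *)

Section Generation.
Variables n i : nat.

(** The sizes run up to [n + i + 1]: the [n + i] vertices charged to a term, and the root. *)
Definition small_trees : seq rtree :=
  List.flat_map trees_of_size (iota 0 (n + i).+2).

Lemma small_trees_card T : List.In T small_trees -> (#|{: tedge T}| <= n + i)%N.
Proof.
case/List.in_flat_map=> k [kL /trees_of_size_card Tk].
move/mem_In: kL; rewrite mem_iota add0n => /andP[_ klt].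
by rewrite -ltnS; apply: leq_trans (card_tedge T) _; rewrite Tk -ltnS.
Qed.

(** Tuples of fixed lengths over finite types make these terms finitely many. *)
Definition tree_generators (S : rtree) : seq {T : rtree & chains T} :=
  List.flat_map (fun t : (n - i).-tuple (edge (cone S)) * i.-tuple (halfedge (cone S)) =>
    match pselect (uniq (map (@hvert _) t.2)) with
    | left hsu => [:: existT (fun T : rtree => chains T) S
        (Reduced (asboolT (@term_reduced S t.1 t.2 hsu)))]
    | right _ => [::]
    end)
  (enum {: (n - i).-tuple (edge (cone S)) * i.-tuple (halfedge (cone S))}).

Definition generators : seq {T : rtree & chains T} := List.flat_map tree_generators small_trees.

Lemma generators_tree p : List.In p generators -> List.In (tag p) small_trees.
Proof.
case/List.in_flat_map=> S [SL /List.in_flat_map[t [_]]].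
by case: pselect => //= hsu [<-|//].
Qed.

Lemma generators_term S es hs : List.In S small_trees -> uniq (map (@hvert (cone S)) hs) ->
  size es = (n - i)%N -> size hs = i ->
  exists2 c : chains S, reduced_val c = term es hs &
    List.In (existT (fun T : rtree => chains T) S c) generators.
Proof.
move=> SL hsu /eqP es_n /eqP hs_i.
pose t := (Tuple es_n, Tuple hs_i).
exists (Reduced (asboolT (@term_reduced S t.1 t.2 hsu))) => //.
apply/List.in_flat_map; exists S; split=> //; apply/List.in_flat_map; exists t; split.
  by apply/mem_In; rewrite mem_enum.
case: pselect => // hsu'; left; apply: (congr1 (existT (fun T : rtree => chains T) S)).
exact: reduced_val_inj.
Qed.

Lemma small_tree_cover (T : rtree) (ws : seq T) : (size ws <= n + i)%N ->
  exists (S : rtree) (f : rhom T S), List.In S small_trees /\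
    forall x, x \in ws -> exists w, x = top_of f w.
Proof.
move=> sw; pose W := [set x in root T :: ws].
have rW : root T \in W by rewrite inE mem_head.
have [S [f [SL fW]]] := small_quotient rW; exists S, f; split; last first.
  by move=> x xw; apply: fW; rewrite !inE xw orbT.
apply/List.in_flat_map; exists #|W|; split=> //; apply/mem_In; rewrite mem_iota add0n /= ltnS.
by rewrite cardsE (leq_trans (card_size _)).
Qed.

Lemma chains_spanned T (x : chains T) : bidegree i n (reduced_val x) -> spanned generators x.
Proof.
move=> xb; pose P (y : ext (cone T)) := exists2 c : chains T, reduced_val c = y &
  spanned generators c.
suff [c cx sc] : P (reduced_val x) by rewrite -(reduced_val_inj cx).
apply: (reduced_term_ind (i := i) (n := n)) xb; last exact: reduced_valP.
- by exists 0 => //; apply: Spanned0.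
- by move=> y z [c <- sc] [d <- sd]; exists (c - d) => //; apply: SpannedB.
move=> es hs hsu esn hsi.
have [own ownP] := choice (@owner_exists T).
pose vs := pmap (fun h : halfedge (cone T) => hvert h) hs.
(* One vertex for each edge of [es], and two for each half-edge of [hs], or one if it lies at the
   cone point, which [pmap] drops. Since [size es + size hs = n] and [size hs = i], at most [n + i]
   in all. *)
have [|S [f [SL fW]]] := @small_tree_cover T (map own es ++ map (own \o @hedge _) hs ++ vs).
  rewrite !size_cat !size_map size_pmap -esn -hsi -addnA leq_add2l leq_add2l.
  exact: count_size.
have [||//|es' [hs' [es's hs's hsu' E]]] := @term_descends _ _ f es hs.
- move=> e ee; exists (own e); first exact: ownP.
  by apply: fW; rewrite mem_cat map_f.
- move=> h hh; split=> [|v hv].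
    exists (own (hedge h)); first exact: ownP.
    by apply: fW; rewrite !mem_cat (map_f (own \o @hedge _) hh) orbT.
  by apply: fW; rewrite !mem_cat mem_pmap -hv map_f ?orbT.
have [||c cE cL] := generators_term (es := es') SL hsu'.
- by rewrite es's -esn hsi addnK.
- by rewrite hs's.
exists (act chains f c); last exact: (SpannedG (p := existT (fun T : rtree => chains T) S c)).
by rewrite -E -cE.
Qed.

Definition hom_id (M : rt_module) : module_hom M M :=
  @ModuleHom M M (fun T x => x) (fun T x y => erefl) (fun S T f x => erefl).

Local Notation N := (principal_sum (map tag generators)).

(** Cycles are pulled back to the sum of principal projectives, where noetherianity is available.
    Homology is a quotient of the resulting submodule, which serves both smallness and finite
    generation. *)
Definition cycle_family (T : rtree) (x : N T) : Prop :=
  is_cycle i n (reduced_val (@yoneda chains generators T x)).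

Lemma cycle_family_sub : subfamily cycle_family.
Proof.
split=> [T|T x y Kx Ky|S T f x Kx]; rewrite /cycle_family.
- have [z zE] : exists z : cycle_type (cone T) i n, cycle_val z = 0 by exists 0.
  by rewrite yoneda0 -[reduced_val 0]/(0 : ext _) -zE; apply: cycleP.
- have [z zE] := cycle_of Kx; have [w wE] := cycle_of Ky.
  by rewrite yonedaB reduced_valB -zE -wE -cycle_valB; apply: cycleP.
- rewrite yoneda_act; have [r [M p]] := chain_mapP f; exact: (cone_map_cycle p).
Qed.

Local Notation K := (submodule cycle_family_sub).

Definition class_map (T : rtree) (x : K T) : homology (cone T) i n :=
  hclass (projT1 (cid (cycle_of (sub_valP x)))).

Lemma class_mapE T (x : K T) z :
  cycle_val z = reduced_val (@yoneda chains generators T (sub_val x)) -> class_map x = hclass z.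
Proof.
rewrite /class_map; case: (cid _) => w /= wx zx.
by congr hclass; apply: val_inj; apply: etrans wx (esym zx).
Qed.

Lemma class_mapB T : {morph @class_map T : x y / x - y}.
Proof.
move=> x y; have [z zE] := cycle_of (sub_valP x); have [w wE] := cycle_of (sub_valP y).
rewrite (class_mapE zE) (class_mapE wE) -hclassB; apply: class_mapE.
by rewrite cycle_valB zE wE sub_valB yonedaB.
Qed.

Lemma class_mapD T : {morph @class_map T : x y / x + y}.
Proof.
move=> x y; have [z zE] := cycle_of (sub_valP x); have [w wE] := cycle_of (sub_valP y).
rewrite (class_mapE zE) (class_mapE wE) -hclassD; apply: class_mapE.
by rewrite cycle_valD zE wE sub_valD yonedaD reduced_valD.
Qed.

Lemma class_map_act S T (f : rhom S T) (x : K T) :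
  class_map (act K f x) = act (homology_module n i) f (class_map x).
Proof.
have [z zE] := cycle_of (sub_valP x); rewrite (class_mapE zE) /=.
rewrite (hact_class (cycle_mapE f z)); apply: class_mapE.
by rewrite cycle_mapE zE /= yoneda_act.
Qed.

Lemma class_map_surj (T : rtree) (y : homology (cone T) i n) : exists x : K T, class_map x = y.
Proof.
have [z <-] := hclass_surj y; have [zr zb _] := cycleP z.
have [x xE] := yoneda_spanned (@chains_spanned T (Reduced (asboolT zr)) zb).
have xK : cycle_family x by rewrite /cycle_family xE; apply: cycleP.
by exists (sub_elt cycle_family_sub xK); apply: class_mapE; rewrite /= xE.
Qed.

Definition class_hom : module_hom K (RTModule (homology_module n i)) :=
  @ModuleHom K (RTModule (homology_module n i)) class_map class_mapD class_map_act.

Lemma homology_small : small (n + i) (RTModule (homology_module n i)).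
Proof.
exists N; split; last first.
  exists K, (sub_inclusion cycle_family_sub), class_hom; split=> [T|T y].
    exact: sub_val_inj.
  exact: class_map_surj.
exists (map tag generators), (hom_id N); split; last by move=> T y; exists y.
have : forall p, List.In p generators -> (#|{: tedge (tag p)}| <= n + i)%N.
  by move=> p /generators_tree/small_trees_card.
elim: generators => //= p L IH Lsmall.
by rewrite Lsmall ?IH; [|move=> q qL; apply: Lsmall; right|left].
Qed.

Lemma homology_fin_gen : fin_gen (RTModule (homology_module n i)).
Proof.
have [L LP] := @noetherian_principal_sum (map tag generators) _ cycle_family_sub.
have [L' L'P] := submodule_spanned cycle_family_sub LP.
apply: fin_gen_spanned => T y; have [x <-] := class_map_surj y.
exact: (@spanned_hom K (RTModule (homology_module n i)) class_map class_mapB class_map_act _ _ _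
  (L'P T x)).
Qed.

End Generation.

Theorem theorem1p6 (n i : nat) :
  exists M : module_on (fun T : rtree => homology (cone T) i n),
    (forall (S T : rtree) (f : rhom S T), is_structure_map f (act M f)) /\
    small (n + i) (RTModule M) /\
    fin_gen (RTModule M).
Proof.
exists (homology_module n i); split; first exact: homology_structure_map.
by split; [apply: homology_small | apply: homology_fin_gen].
Qed.
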